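(* Let $\mathfrak{m}\Pi\mathrm{Sym}$ and $\mathfrak{m}\bar\Pi\mathrm{Sym}$ be the linearly compact $\mathbb{Z}[\beta]$-modules with pseudobases $\{K^{(\beta)}_\alpha\}$ and $\{\bar K^{(\beta)}_\alpha\}$ respectively ($\alpha$ ranging over all peak compositions), and let $\mathfrak{m}\Pi\mathrm{Sym}_{\mathbb{Q}[\beta]}$ be the linearly compact $\mathbb{Q}[\beta]$-module with pseudobasis $\{K^{(\beta)}_\alpha\}$. Then both $\mathfrak{m}\Pi\mathrm{Sym}$ and $\mathfrak{m}\bar\Pi\mathrm{Sym}$ are LC-Hopf subalgebras of $\mathfrak{m}\mathrm{QSym}$, and $$\mathfrak{m}\bar\Pi\mathrm{Sym}=\mathfrak{m}\mathrm{QSym}\cap\mathfrak{m}\Pi\mathrm{Sym}_{\mathbb{Q}[\beta]}\supseteq\mathfrak{m}\Pi\mathrm{Sym}.$$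
   Context: Quasisymmetric functions. $\mathfrak{m}\mathrm{QSym}$ is the set of all $f\in\mathbb{Z}[\beta][[x_1,x_2,\dots]]$ (unbounded degree allowed) such that for all $a_1,\dots,a_k\in\mathbb{Z}_{>0}$ the coefficients of $x_1^{a_1}\cdots x_k^{a_k}$ and $x_{i_1}^{a_1}\cdots x_{i_k}^{a_k}$ agree for all $i_1<\dots<i_k$. It is the LC-module with pseudobasis the monomial quasisymmetric functions $M_\alpha=\sum_{i_1<\dots<i_l}x_{i_1}^{\alpha_1}\cdots x_{i_l}^{\alpha_l}$ ($M_\emptyset=1$), $\alpha=(\alpha_1,\dots,\alpha_l)$ ranging over all compositions (finite sequences of positive integers); elements are arbitrary infinite linear combinations. It is an LC-Hopf algebra under power series multiplication, with continuous coproduct $\Delta(M_\alpha)=\sum_{\alpha=\alpha'\alpha''}M_{\alpha'}\otimes M_{\alpha''}$ (over all ways to write $\alpha$ as a concatenation) and counit $M_\emptyset\mapsto1$, $M_\alpha\mapsto0$ for $\alpha\ne\emptyset$. A linearly compact module with pseudobasis $\{b_i\}$ is the set of arbitrary (possibly infinite) linear combinations of the $b_i$ with the product topology; the completed tensor product $B\hat\otimes B'$ has pseudobasis $\{b_i\otimes b'_j\}$. An LC-Hopf algebra is the continuous dual of a Hopf algebra structure on the free module with dual basis (all structure maps being continuous linear, with $\hat\otimes$ in place of $\otimes$). An LC-Hopf subalgebra is a submodule, linearly compact with its own pseudobasis, to which the structure maps restrict making it an LC-Hopf algebra (so the coproduct takes values in its completed tensor square). Intersections are taken inside the analogue of $\mathfrak{m}\mathrm{QSym}$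 over $\mathbb{Q}[\beta]$. Multipeak functions. For a composition $\alpha=(\alpha_1,\dots,\alpha_k)$ let $|\alpha|=\sum_i\alpha_i$ and $I(\alpha)=\{\alpha_1,\alpha_1+\alpha_2,\dots,\alpha_1+\dots+\alpha_{k-1}\}$. $\alpha$ is a peak composition if $\alpha_i\ge2$ for $1\le i<k$. Let $\mathbb{M}=\{1'<1<2'<2<\cdots\}$, $|i'|=|i|=i$. For finite nonempty $S,T\subset\mathbb{M}$: $S\prec T$ means $\max S<\min T$, $S\preceq T$ means $\max S\le\min T$, and $x^S=\prod_{i\in S}x_{|i|}$. For a tuple $S=(S_1,\dots,S_N)$ put $|S|=\sum|S_i|$, $x^S=\prod_i x^{S_i}$. For a peak composition $\alpha$ with $|\alpha|=N$: $K^{(\beta)}_\alpha=\sum_S\beta^{|S|-N}x^S$ over $N$-tuples of finite nonempty subsets $S_i\subset\mathbb{M}$ with $S_1\preceq\cdots\preceq S_N$, $S_i\cap S_{i+1}\subset\{1',2',\dots\}$ if $i\in I(\alpha)$, and $S_i\cap S_{i+1}\subset\{1,2,\dots\}$ if $i\notin I(\alpha)$. $\bar K^{(\beta)}_\alpha=\sum_S\beta^{|S|-N}x^S$ over $N$-tuples of finite nonempty subsets $S_i\subset\mathbb{M}$ with $S_1\preceq\cdots\preceq S_N$, $S_i\prec S_{i+1}$ if $i\in I(\alpha)$, $S_{i+1}\subseteq\mathbb{Z}_{>0}$ if $i\in\{0\}\cup I(\alpha)$, and $S_i\cap S_{i+1}\subseteq\mathbb{Z}_{>0}$ if $i\notin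 I(\alpha)$. Each of the two families is linearly independent and each function involves only $x$-monomials of degree at least $|\alpha|$. *)

(* Defs.v *)
From HB Require Import structures.
From mathcomp Require Import all_boot all_order all_algebra.
From mathcomp Require Import finmap.
From mathcomp Require Import mathcomp_extra boolp classical_sets functions.
From mathcomp Require Import cardinality fsbigop topology function_spaces.
From mathcomp.multinomials Require Import monalg.

Set Implicit Arguments.
Unset Strict Implicit.
Unset Printing Implicit Defensive.

Import GRing.Theory.
Local Open Scope classical_set_scope.
Local Open Scope ring_scope.

(* Linearly compact modules over a (discrete) ring R, in coordinates: the  *)
(* LC-module with pseudobasis indexed by I is the product R^I, a function  *)
(* u standing for the infinite combination of the pseudobasis with         *)
(* coefficients u i.  Its completed tensor product with R^J is R^(I * J).  *)

Notation lctop R I := (prod_topology (fun _ : I => discrete_topology R)).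

Definition lc_map (R : comNzRingType) (I J : choiceType)
    (F : (I -> R) -> (J -> R)) : Prop :=
  linear (F : (I -> R^o) -> (J -> R^o)) /\
  continuous (F : lctop R I -> lctop R J).

Definition lc_form (R : comNzRingType) (I : choiceType)
    (F : (I -> R) -> R) : Prop :=
  linear (F : (I -> R^o) -> R^o) /\
  continuous (F : lctop R I -> discrete_topology R).

Definition lc_pure (R : comNzRingType) (I J : choiceType)
    (u : I -> R) (v : J -> R) : I * J -> R :=
  fun p => u p.1 * v p.2.

(* F (x) G on completed tensor products: apply G to the second coordinate, *)
(* then F to the first.  For F and G linear and continuous this is the     *)
(* continuous linear map sending u (x) v to F u (x) G v.                   *)
Definition lc_tens (R : comNzRingType) (I I' J J' : choiceType)
    (F : (I -> R) -> (J -> R)) (G : (I' -> R) -> (J' -> R))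
    (w : I * I' -> R) : J * J' -> R :=
  fun p => F (fun i => G (fun i' => w (i, i')) p.2) p.1.

(* The infinite linear combination of the family b with coefficients c,    *)
(* computed coordinatewise; meaningful when the family is summable.        *)
Definition lc_comb (R : comNzRingType) (I J : choiceType)
    (b : I -> J -> R) (c : I -> R) : J -> R :=
  fun j => \sum_(i \in [set: I]) c i * b i j.

Definition summable (R : comNzRingType) (I J : choiceType)
    (b : I -> J -> R) : Prop :=
  forall j, finite_set [set i | b i j != 0].

Definition lc_span (R : comNzRingType) (I J : choiceType)
    (b : I -> J -> R) : set (J -> R) :=
  range (lc_comb b).

Definition pseudobasis (R : comNzRingType) (I J : choiceType)
    (b : I -> J -> R) (H : set (J -> R)) : Prop :=
  [/\ summable b, injective (lc_comb b) & H = lc_span b].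

Record lc_ops (R : comNzRingType) (I : choiceType) := LCOps {
  lc_mul : (I * I -> R) -> (I -> R);
  lc_one : I -> R;
  lc_comul : (I -> R) -> (I * I -> R);
  lc_counit : (I -> R) -> R;
  lc_antipode : (I -> R) -> (I -> R)
}.

Definition lc_assoc (R : comNzRingType) (I : choiceType)
    (w : I * I * I -> R) : I * (I * I) -> R :=
  fun p => w (p.1, p.2.1, p.2.2).

(* id (x) flip (x) id *)
Definition lc_midswap (R : comNzRingType) (I : choiceType)
    (w : I * I * (I * I) -> R) : I * I * (I * I) -> R :=
  fun p => w (p.1.1, p.2.1, (p.1.2, p.2.2)).

Record lc_hopf (R : comNzRingType) (I : choiceType) (A : lc_ops R I) : Prop :=
  LCHopf {
  lc_mul_map : lc_map (lc_mul A);
  lc_comul_map : lc_map (lc_comul A);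
  lc_counit_form : lc_form (lc_counit A);
  lc_antipode_map : lc_map (lc_antipode A);
  lc_mulA : forall w : I * I * I -> R,
    lc_mul A (lc_tens (lc_mul A) id w) =
    lc_mul A (lc_tens id (lc_mul A) (lc_assoc w));
  lc_mul1l : forall u, lc_mul A (lc_pure (lc_one A) u) = u;
  lc_mul1r : forall u, lc_mul A (lc_pure u (lc_one A)) = u;
  lc_comulA : forall u,
    lc_assoc (lc_tens (lc_comul A) id (lc_comul A u)) =
    lc_tens id (lc_comul A) (lc_comul A u);
  lc_counitl : forall u,
    (fun j => lc_counit A (fun i => lc_comul A u (i, j))) = u;
  lc_counitr : forall u,
    (fun i => lc_counit A (fun j => lc_comul A u (i, j))) = u;
  lc_comulM : forall w : I * I -> R,
    lc_comul A (lc_mul A w) =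
    lc_tens (lc_mul A) (lc_mul A)
      (lc_midswap (lc_tens (lc_comul A) (lc_comul A) w));
  lc_comul1 : lc_comul A (lc_one A) = lc_pure (lc_one A) (lc_one A);
  lc_counitM : forall w : I * I -> R,
    lc_counit A (lc_mul A w) =
    lc_counit A (fun i => lc_counit A (fun j => w (i, j)));
  lc_counit1 : lc_counit A (lc_one A) = 1;
  lc_antipodel : forall u,
    lc_mul A (lc_tens (lc_antipode A) id (lc_comul A u)) =
    (fun i => lc_counit A u * lc_one A i);
  lc_antipoder : forall u,
    lc_mul A (lc_tens id (lc_antipode A) (lc_comul A u)) =
    (fun i => lc_counit A u * lc_one A i)
}.

(* The inclusion of the LC-submodule with pseudobasis b, which identifies  *)
(* it with R^I, is phi := lc_comb b; the structure maps of A restrict to   *)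
(* it along phi (along phi (x) phi for the completed tensor square).       *)
Definition lc_restricts (R : comNzRingType) (I J : choiceType)
    (A : lc_ops R J) (b : I -> J -> R) (B : lc_ops R I) : Prop :=
  let phi := lc_comb b in
  [/\ forall w, phi (lc_mul B w) = lc_mul A (lc_tens phi phi w),
      phi (lc_one B) = lc_one A,
      forall u, lc_tens phi phi (lc_comul B u) = lc_comul A (phi u),
      forall u, lc_counit B u = lc_counit A (phi u)
    & forall u, phi (lc_antipode B u) = lc_antipode A (phi u)].

Definition lc_hopf_sub (R : comNzRingType) (I J : choiceType)
    (A : lc_ops R J) (H : set (J -> R)) (b : I -> J -> R) : Prop :=
  pseudobasis b H /\ exists B : lc_ops R I, lc_hopf B /\ lc_restricts A b B.

(* Power series in x_1, x_2, ...: the index i : nat stands for x_(i+1).    *)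

Notation monomial := {cmonom nat}.
Notation pseries R := (monomial -> R).

(* x_(i_1)^(a_1) ... x_(i_k)^(a_k) *)
Definition xmon (i a : seq nat) : monomial :=
  \big[mmul/mone]_(p <- zip i a) expcmn (ucm p.1) p.2.

Definition mon_sum (R : comNzRingType) (T : choiceType)
    (D : set T) (c : T -> R) (mon : T -> monomial) : pseries R :=
  fun m => \sum_(t \in D) c t * (mon t == m)%:R.

(* Multiplication of power series, as a map on the completed tensor square *)
(* (power series in two alphabets).                                        *)
Definition ps_mul (R : comNzRingType) (w : monomial * monomial -> R) :
    pseries R :=
  fun m => \sum_(p \in [set p | mmul p.1 p.2 = m]) w p.

Definition composition : choiceType := {a : seq nat | all (leq 1) a}.

(* Invariance is tested against the indices 1 < 2 < ... < k. *)
Definition mQSym (R : comNzRingType) : set (pseries R) :=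
  [set f | forall a i : seq nat,
     all (leq 1) a -> size i = size a -> sorted ltn i ->
     f (xmon (iota 0 (size a)) a) = f (xmon i a)].

Arguments mQSym R : clear implicits.

Definition Mqsym (R : comNzRingType) (a : composition) : pseries R :=
  mon_sum [set i : seq nat | size i = size (val a) /\ sorted ltn i]
    (fun=> 1) (fun i => xmon i (val a)).

(* The coordinates of an element of mQSym in the pseudobasis Mqsym. *)
Definition qsym_coord (R : comNzRingType) (f : pseries R) : composition -> R :=
  fun a => f (xmon (iota 0 (size (val a))) (val a)).

Definition qsym_mul (R : comNzRingType) (w : composition * composition -> R) : composition -> R :=
  let phi := lc_comb (@Mqsym R) in qsym_coord (ps_mul (lc_tens phi phi w)).

Definition qsym_one (R : comNzRingType) : composition -> R :=
  fun a => (val a == [::])%:R.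

(* Continuous linear extension of the map sending M_a to the sum of        *)
(* M_a' (x) M_a'' over a = a' ++ a''.                                      *)
Definition qsym_comul (R : comNzRingType) : (composition -> R) -> (composition * composition -> R) :=
  lc_comb (fun (a : composition) (p : composition * composition) =>
    (val a == val p.1 ++ val p.2)%:R).

Definition qsym_counit (R : comNzRingType) (u : composition -> R) : R :=
  \sum_(a \in [set: composition]) u a * (val a == [::])%:R.

Definition qsym_ops (R : comNzRingType) (S : (composition -> R) -> (composition -> R)) :
    lc_ops R composition :=
  LCOps (@qsym_mul R) (@qsym_one R) (@qsym_comul R) (@qsym_counit R) S.

(* The set H of power series is an LC-Hopf subalgebra of mQSym with        *)
(* pseudobasis b.  The antipode of mQSym is the (unique) S that makes its  *)
(* other operations an LC-Hopf algebra.                                    *)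
Definition mQSym_hopf_sub (R : comNzRingType) (I : choiceType)
    (H : set (pseries R)) (b : I -> pseries R) : Prop :=
  [/\ H `<=` mQSym R, pseudobasis b H
    & exists S, lc_hopf (qsym_ops S) /\
        lc_hopf_sub (qsym_ops S) (@qsym_coord R @` H) (@qsym_coord R \o b)].

Definition peak_composition : choiceType :=
  {a : seq nat | all (leq 1) a && all (leq 2) (take (size a).-1 a)}.

(* I(a), without |a| *)
Definition desc (a : seq nat) : seq nat :=
  [seq sumn (take j a) | j <- iota 1 (size a).-1].

(* The alphabet 1' < 1 < 2' < 2 < ... is encoded in order by 0, 1, 2, ...: *)
(* i' is 2(i-1) and i is 2(i-1)+1; the variable x_|c| has index c./2.      *)
Definition primed (c : nat) : bool := ~~ odd c.

Definition fsmax (S : {fset nat}) : nat := \max_(c <- S) c.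
Definition fsmin (S : {fset nat}) : nat := \big[minn/fsmax S]_(c <- S) c.

Definition fsle (S T : {fset nat}) : bool := (fsmax S <= fsmin T)%N.
Definition fslt (S T : {fset nat}) : bool := (fsmax S < fsmin T)%N.

(* S_i, with i counted from 1 *)
Definition blk (S : seq {fset nat}) (i : nat) : {fset nat} :=
  nth fset0 S i.-1.

Definition nblk (S : seq {fset nat}) : nat := (\sum_(T <- S) #|` T|%fset)%N.

Definition mblk (S : seq {fset nat}) : monomial :=
  \big[mmul/mone]_(T <- S) \big[mmul/mone]_(c <- T) ucm c./2.

Definition Kset (a : seq nat) : set (seq {fset nat}) :=
  [set S | let N := sumn a in
   [/\ size S = N /\ (forall T, T \in S -> T != fset0),
       forall i, (1 <= i < N)%N -> fsle (blk S i) (blk S i.+1),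
       forall i, (1 <= i < N)%N -> i \in desc a ->
         {in (blk S i `&` blk S i.+1)%fset, forall c, primed c}
     & forall i, (1 <= i < N)%N -> i \notin desc a ->
         {in (blk S i `&` blk S i.+1)%fset, forall c, ~~ primed c}]].

Definition Kbarset (a : seq nat) : set (seq {fset nat}) :=
  [set S | let N := sumn a in
   [/\ size S = N /\ (forall T, T \in S -> T != fset0),
       forall i, (1 <= i < N)%N -> fsle (blk S i) (blk S i.+1),
       forall i, (1 <= i < N)%N -> i \in desc a ->
         fslt (blk S i) (blk S i.+1),
       forall i, (0 <= i < N)%N -> i \in 0%N :: desc a ->
         {in blk S i.+1, forall c, ~~ primed c}
     & forall i, (1 <= i < N)%N -> i \notin desc a ->
         {in (blk S i `&` blk S i.+1)%fset, forall c, ~~ primed c}]].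

Definition Kpeak (R : comNzRingType) (beta : R) (a : peak_composition) : pseries R :=
  mon_sum (Kset (val a)) (fun S => beta ^+ (nblk S - sumn (val a))) mblk.

Definition Kbarpeak (R : comNzRingType) (beta : R) (a : peak_composition) :
    pseries R :=
  mon_sum (Kbarset (val a)) (fun S => beta ^+ (nblk S - sumn (val a))) mblk.

Definition mPiSym : set (pseries {poly int}) := lc_span (Kpeak ('X : {poly int})).
Definition mPibarSym : set (pseries {poly int}) :=
  lc_span (Kbarpeak ('X : {poly int})).
Definition mPiSymQ : set (pseries {poly rat}) := lc_span (Kpeak ('X : {poly rat})).

Definition psQ (f : pseries {poly int}) : pseries {poly rat} :=
  fun m => map_poly intr (f m).

(* Main.v *)
(* Continuous linear maps between products of copies of R are families of
   finite functionals, so mQSym is handled through its continuous dual, the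
   algebra of noncommutative symmetric functions on H_1, H_2, ...

   Cutting the alphabet after each letter computes the coefficients of K, Kbar
   and of the multifundamental functions L by a transfer matrix on prefixes of
   the composition: an unprimed letter x acts by U(x), a primed one by V(x), and
   V(x) is the inverse of U(-x/(1+beta x)).  Hence the endomorphism Theta dual to
   H(x) |-> H(-x/(1+beta x))^-1 H(x) sends L_a to K_a.  It is a Hopf
   endomorphism because that series is group-like, and K_a depends only on the
   peaks of a; so the span of the peak K_a is the image of Theta and inherits a
   Hopf structure.

   Intertwining the two transfer matrices gives
     K_a = sum over d in {0,1}^l of 2^(l-|d|) beta^|d| Kbar_(a+d).
   This matrix is triangular with powers of 2 on the diagonal, while Kbar is
   unitriangular on peak monomials.  The closure of the Kbar-span under the Hopf
   operations is therefore an identity between finite functionals that may be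
   tested on the K-span, and over Q both spans coincide; integrality of the
   Kbar-coordinates is read off the peak monomials. *)
Require Import Defs.
From mathcomp Require Import all_boot all_order all_algebra.
From mathcomp Require Import finmap.
From mathcomp Require Import boolp classical_sets functions.
From mathcomp Require Import cardinality fsbigop topology function_spaces.
From mathcomp.multinomials Require Import monalg.
From mathcomp Require Import ring zify.

Set Implicit Arguments.
Unset Strict Implicit.
Unset Printing Implicit Defensive.

Import GRing.Theory.
Local Open Scope classical_set_scope.
Local Open Scope ring_scope.


(** * Finite functionals and continuity *)

(** The substitution -x/(1+beta x) is the inverse of x under the formal group law x + y + beta x y.
    At beta = 0 the series becomes H(-x)^-1 H(x) = E(x) H(x), the classical one. The same law
    explains the weights 2 and beta: the two letters of one variable contribute x + x + beta x^2 =
    (2 + beta x) x. The obstacle is that 2 is regular but not invertible in Z[beta], so nothing can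
    be divided back from K to Kbar. The operations on the Kbar-span are therefore defined by
    operating in mQSym and reading off peak coordinates, and what remains to be shown is that
    nothing gets lost. For that a regular diagonal suffices: a finite functional sees finitely many
    coordinates, so if it vanishes on the image of a triangular matrix, downward induction on the
    rank shows that it is zero. A functional given as an explicit finite sum is linear and
    continuous at once, and two of them in different variables commute ([finC]); these facts take
    the place of topological arguments. *)

Section FiniteForms.
Variable R : comNzRingType.

Definition fin (I : Type) (phi : (I -> R) -> R) : Prop :=
  exists s : seq (R * I), forall u, phi u = \sum_(p <- s) p.1 * u p.2.

Definition finmap (I J : Type) (F : (I -> R) -> (J -> R)) : Prop :=
  forall j, fin (fun u => F u j).

Lemma fin_proj (I : Type) (i : I) : fin (fun u => u i).
Proof. by exists [:: (1, i)] => u; rewrite big_seq1 mul1r. Qed.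

Lemma fin_zero (I : Type) : fin (fun _ : I -> R => 0).
Proof. by exists [::] => u; rewrite big_nil. Qed.

Lemma fin_add (I : Type) (phi psi : (I -> R) -> R) :
  fin phi -> fin psi -> fin (fun u => phi u + psi u).
Proof. by move=> [s sE] [t tE]; exists (s ++ t) => u; rewrite big_cat sE tE. Qed.

Lemma fin_scale (I : Type) (a : R) (phi : (I -> R) -> R) :
  fin phi -> fin (fun u => a * phi u).
Proof.
move=> [s sE]; exists [seq (a * p.1, p.2) | p <- s] => u.
by rewrite sE big_map mulr_sumr; apply: eq_bigr => p _ /=; rewrite mulrA.
Qed.

Lemma fin_opp (I : Type) (phi : (I -> R) -> R) :
  fin phi -> fin (fun u => - phi u).
Proof.
by move=> phiP; have [s sE] := fin_scale (-1) phiP; exists s => u; rewrite -sE mulN1r.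
Qed.

Lemma fin_sum (I K : Type) (r : seq K) (P : pred K) (phi : K -> (I -> R) -> R) :
  (forall k, P k -> fin (phi k)) -> fin (fun u => \sum_(k <- r | P k) phi k u).
Proof.
move=> phiP; elim: r => [|k r IHr].
  by exists [::] => u; rewrite !big_nil.
case Pk: (P k).
  have [s sE] := fin_add (phiP k Pk) IHr.
  by exists s => u; rewrite -sE big_cons Pk.
by have [s sE] := IHr; exists s => u; rewrite -sE big_cons Pk.
Qed.

Lemma fin_comp (I J : Type) (phi : (J -> R) -> R) (F : (I -> R) -> (J -> R)) :
  fin phi -> finmap F -> fin (fun u => phi (F u)).
Proof.
move=> [s sE] FP.
have [t tE] : fin (fun u => \sum_(p <- s) p.1 * F u p.2).
  by apply: fin_sum => p _; apply: fin_scale; exact: FP.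
by exists t => u; rewrite sE tE.
Qed.

Lemma finmap_id (I : Type) : finmap (fun u : I -> R => u).
Proof. by move=> i; exact: fin_proj. Qed.

Lemma finmap_comp (I J K : Type) (F : (I -> R) -> (J -> R))
    (G : (J -> R) -> (K -> R)) :
  finmap G -> finmap F -> finmap (fun u => G (F u)).
Proof. by move=> GP FP k; exact: (fin_comp (GP k) FP). Qed.

Lemma finmap_reindex (I J : Type) (h : J -> I) :
  finmap (fun (u : I -> R) j => u (h j)).
Proof. by move=> j; exact: fin_proj. Qed.

Lemma eq_form (I : Type) (phi : (I -> R) -> R) (u v : I -> R) :
  (forall i, u i = v i) -> phi u = phi v.
Proof. by move=> uv; congr phi; apply: funext. Qed.

Section Linearity.
Variables (I : Type) (phi : (I -> R) -> R) (phiP : fin phi).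

Lemma fin_lin a u v : phi (fun i => a * u i + v i) = a * phi u + phi v.
Proof.
case: phiP => s sE; rewrite !sE mulr_sumr -big_split.
by apply: eq_bigr => p _; rewrite mulrDr mulrCA.
Qed.

Lemma fin0E : phi (fun=> 0) = 0.
Proof. by case: phiP => s sE; rewrite sE big1 // => p _; rewrite mulr0. Qed.

Lemma finZE a u : phi (fun i => a * u i) = a * phi u.
Proof.
have := fin_lin a u (fun=> 0); rewrite fin0E addr0 => <-.
by apply: eq_form => i; rewrite addr0.
Qed.

Lemma finDE u v : phi (fun i => u i + v i) = phi u + phi v.
Proof.
have := fin_lin 1 u v; rewrite mul1r => <-.
by apply: eq_form => i; rewrite mul1r.
Qed.

Lemma fin_sumE (K : Type) (r : seq K) (P : pred K) (F : K -> I -> R) :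
  phi (fun i => \sum_(k <- r | P k) F k i) = \sum_(k <- r | P k) phi (F k).
Proof.
elim: r => [|k r IHr].
  rewrite big_nil; transitivity (phi (fun=> 0)); last exact: fin0E.
  by apply: eq_form => i; rewrite big_nil.
transitivity (phi (fun i => (if P k then F k i else 0)
   + \sum_(k <- r | P k) F k i)).
  apply: eq_form => i; rewrite big_cons.
  by case: (P k) => //; rewrite add0r.
rewrite finDE IHr big_cons; case: (P k) => //.
by rewrite fin0E add0r.
Qed.

(** Fubini for functionals in two different variables. Expanding [psi] alone is enough, because
    [phi] is linear and passes through the finite sum. *)
Lemma finC (J : Type) (psi : (J -> R) -> R) (w : I -> J -> R) : fin psi ->
  phi (fun i => psi (fun j => w i j)) = psi (fun j => phi (fun i => w i j)).
Proof.
move=> [t tE]; transitivity (phi (fun i => \sum_(p <- t) p.1 * w i p.2)).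
  by apply: eq_form => i; rewrite tE.
by rewrite fin_sumE tE; apply: eq_bigr => p _; rewrite finZE.
Qed.

End Linearity.

End FiniteForms.

Section Continuity.
Variable R : comNzRingType.

(** Evaluation at [i] is continuous into a discrete space, so the cylinder through [u] is open. A
    finite functional is constant on a finite intersection of such cylinders. *)
Lemma nbhs_coord (I : choiceType) (u : lctop R I) (i : I) :
  nbhs u [set v : lctop R I | v i = u i].
Proof.
have /cvg_sup/(_ i) cvu : nbhs u --> u by exact: cvg_id.
apply: cvu.
have cont := @initial_continuous _ _ (fun f : lctop R I => f i).
exact: (cont u _ (discrete_set1 _)).
Qed.

Lemma fin_continuous (I : choiceType) (phi : (I -> R) -> R) :
  fin phi -> continuous (phi : lctop R I -> discrete_topology R).
Proof.
move=> [s sE] u A /principal_filterP Au; change (nbhs u (phi @^-1` A)).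
have : nbhs u [set v : lctop R I | forall p, p \in s -> v p.2 = u p.2].
  elim: s {sE} => [|p s IHs]; first by apply: filterE => v p; rewrite in_nil.
  apply: (filterS _ (filterI (nbhs_coord u p.2) IHs)) => v [vp vs] q.
  by rewrite inE => /orP[/eqP->|/vs].
move=> nu; apply: (filterS _ nu) => v vu /=; suff -> : phi v = phi u by [].
by rewrite !sE; apply: eq_big_seq => p /vu ->.
Qed.

Lemma finmap_lc_map (I J : choiceType) (F : (I -> R) -> (J -> R)) :
  finmap F -> lc_map F.
Proof.
move=> FP; split.
  move=> a u v; apply: funext => j.
  exact: (fin_lin (FP j)).
move=> u.
have FF : Filter ((F : lctop R I -> lctop R J) @ nbhs (u : lctop R I)).
  exact: fmap_filter.
apply/cvg_sup => j.
apply: (@continuous_comp_initial _ _ _ _ (F : lctop R I -> _)).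
exact: fin_continuous (FP j).
Qed.

Lemma fin_lc_form (I : choiceType) (phi : (I -> R) -> R) :
  fin phi -> lc_form phi.
Proof.
move=> phiP; split; last exact: fin_continuous.
by move=> a u v; exact: (fin_lin phiP).
Qed.

End Continuity.


(** * Restriction of Hopf structures *)

Section CompletedTensor.
Variable R : comNzRingType.
Implicit Types I J K : choiceType.

(** Since [lc_tens] applies its right factor first, the composite runs [G'], [F'], [G], [F], while
    the right-hand side wants [G] before [F']. Exchanging these two by [finC] is the whole content,
    hence the finiteness of exactly this pair. *)
Lemma lc_tens_comp I I' J J' K K' (F : (J -> R) -> (K -> R))
    (G : (J' -> R) -> (K' -> R)) (F' : (I -> R) -> (J -> R))
    (G' : (I' -> R) -> (J' -> R)) (w : I * I' -> R) :
  finmap G -> finmap F' ->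
  lc_tens F G (lc_tens F' G' w) =
  lc_tens (fun u => F (F' u)) (fun u => G (G' u)) w.
Proof.
move=> GP F'P; apply: funext => -[k k'] /=; rewrite /lc_tens /=.
congr (F _ k); apply: funext => j.
exact: (finC (GP k') (fun j' i => G' (fun i' => w (i, i')) j') (F'P j)).
Qed.

Lemma lc_tens_inj I I' J J' (F : (I -> R) -> (J -> R))
    (G : (I' -> R) -> (J' -> R)) :
  injective F -> injective G -> injective (lc_tens F G).
Proof.
move=> Finj Ginj w w' ww'; apply: funext => -[i i'].
have FG j' : (fun i => G (fun i' => w (i, i')) j') =
             (fun i => G (fun i' => w' (i, i')) j').
  by apply: Finj; apply: funext => j; exact: (congr1 (@^~ (j, j')) ww').
have Gi : G (fun i' => w (i, i')) = G (fun i' => w' (i, i')).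
  by apply: funext => j'; exact: (congr1 (@^~ i) (FG j')).
exact: (congr1 (@^~ i') (Ginj _ _ Gi)).
Qed.

Lemma finmap_lc_tens I I' J J' (F : (I -> R) -> (J -> R))
    (G : (I' -> R) -> (J' -> R)) :
  finmap F -> finmap G -> finmap (lc_tens F G).
Proof.
move=> FP GP [j j']; rewrite /lc_tens /=.
apply: (fin_comp (FP j)) => i; apply: (fin_comp (GP j')) => i'.
exact: fin_proj.
Qed.

Lemma lc_tens_pure I I' J J' (F : (I -> R) -> (J -> R))
    (G : (I' -> R) -> (J' -> R)) u v :
  finmap F -> finmap G ->
  lc_tens F G (lc_pure u v) = lc_pure (F u) (G v).
Proof.
move=> FP GP; apply: funext => -[j j']; rewrite /lc_tens /lc_pure /=.
under eq_fun => i do rewrite (finZE (GP j')) mulrC.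
by rewrite (finZE (FP j)) mulrC.
Qed.

Lemma lc_tens_factor I I' J J' K K' (F : (J -> R) -> (K -> R))
    (G : (J' -> R) -> (K' -> R)) (F' : (I -> R) -> (J -> R))
    (G' : (I' -> R) -> (J' -> R)) H H' (w : I * I' -> R) :
  finmap G -> finmap F' ->
  (forall u, H u = F (F' u)) -> (forall u, H' u = G (G' u)) ->
  lc_tens H H' w = lc_tens F G (lc_tens F' G' w).
Proof.
by move=> GP F'P /funext -> /funext ->; rewrite lc_tens_comp.
Qed.

End CompletedTensor.

(** * Transport of the Hopf axioms along an injection *)

Section HopfSub.
Variables (R : comNzRingType) (I J : choiceType) (A : lc_ops R J).
Variables (phi : (I -> R) -> (J -> R)) (B : lc_ops R I).
Hypotheses (phiP : finmap phi) (phi_inj : injective phi) (AP : lc_hopf A).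
Hypotheses (mulAP : finmap (lc_mul A)) (comulAP : finmap (lc_comul A)).
Hypotheses (counitAP : fin (lc_counit A)) (antipodeAP : finmap (lc_antipode A)).
Hypotheses (mulBP : finmap (lc_mul B)) (comulBP : finmap (lc_comul B)).
Hypotheses (counitBP : fin (lc_counit B)) (antipodeBP : finmap (lc_antipode B)).
Hypotheses (phiM : forall w, phi (lc_mul B w) = lc_mul A (lc_tens phi phi w))
  (phi1 : phi (lc_one B) = lc_one A)
  (phiD : forall u, lc_tens phi phi (lc_comul B u) = lc_comul A (phi u))
  (phiE : forall u, lc_counit B u = lc_counit A (phi u))
  (phiS : forall u, phi (lc_antipode B u) = lc_antipode A (phi u)).

Let idP K : finmap (fun u : K -> R => u) := @finmap_id R K.
Let phi2P : finmap (lc_tens phi phi) := finmap_lc_tens phiP phiP.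

(** [phi], or a tensor power of it, carries each axiom of [B] to the same axiom of [A]; injectivity
    of [phi] and of its tensor powers ([lc_tens_inj]) brings it back. *)
Lemma lc_hopf_restrict : lc_hopf B.
Proof.
split.
- exact: finmap_lc_map.
- exact: finmap_lc_map.
- exact: fin_lc_form.
- exact: finmap_lc_map.
- move=> w; apply: phi_inj; rewrite !phiM !lc_tens_comp //.
  rewrite (lc_tens_factor (F := lc_mul A) (G := id)
    (F' := lc_tens phi phi) (G' := phi)) //.
  rewrite lc_mulA //.
  have -> : lc_assoc (lc_tens (lc_tens phi phi) phi w) =
            lc_tens phi (lc_tens phi phi) (lc_assoc w) by [].
  by congr lc_mul; rewrite (lc_tens_factor (F := id) (G := lc_mul A)
    (F' := phi) (G' := lc_tens phi phi)).
- move=> u; apply: phi_inj; rewrite phiM lc_tens_pure // phi1.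
  exact: lc_mul1l.
- move=> u; apply: phi_inj; rewrite phiM lc_tens_pure // phi1.
  exact: lc_mul1r.
- have inj2 := lc_tens_inj phi_inj phi_inj.
  move=> u; apply: (lc_tens_inj phi_inj inj2).
  rewrite lc_tens_comp // (lc_tens_factor (F := id) (G := lc_comul A)
    (F' := phi) (G' := phi)) //.
  rewrite phiD -lc_comulA // -phiD.
  rewrite -(lc_tens_factor (F := lc_comul A) (G := id)
    (H := fun u => lc_tens phi phi (lc_comul B u)) (H' := phi)) //.
  by rewrite -(lc_tens_comp (lc_tens phi phi) (G := phi) (F' := lc_comul B) id).
- move=> u; apply: phi_inj; apply: funext => q.
  rewrite -[RHS](congr1 (@^~ q) (lc_counitl AP (phi u))) /= -phiD.
  under eq_fun => j do rewrite phiE.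
  rewrite (finC (phiP q) _ counitAP); congr (lc_counit A _); apply: funext => p.
  exact: (finC (phiP q) (fun j i => lc_comul B u (i, j)) (phiP p)).
- move=> u; apply: phi_inj; apply: funext => q.
  rewrite -[RHS](congr1 (@^~ q) (lc_counitr AP (phi u))) /= -phiD.
  under eq_fun => j do rewrite phiE.
  by rewrite (finC (phiP q) _ counitAP).
- move=> w; apply: (lc_tens_inj phi_inj phi_inj).
  rewrite phiD phiM lc_comulM // !lc_tens_comp //.
  rewrite (lc_tens_factor (F := lc_tens phi phi) (G := lc_tens phi phi)
    (F' := lc_comul B) (G' := lc_comul B)) //.
  rewrite (lc_tens_factor (F := lc_mul A) (G := lc_mul A)
    (F' := lc_tens phi phi) (G' := lc_tens phi phi)) //.
  congr lc_tens.
  apply: funext => -[[a b] [c d]]; rewrite /lc_midswap /lc_tens /=.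
  congr (phi _ a); apply: funext => i.
  exact: (finC (phiP c) _ (phiP b)).
- apply: (lc_tens_inj phi_inj phi_inj).
  by rewrite phiD phi1 lc_comul1 // lc_tens_pure // phi1.
- move=> w; rewrite phiE phiM lc_counitM //.
  rewrite phiE; congr (lc_counit A _); apply: funext => p.
  rewrite /lc_tens /=.
  under [in RHS]eq_fun => i do rewrite phiE.
  by rewrite (finC (phiP p) _ counitAP).
- by rewrite phiE phi1 lc_counit1.
- move=> u; apply: phi_inj; rewrite phiM lc_tens_comp //.
  rewrite (lc_tens_factor (F := lc_antipode A) (G := id)
    (F' := phi) (G' := phi)) // phiD lc_antipodel //.
  by apply: funext => j; rewrite (finZE (phiP j)) phi1 phiE.
- move=> u; apply: phi_inj; rewrite phiM lc_tens_comp //.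
  rewrite (lc_tens_factor (F := id) (G := lc_antipode A)
    (F' := phi) (G' := phi)) // phiD lc_antipoder //.
  by apply: funext => j; rewrite (finZE (phiP j)) phi1 phiE.
Qed.

End HopfSub.


(** * Triangular families *)

Section Combinations.
Variable R : comNzRingType.

Lemma lc_combE (I J : choiceType) (b : I -> J -> R) c j (s : seq I) :
  uniq s -> (forall i, b i j != 0 -> i \in s) ->
  lc_comb b c j = \sum_(i <- s) c i * b i j.
Proof.
move=> s_uniq sP; rewrite /lc_comb (fsbigE s) //; last first.
  move=> i _; apply: contraNeq => cb0; apply: sP.
  by apply: contraNneq cb0 => ->; rewrite mulr0.
by apply: eq_bigl => i; rewrite in_setT.
Qed.

Lemma finmap_lc_comb (I J : choiceType) (b : I -> J -> R) :
  summable b -> finmap (lc_comb b).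
Proof.
move=> bP j; have /finite_seqP[s sE] := bP j.
exists [seq (b i j, i) | i <- undup s] => c.
rewrite (@lc_combE _ _ _ _ _ (undup s)) ?undup_uniq //.
  by rewrite big_map; apply: eq_bigr => i _; rewrite mulrC.
by move=> i bij; rewrite mem_undup; have : [set` s] i by rewrite -sE.
Qed.

Definition basis_vec (I : choiceType) (i : I) : I -> R := fun k => (k == i)%:R.

Lemma lc_comb_basis (I J : choiceType) (b : I -> J -> R) i :
  lc_comb b (basis_vec i) = b i.
Proof.
apply: funext => j; rewrite /lc_comb (fsbigE [:: i]) //.
  by rewrite big_mkcond big_seq1 in_setT /basis_vec eqxx mul1r.
by move=> k _; rewrite inE /basis_vec => /negPf->; rewrite mul0r.
Qed.

Lemma fin_expand (I : choiceType) (phi : (I -> R) -> R) : fin phi ->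
  exists r : seq I, forall u, phi u = \sum_(k <- r) u k * phi (basis_vec k).
Proof.
move=> phiP; have [s sE] := phiP; pose r := undup [seq p.2 | p <- s].
exists r => u; pose u' i := \sum_(k <- r) u k * basis_vec k i.
have uE i : i \in r -> u' i = u i.
  move=> ir; rewrite /u' (bigD1_seq i) ?undup_uniq //= /basis_vec eqxx mulr1.
  by rewrite big1 ?addr0 // => k /negPf ki; rewrite eq_sym ki mulr0.
have -> : phi u = phi u'.
  rewrite !sE; apply: eq_big_seq => p ps; rewrite uE // mem_undup.
  by rewrite map_f.
rewrite /u' (fin_sumE phiP); apply: eq_bigr => k _.
by rewrite (finZE phiP).
Qed.

Lemma fin_ext (I : choiceType) (phi psi : (I -> R) -> R) :
  fin phi -> fin psi -> (forall i, phi (basis_vec i) = psi (basis_vec i)) ->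
  forall u, phi u = psi u.
Proof.
move=> phiP psiP phipsi u; apply/eqP; rewrite -subr_eq0; apply/eqP.
have [r /(_ u)->] := fin_expand (fin_add phiP (fin_opp psiP)).
by rewrite big1 // => k _; rewrite phipsi subrr mulr0.
Qed.

End Combinations.

Section Triangular.
Variables (R : comNzRingType) (I : choiceType) (rk : I -> nat).
Variables (low : nat -> seq I).
Hypothesis low_uniq : forall n, uniq (low n).
Hypothesis lowP : forall i n, (rk i <= n)%N -> i \in low n.
Variables (b : I -> I -> R).
Hypothesis b_tri : forall i j, b i j != 0 -> i = j \/ (rk i < rk j)%N.

Lemma tri_summable : summable b.
Proof.
move=> j; apply: (@sub_finite_set _ _ [set` low (rk j)]); last exact: finite_seq.
by move=> i /= /b_tri [->|/ltnW]; apply: lowP.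
Qed.

Lemma tri_combE c j : lc_comb b c j =
  c j * b j j + \sum_(i <- low (rk j) | (rk i < rk j)%N) c i * b i j.
Proof.
rewrite (@lc_combE _ _ _ _ _ _ (low (rk j))) //; last first.
  by move=> i /b_tri [->|/ltnW]; apply: lowP.
rewrite (bigD1_seq j) ?lowP //=; congr (_ + _).
rewrite big_mkcond [RHS]big_mkcond; apply: eq_bigr => i _.
have [->|ij] := eqVneq i j; first by rewrite ltnn.
case: ltnP => // rji; have [->|/b_tri[]] := eqVneq (b i j) 0.
- by rewrite mulr0.
- by move/eqP: ij.
- by rewrite ltnNge rji.
Qed.

Section Inverse.
Variable e : I -> R.
Hypothesis eP : forall i, b i i * e i = 1.

(** Forward substitution. The recursion descends in rank, which is not structural, so it runs on
    fuel; any amount above the rank gives the same value ([tri_inv_fuelE]). *)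
Fixpoint tri_inv_fuel (n : nat) (f : I -> R) (j : I) : R :=
  if n isn't n'.+1 then 0 else
  e j * (f j - \sum_(i <- low (rk j) | (rk i < rk j)%N)
                 tri_inv_fuel n' f i * b i j).

Definition tri_inv (f : I -> R) (j : I) : R := tri_inv_fuel (rk j).+1 f j.

Lemma tri_inv_fuelE n f j : (rk j < n)%N -> tri_inv_fuel n f j = tri_inv f j.
Proof.
suff H m k : (rk j < m)%N -> (rk j < k)%N -> tri_inv_fuel m f j = tri_inv_fuel k f j.
  by move=> jn; apply: H.
elim: m k j => [|m IHm] [|k] j //; rewrite !ltnS => jm jk /=.
congr (_ * (_ - _)); apply: eq_bigr => i ij; congr (_ * _).
by apply: IHm; apply: leq_trans ij _.
Qed.

Lemma tri_invE f j : tri_inv f j =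
  e j * (f j - \sum_(i <- low (rk j) | (rk i < rk j)%N) tri_inv f i * b i j).
Proof.
rewrite /tri_inv /=; congr (_ * (_ - _)); apply: eq_bigr => i ij.
by rewrite tri_inv_fuelE.
Qed.

Lemma finmap_tri_inv : finmap tri_inv.
Proof.
suff H n : finmap (tri_inv_fuel n) by move=> j; exact: H.
elim: n => [|n IHn] j /=; first exact: fin_zero.
apply: fin_scale; apply: fin_add; first exact: fin_proj.
apply: fin_opp; apply: fin_sum => i _.
have [s sE] := fin_scale (b i j) (IHn i).
by exists s => u; rewrite mulrC sE.
Qed.

Lemma tri_invK f : lc_comb b (tri_inv f) = f.
Proof.
apply: funext => j; rewrite tri_combE [in X in X + _]tri_invE mulrAC.
by rewrite [e j * _]mulrC eP mul1r subrK.
Qed.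

Lemma tri_combK c : tri_inv (lc_comb b c) = c.
Proof.
apply: funext => j; move: {2}(rk j) (leqnn (rk j)) => n.
elim: n j => [|n IHn] j jn; rewrite tri_invE tri_combE.
  rewrite [in X in _ - X]big_pred0; last by move=> i; move: jn; case: (rk j).
  rewrite big_pred0; last by move=> i; move: jn; case: (rk j).
  by rewrite subr0 addr0 mulrCA [e j * _]mulrC eP mulr1.
rewrite [X in _ - X](eq_bigr (fun i => c i * b i j)); last first.
  by move=> i ij; rewrite IHn // -ltnS (leq_trans ij).
by rewrite addrK mulrCA [e j * _]mulrC eP mulr1.
Qed.

End Inverse.

Section Density.
Hypothesis b_reg : forall i x, x * b i i = 0 -> x = 0.

Lemma tri_comb_inj : injective (lc_comb b).
Proof.
move=> c d cd; apply: funext => j; move: {2}(rk j) (leqnn (rk j)) => n.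
elim: n j => [|n IHn] j jn.
  have := congr1 (@^~ j) cd; rewrite /= !tri_combE !big_pred0.
  - rewrite !addr0 => /eqP; rewrite -subr_eq0 -mulrBl => /eqP /b_reg/eqP.
    by rewrite subr_eq0 => /eqP.
  - by move=> i; move: jn; case: (rk j).
  - by move=> i; move: jn; case: (rk j).
have := congr1 (@^~ j) cd; rewrite /= !tri_combE.
rewrite [X in _ + X = _](eq_bigr (fun i => d i * b i j)); last first.
  by move=> i ij; rewrite IHn // -ltnS (leq_trans ij).
move=> /addIr/eqP; rewrite -subr_eq0 -mulrBl => /eqP /b_reg/eqP.
by rewrite subr_eq0 => /eqP.
Qed.

(** The difference of the functionals sees no coordinate above some rank N. At lower rank, its
    vanishing on the row [b i] expresses [b i i] times its value at [basis_vec i] through its values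
    at higher rank, which are zero by induction; regularity of [b i i] then gives zero. The diagonal
    may be non-invertible, as the powers of 2 are. *)
Lemma tri_dense phi psi : fin phi -> fin psi ->
  (forall c, phi (lc_comb b c) = psi (lc_comb b c)) -> forall u, phi u = psi u.
Proof.
move=> phiP psiP phipsi u; apply/eqP; rewrite -subr_eq0; apply/eqP.
pose xi u := phi u - psi u; rewrite -/(xi u).
have xiP : fin xi by apply: fin_add => //; apply: fin_opp.
have xib c : xi (lc_comb b c) = 0 by rewrite /xi phipsi subrr.
rewrite (fin_ext xiP (psi := fun=> 0)) //; first exact: fin_zero.
clearbody xi => {u phi psi phiP psiP phipsi}.
have [s sE] := xiP.
pose N := \max_(p <- s) rk p.2.
have big i : (N < rk i)%N -> xi (basis_vec R i) = 0.
  move=> Ni; rewrite sE big_seq big1 // => p ps; rewrite /basis_vec.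
  case: eqP => [pi|_]; last by rewrite mulr0.
  by move: Ni; rewrite ltnNge -pi /N (big_rem p) //= leq_maxl.
have [r rE] := fin_expand xiP.
(* Downward induction on the rank, measured by its distance to [N.+1]. *)
move=> i; move: {2}(N.+1 - rk i)%N (leqnn (N.+1 - rk i)%N) => n.
elim: n i => [|n IHn] i iN; first by apply: big; lia.
apply: (@b_reg i); rewrite mulrC -(finZE xiP) -[RHS](xib (basis_vec R i)).
rewrite lc_comb_basis rE [RHS]rE; apply: eq_bigr => k _.
rewrite {1}/basis_vec; have [->|ki] := eqVneq k i; first by rewrite mulr1.
rewrite mulr0 mul0r; have [->|/b_tri[ik|ik]] := eqVneq (b i k) 0.
- by rewrite mul0r.
- by move: ki; rewrite ik eqxx.
- by rewrite IHn ?mulr0 //; lia.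
Qed.

End Density.
End Triangular.

(** Basis vectors of the completed tensor square are pure tensors, and on pure tensors density
    applies to one factor at a time with the other one frozen. *)
Lemma tens_dense (R : comNzRingType) (I J : choiceType)
    (T : (I -> R) -> (J -> R)) (phi psi : (J * J -> R) -> R) :
  finmap T ->
  (forall xi xi' : (J -> R) -> R, fin xi -> fin xi' ->
    (forall c, xi (T c) = xi' (T c)) -> forall u, xi u = xi' u) ->
  fin phi -> fin psi ->
  (forall w, phi (lc_tens T T w) = psi (lc_tens T T w)) ->
  forall w, phi w = psi w.
Proof.
move=> TP dense phiP psiP phipsi.
have pureP (xi : (J * J -> R) -> R) : fin xi ->
    (forall u, fin (fun v => xi (lc_pure u v))) /\
    (forall v, fin (fun u => xi (lc_pure u v))).
  move=> xiP; split=> [u|v]; apply: (fin_comp xiP) => -[i j].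
    by apply: fin_scale; apply: fin_proj.
  have [s sE] := fin_scale (v j) (fin_proj R i).
  by exists s => u; rewrite -sE /lc_pure mulrC.
have [phi1 phi2] := pureP _ phiP; have [psi1 psi2] := pureP _ psiP.
have pures u v : phi (lc_pure u v) = psi (lc_pure u v).
  apply: (dense _ _ (phi2 v) (psi2 v)) => c.
  apply: (dense _ _ (phi1 (T c)) (psi1 (T c))) => d.
  by rewrite -lc_tens_pure.
apply: fin_ext => // -[i j].
have -> : basis_vec R (i, j) = lc_pure (basis_vec R i) (basis_vec R j).
  by apply: funext => -[k l]; rewrite /basis_vec /lc_pure /= -natrM mulnb.
exact: pures.
Qed.


(** * Transfer operators *)

(* A composition is encoded by the reversed list of its parts, each decreased
   by one, so that the head describes the last part. *)
Notation state := (seq nat).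

Section Letters.
Variables (R : comNzRingType) (b x : R).
Implicit Types g : state -> R.

(* If [g] gives, for every prefix of a composition, the generating function of
   its fillings by some initial letters of the alphabet, then [unprim g] and
   [prim bar g] allow one more letter, of weight x.  The recursion removes the
   last block of the filling; [bar] selects the rules of Kbar. *)
Fixpoint unprim_in (g : state -> R) (r : state) (q : nat) : R :=
  if q is q'.+1 then (1 + b * x) * g (q :: r) + x * unprim_in g r q'
  else (1 + b * x) * g (0%N :: r) + x * g r.

Definition unprim g (a : state) : R :=
  if a is q :: r then unprim_in g r q else g [::].

Fixpoint prim (bar : bool) g (a : state) : R :=
  match a with
  | [::] => g [::]
  | q'.+1 :: r => (1 + b * x) * g a + x * g (q' :: r)
  | 0 :: r => if bar then g a else (1 + b * x) * g a + x * prim bar g r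
  end.

Definition variable (bar : bool) g : state -> R := unprim (prim bar g).

Lemma unprim0 g r : unprim g (0%N :: r) = (1 + b * x) * g (0%N :: r) + x * g r.
Proof. by []. Qed.

Lemma unprimS g q r :
  unprim g (q.+1 :: r) = (1 + b * x) * g (q.+1 :: r) + x * unprim g (q :: r).
Proof. by []. Qed.

Lemma prim0 g r : prim false g (0%N :: r) =
  (1 + b * x) * g (0%N :: r) + x * prim false g r.
Proof. by []. Qed.

Lemma primS bar g q r : prim bar g (q.+1 :: r) =
  (1 + b * x) * g (q.+1 :: r) + x * g (q :: r).
Proof. by []. Qed.

(* [peak a] is the peak composition with the same peaks as [a]: a part 1 other
   than the last is absorbed into the next part. *)
Fixpoint lam (q : nat) (r : state) : state :=
  match r with
  | [::] => [:: q]
  | 0 :: r' => lam q.+1 r'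
  | p :: r' => q :: lam p r'
  end.

Definition peak (a : state) : state := if a is q :: r then lam q r else [::].

(** The head is the last part, the only one that may be 1; the other parts, stored decreased by one,
    must be positive. *)
Definition is_peak (a : state) : bool := all (leq 1) (behead a).

Lemma lamS q r : exists p r', lam q r = p :: r' /\ lam q.+1 r = p.+1 :: r'.
Proof.
elim: r q => [|[|p] r IHr] q /=; first by exists q, [::].
  exact: IHr.
by exists q, (lam p.+1 r).
Qed.

Definition decr (a : state) : state :=
  match a with
  | [::] => [::]
  | 0 :: r => r
  | q.+1 :: r => q :: r
  end.

Lemma decr_peak a : decr (peak a) = peak (decr a).
Proof.
case: a => [|[|q] [|[|p] r]] //=.
- by have [p [r' [-> ->]]] := lamS 0 r.
- by have [p [r' [-> ->]]] := lamS q.+1 r.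
Qed.

(* The two letters of one variable can only cover a run of descents followed
   by a run of ascents: [ladder] and [ladder_desc] sum over these runs. *)
Definition newvar g (a : state) : R := g (decr a) + b * g a.

Fixpoint ladder_desc g (a : state) : R :=
  match a with
  | [::] => 0
  | q'.+1 :: r => newvar g a
  | 0 :: r => newvar g a + x * ladder_desc g r
  end.

Fixpoint ladder_in g (r : state) (q : nat) : R :=
  if q is q'.+1 then newvar g (q :: r) + x * ladder_in g r q'
  else ladder_desc g (0%N :: r).

Definition ladder g (a : state) : R := if a is q :: r then ladder_in g r q else 0.

Lemma ladderS g q r :
  ladder g (q.+1 :: r) = newvar g (q.+1 :: r) + x * ladder g (q :: r).
Proof. by []. Qed.

Lemma ladder0 g r :
  ladder g (0%N :: r) = newvar g (0%N :: r) + x * ladder_desc g r.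
Proof. by []. Qed.

Lemma ladder_desc0 g r :
  ladder_desc g (0%N :: r) = newvar g (0%N :: r) + x * ladder_desc g r.
Proof. by []. Qed.

Lemma prim_ladder g r : prim false g r = g r + x * ladder_desc g r.
Proof.
elim: r => [|[|q] r IHr]; first by rewrite /= mulr0 addr0.
  by rewrite prim0 IHr ladder_desc0 /newvar /=; ring.
by rewrite primS /= /newvar /=; ring.
Qed.

(** In a run of blocks that meet the new variable, the blocks before the turn from descents to
    ascents must use the primed letter and those after it the unprimed one. Only the block at the
    turn may use either letter or both, which gives 2 x + b x^2. Older letters can occur only in the
    first block of the run, whence [newvar]. *)
Lemma variable_ladder g a : variable false g a = g a + (2 + b * x) * x * ladder g a.
Proof.
case: a => [|q r]; first by rewrite /= mulr0 addr0.
rewrite /variable; elim: q => [|q IHq].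
  by rewrite unprim0 !prim_ladder ladder0 ladder_desc0 /newvar /=; ring.
by rewrite unprimS IHq primS ladderS /newvar /=; ring.
Qed.

Lemma newvar_peak g a : (forall a, g (peak a) = g a) ->
  newvar g (peak a) = newvar g a.
Proof. by move=> gP; rewrite /newvar gP decr_peak gP. Qed.

(** Absorbing a part 1 turns a descent inside a run into an ascent, and [ladder] charges [x] for
    either, so the sum over runs does not change. *)
Lemma ladder_peak g a : (forall a, g (peak a) = g a) ->
  ladder g (peak a) = ladder g a.
Proof.
move=> gP; have [n] := ubnP (sumn a + size a)%N; elim: n a => // n IHn.
move=> [|[|q] r] //; last first.
  move=> /= le_n; have [p [r' [E E']]] := lamS q r.
  rewrite E' -![ladder_in _ _ _]/(ladder g (_ :: _)) !ladderS.
  rewrite -{1}E' -/(peak (q.+1 :: r)) newvar_peak // -E -/(peak (q :: r)) IHn //=.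
case: r => [|[|q] r] //= le_n.
  have [p [r' [E E']]] := lamS 0 r.
  have /= := newvar_peak [:: 0, 0 & r]%N gP; rewrite E' => <-.
  have /= := IHn (0%N :: r); rewrite E -[_ + x * _]/(ladder g (0%N :: r)) => <- //.
  by move: le_n => /=; lia.
have [p [r' [E E']]] := lamS q r.
have /= := newvar_peak [:: 0, q.+1 & r]%N gP; rewrite E' => <- /=.
by have /= := newvar_peak (q.+1 :: r)%N gP; rewrite E' => <-.
Qed.

Lemma variable_peak g a : (forall a, g (peak a) = g a) ->
  variable false g (peak a) = variable false g a.
Proof. by move=> gP; rewrite !variable_ladder ladder_peak // gP. Qed.

(* The sum over d in {0,1}^l of 2^(l-|d|) b^|d| g (a + d) *)
Fixpoint thicken (g : state -> R) (a : state) : R :=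
  if a is q :: r then
    2 * thicken (fun s => g (q :: s)) r + b * thicken (fun s => g (q.+1 :: s)) r
  else g [::].

Lemma thicken_lin k l g h a :
  thicken (fun s => k * g s + l * h s) a = k * thicken g a + l * thicken h a.
Proof. by elim: a g h => [|q r IHr] g h //=; rewrite !IHr; ring. Qed.

Lemma thickenE g q r : thicken g (q :: r) =
  2 * thicken (fun s => g (q :: s)) r + b * thicken (fun s => g (q.+1 :: s)) r.
Proof. by []. Qed.

(** The last part of a nonempty [r] is at least 2, so [prim] stops after one box and never reaches
    the rule in which K and Kbar differ. *)
Lemma prim_thicken g r : is_peak (0%N :: r) ->
  prim false (thicken g) r = thicken (prim true g) r.
Proof.
case: r => [|[|q] r] // _.
by rewrite primS !thickenE /= !thicken_lin; ring.
Qed.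

(** The decisive case is a last part 1. On the K side the new variable then reaches the earlier
    parts with weight 2 x + b x^2. On the Kbar side this weight is split: 2 times x from a last part
    1, and b times x^2 from a last part thickened to 2. *)
Lemma variable_thicken g a : is_peak a ->
  variable false (thicken g) a = thicken (variable true g) a.
Proof.
case: a => [|q r] // r_peak; have {}r_peak : is_peak (0%N :: r) by [].
rewrite /variable; elim: q => [|q IHq].
  rewrite unprim0 prim0 prim_thicken // !thickenE /= !thicken_lin.
  by ring.
rewrite unprimS IHq primS !thickenE /=.
by rewrite !thicken_lin; ring.
Qed.

End Letters.


(** * Coefficient rows of L, K and Kbar *)

Section Rows.
Variables (R : comNzRingType) (beta : R).
Implicit Types (g : state -> R) (c : seq nat) (a : state).

Definition const_row g (a : state) : {poly R} := (g a)%:P.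

Definition ustep g (n : nat) (a : state) : R :=
  (unprim beta%:P 'X (const_row g) a)`_n.

Definition vstep bar g (n : nat) (a : state) : R :=
  (variable beta%:P 'X bar (const_row g) a)`_n.

Definition row0 (a : state) : R := (a == [::])%:R.

(* The coefficients of x_1^(c_1) x_2^(c_2) ... in the functions L (fundamental),
   K ([bar = false]) and Kbar ([bar = true]) of the composition a *)
Definition lrow c : state -> R := foldl ustep row0 c.
Definition krow bar c : state -> R := foldl (vstep bar) row0 c.

Lemma lrow_rcons c n : lrow (rcons c n) = ustep (lrow c) n.
Proof. by rewrite /lrow foldl_rcons. Qed.

Lemma krow_rcons bar c n : krow bar (rcons c n) = vstep bar (krow bar c) n.
Proof. by rewrite /krow foldl_rcons. Qed.

Lemma coef_step (p q : {poly R}) n : ((1 + beta%:P * 'X) * p + 'X * q)`_n =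
  p`_n + (if n is m.+1 then beta * p`_m + q`_m else 0).
Proof.
rewrite mulrDl mul1r -mulrA !coefD coefCM !coefXM.
by case: n => [|n] /=; rewrite ?mulr0 ?addr0 ?addrA.
Qed.

Lemma coef_unprim0 (g : state -> {poly R}) r n :
  (unprim beta%:P 'X g (0%N :: r))`_n =
  (g (0%N :: r))`_n + (if n is m.+1 then beta * (g (0%N :: r))`_m + (g r)`_m else 0).
Proof. by rewrite unprim0 coef_step. Qed.

Lemma coef_unprimS (g : state -> {poly R}) q r n :
  (unprim beta%:P 'X g (q.+1 :: r))`_n = (g (q.+1 :: r))`_n +
  (if n is m.+1 then
     beta * (g (q.+1 :: r))`_m + (unprim beta%:P 'X g (q :: r))`_m else 0).
Proof. by rewrite unprimS coef_step. Qed.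

Lemma coef_prim0 (g : state -> {poly R}) r n :
  (prim beta%:P 'X false g (0%N :: r))`_n = (g (0%N :: r))`_n +
  (if n is m.+1 then
     beta * (g (0%N :: r))`_m + (prim beta%:P 'X false g r)`_m else 0).
Proof. by rewrite prim0 coef_step. Qed.

Lemma coef_primS bar (g : state -> {poly R}) q r n :
  (prim beta%:P 'X bar g (q.+1 :: r))`_n = (g (q.+1 :: r))`_n +
  (if n is m.+1 then beta * (g (q.+1 :: r))`_m + (g (q :: r))`_m else 0).
Proof. by rewrite primS coef_step. Qed.

Section FiniteSteps.
Variables (I : Type) (G : (I -> R) -> state -> {poly R}).
Hypothesis GP : forall a n, fin (fun u => (G u a)`_n).

Lemma fin_coef_step (p q : (I -> R) -> {poly R}) :
  (forall n, fin (fun u => (p u)`_n)) -> (forall n, fin (fun u => (q u)`_n)) ->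
  forall n, fin (fun u => ((1 + beta%:P * 'X) * p u + 'X * q u)`_n).
Proof.
move=> pP qP n; under eq_fun => u do rewrite coef_step.
apply: fin_add => //; case: n => [|n]; first exact: fin_zero.
by apply: fin_add => //; apply: fin_scale.
Qed.

Lemma fin_unprim a n : fin (fun u => (unprim beta%:P 'X (G u) a)`_n).
Proof.
case: a => [|q r] /=; first exact: GP.
by elim: q n => [|q IHq] n /=; apply: fin_coef_step.
Qed.

End FiniteSteps.

Lemma fin_const_row a n : fin (fun g => (const_row g a)`_n).
Proof.
rewrite /const_row; under eq_fun => g do rewrite coefC.
by case: n => [|n] /=; [apply: fin_proj|apply: fin_zero].
Qed.

Lemma fin_ustep n a : fin (fun g => ustep g n a).
Proof. by apply: fin_unprim; apply: fin_const_row. Qed.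

Lemma coef0_prim bar (g : state -> {poly R}) a :
  (prim beta%:P 'X bar g a)`_0 = (g a)`_0.
Proof.
case: a => [|[|q] r] //; last by rewrite coef_primS addr0.
by case: bar => //; rewrite coef_prim0 addr0.
Qed.

Lemma coef0_unprim (g : state -> {poly R}) a :
  (unprim beta%:P 'X g a)`_0 = (g a)`_0.
Proof.
by case: a => [|[|q] r] //; rewrite (coef_unprim0, coef_unprimS) addr0.
Qed.

Lemma vstep0 bar g : vstep bar g 0 = g.
Proof.
apply: funext => a; rewrite /vstep /variable coef0_unprim coef0_prim.
by rewrite /const_row coefC.
Qed.

Lemma krow_peak c a : krow false c (peak a) = krow false c a.
Proof.
elim/last_ind: c a => [|c n IHc] a.
  rewrite /krow /= /row0; case: a => //= q r.
  by have [p [r' [-> _]]] := lamS q r.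
rewrite !krow_rcons /vstep variable_peak // => a'.
by rewrite /const_row IHc.
Qed.

End Rows.

Lemma is_peak_behead q r : is_peak (q :: r) -> is_peak r.
Proof. by case: r => // p r /= /andP[]. Qed.

Section RowMorphism.
Variables (R R' : comNzRingType) (f : {rmorphism R -> R'}).

Lemma rmorph_unprim b x g a :
  f (unprim b x g a) = unprim (f b) (f x) (fun s => f (g s)) a.
Proof.
case: a => [|q r] //=; elim: q => [|q IHq] /=;
by rewrite !(rmorphD, rmorphM, rmorph1) ?IHq.
Qed.

Lemma rmorph_prim b x bar g a :
  f (prim b x bar g a) = prim (f b) (f x) bar (fun s => f (g s)) a.
Proof.
elim: a => [|[|q] r IHr] //=; last by rewrite !(rmorphD, rmorphM, rmorph1).
by case: bar IHr => //= IHr; rewrite !(rmorphD, rmorphM, rmorph1) IHr.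
Qed.

Lemma rmorph_variable b x bar g a :
  f (variable b x bar g a) = variable (f b) (f x) bar (fun s => f (g s)) a.
Proof.
rewrite /variable rmorph_unprim; congr unprim.
by apply: funext => s; rewrite rmorph_prim.
Qed.

Lemma rmorph_thicken b g a :
  f (thicken b g a) = thicken (f b) (fun s => f (g s)) a.
Proof.
elim: a g => [|q r IHr] g //=.
by rewrite rmorphD !rmorphM !IHr rmorphMn rmorph1.
Qed.

End RowMorphism.

Section RowBaseChange.
Variables (R R' : comNzRingType) (f : {rmorphism R -> R'}) (beta : R).

Lemma rmorph_vstep bar g n a :
  f (vstep beta bar g n a) = vstep (f beta) bar (fun s => f (g s)) n a.
Proof.
rewrite /vstep -coef_map rmorph_variable /= map_polyC map_polyX.
congr (polyseq (variable _ _ _ _ _))`_n.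
by apply: funext => s; rewrite /const_row /= map_polyC.
Qed.

Lemma rmorph_krow bar c a : f (krow beta bar c a) = krow (f beta) bar c a.
Proof.
elim/last_ind: c a => [|c n IHc] a; first by rewrite /krow /= /row0 rmorph_nat.
rewrite !krow_rcons rmorph_vstep; congr vstep.
by apply: funext => s; rewrite IHc.
Qed.

End RowBaseChange.

(** Removing boxes from the end of a peak state leaves a peak state, so the recursion consults no
    other states. An identity known on peak states only can thus pass through an induction on the
    variables. *)
Lemma eq_variable_peak (R : comNzRingType) (b x : R) bar g h a :
  (forall s, is_peak s -> g s = h s) -> is_peak a ->
  variable b x bar g a = variable b x bar h a.
Proof.
move=> gh; have ghp s : is_peak s -> prim b x bar g s = prim b x bar h s.
  elim: s => [|[|q] r IHr] rP //=; first exact: gh.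
    by case: bar IHr => IHr; rewrite gh ?IHr //; apply: is_peak_behead rP.
  by rewrite !gh.
case: a => [|q r] rP; first exact: ghp.
rewrite /variable; elim: q rP => [|q IHq] rP.
  by rewrite !unprim0 !ghp //; apply: is_peak_behead rP.
by rewrite !unprimS ghp ?IHq.
Qed.

Lemma krow_thicken (R : comNzRingType) (beta : R) c a : is_peak a ->
  krow beta false c a = thicken beta (krow beta true c) a.
Proof.
elim/last_ind: c a => [|c n IHc] a aP.
  rewrite /krow /=; clear aP; case: a => //= q r.
  have thick0 s : thicken beta (fun=> 0) s = 0.
    by elim: s => //= p s ->; rewrite !mulr0 addr0.
  by rewrite /row0 /= !thick0 !mulr0 addr0.
rewrite !krow_rcons /vstep.
rewrite (@eq_variable_peak _ _ _ _ _ (thicken beta%:P (const_row (krow beta true c)))) //.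
  rewrite variable_thicken //.
  elim: a (variable _ _ _ _) {aP} => [|q r IHr] g //=.
  by rewrite coefD coefCM !IHr mulr_natl coefMn IHr mulr_natl.
by move=> s sP; rewrite /const_row IHc // (rmorph_thicken (polyC)).
Qed.


(** * Triangularity with respect to size and box weights *)

Definition wsize (a : state) : nat := sumn a + size a.

(* The sum over all boxes of the index of their part, counted from 0 *)
Fixpoint wsum (a : state) : nat :=
  if a is q :: r then wsum r + size r * q.+1 else 0.

Definition of_state (a : state) : seq nat := map succn (rev a).
Definition to_state (c : seq nat) : state := rev (map predn c).

Lemma of_stateK : cancel of_state to_state.
Proof. by move=> a; rewrite /to_state -map_comp map_id_in ?revK // => i. Qed.

Lemma to_stateK c : all (leq 1) c -> of_state (to_state c) = c.
Proof.
move=> /allP cP; rewrite /of_state /to_state revK -map_comp map_id_in // => i ic /=.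
by rewrite prednK // cP.
Qed.

Lemma of_state_cons q r : of_state (q :: r) = rcons (of_state r) q.+1.
Proof. by rewrite /of_state rev_cons map_rcons. Qed.

Lemma of_state_pos a : all (leq 1) (of_state a).
Proof. by rewrite /of_state all_map; apply/allP. Qed.

Lemma sumn_of_state a : sumn (of_state a) = wsize a.
Proof.
elim: a => // q r IHr; rewrite of_state_cons sumn_rcons IHr /wsize /=; lia.
Qed.

(* In a monomial of L_a or Kbar_a without excess, the variable of each box comes
   no earlier than its part; so [a] cannot lie above the monomial unless it is
   equal to it. *)
Definition above (k N w : nat) (a : state) : Prop :=
  (k < size a)%N \/ (N < wsize a)%N \/ (wsize a = N /\ w <= wsum a)%N.

Section Triangularity.
Variables (R : comNzRingType) (beta : R).

(** Removing the last box of [a] lowers [wsum] by the index of its part. If that index is at most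
    [size r], the weight condition of [above] survives; if it is larger, the state has too many
    parts and the first alternative of [above] applies. *)
Lemma unprim_tri (g : state -> {poly R}) (r : state) :
  (forall a, above (size r) (wsize r) (wsum r) a -> (g a)`_0 = (a == r)%:R) ->
  (forall a i, above (size r) (wsize r + i.+1) (wsum r + size r * i.+1) a ->
    (g a)`_i.+1 = 0) ->
  forall a n, above (size r).+1 (wsize r + n.+1) (wsum r + size r * n.+1) a ->
    (unprim beta%:P 'X g a)`_n.+1 = (a == n :: r)%:R.
Proof.
move=> g0 gS [|q s] n.
  by move=> aP; rewrite /= gS //; move: aP; rewrite /above /wsize /=; lia.
elim: q n => [|q IHq] n aP.
  rewrite coef_unprim0 gS ?add0r; last by move: aP; rewrite /above /wsize /=; lia.
  have -> : (g (0%N :: s))`_n = 0.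
    case: n aP => [|n] aP; last first.
      by apply: gS; move: aP; rewrite /above /wsize /=; lia.
    rewrite g0; last by move: aP; rewrite /above /wsize /=; lia.
    case: eqP => // E; move: aP; rewrite -E /above /wsize /=; lia.
  rewrite mulr0 add0r; case: n aP => [|n] aP.
    rewrite g0 ?eqseq_cons ?eqxx //.
    by move: aP; rewrite /above /wsize /=; lia.
  rewrite gS ?eqseq_cons //.
  move: aP; rewrite /above /wsize /=; lia.
rewrite coef_unprimS gS ?add0r; last by move: aP; rewrite /above /wsize /=; lia.
have -> : (g (q.+1 :: s))`_n = 0.
  case: n aP => [|n] aP; last first.
    by apply: gS; move: aP; rewrite /above /wsize /=; lia.
  rewrite g0; last by move: aP; rewrite /above /wsize /=; lia.
  case: eqP => // E; move: aP; rewrite -E /above /wsize /=; lia.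
rewrite mulr0 add0r; case: n aP => [|n] aP.
  rewrite coef0_unprim g0; last by move: aP; rewrite /above /wsize /=; lia.
  rewrite eqseq_cons /=; case: eqP => // E.
  by move: aP; rewrite -E /above /wsize /=; lia.
rewrite IHq ?eqseq_cons //; move: aP; rewrite /above /wsize /=; nia.
Qed.

(** Under the Kbar rules a primed letter can only continue an existing part. If removing the box
    leaves [r] itself, that part has index [size r] - 1, and the box makes [wsum] too small for
    [above]. *)
Lemma prim_tri g (r : state) :
  (forall a, above (size r) (wsize r) (wsum r) a -> g a = (a == r)%:R) ->
  forall a i, above (size r) (wsize r + i.+1) (wsum r + size r * i.+1) a ->
    (prim beta%:P 'X true (const_row g) a)`_i.+1 = 0.
Proof.
move=> gP [|[|q] s] i aP; rewrite ?coef_primS /= /const_row !coefC //= add0r.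
rewrite gP; last by move: aP; rewrite /above /wsize /=; nia.
have -> : (q.+1 :: s == r) = false.
  case: eqP => // E; move: aP; rewrite -E /above /wsize /=; nia.
rewrite mulr0n; case: i aP => [|i] aP /=; rewrite ?mulr0 ?add0r //.
rewrite gP; last by move: aP; rewrite /above /wsize /=; nia.
case: eqP => // E; move: aP; rewrite -E /above /wsize /=; nia.
Qed.

Lemma lrow_tri (r a : state) : above (size r) (wsize r) (wsum r) a ->
  lrow beta (of_state r) a = (a == r)%:R.
Proof.
elim: r a => [|q r IHr] a // aP.
rewrite of_state_cons lrow_rcons /ustep (@unprim_tri _ r) //.
- by move=> s sP; rewrite /const_row coefC IHr.
- by move=> s i _; rewrite /const_row coefC.
- by move: aP; rewrite /above /wsize /=; nia.
Qed.

Lemma krow_tri (r a : state) : above (size r) (wsize r) (wsum r) a ->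
  krow beta true (of_state r) a = (a == r)%:R.
Proof.
elim: r a => [|q r IHr] a // aP.
rewrite of_state_cons krow_rcons /vstep /variable (@unprim_tri _ r) //.
- by move=> s sP; rewrite coef0_prim /const_row coefC IHr.
- by move=> s i sP; apply: (prim_tri IHr).
- by move: aP; rewrite /above /wsize /=; nia.
Qed.

Lemma unprim_size (g : state -> {poly R}) N :
  (forall a i, (N + i < wsize a)%N -> (g a)`_i = 0) ->
  forall a n, (N + n < wsize a)%N -> (unprim beta%:P 'X g a)`_n = 0.
Proof.
move=> gP [|q r] n; first exact: gP.
elim: q n => [|q IHq] [|n] /= nN; rewrite (coef_unprim0, coef_unprimS) gP // add0r //.
  rewrite !gP ?mulr0 ?addr0 //; move: nN; rewrite /wsize /=; lia.
rewrite IHq ?gP ?mulr0 ?addr0 //; move: nN; rewrite /wsize /=; lia.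
Qed.

Lemma prim_size bar (g : state -> {poly R}) N :
  (forall a i, (N + i < wsize a)%N -> (g a)`_i = 0) ->
  forall a n, (N + n < wsize a)%N -> (prim beta%:P 'X bar g a)`_n = 0.
Proof.
move=> gP; elim=> [|[|q] r IHr] n nN; first exact: gP.
  case: bar IHr => IHr; first exact: gP.
  rewrite coef_prim0 gP // add0r; case: n nN => // n nN.
  rewrite IHr ?gP ?mulr0 ?addr0 //; move: nN; rewrite /wsize /=; lia.
rewrite coef_primS gP // add0r; case: n nN => // n nN.
rewrite !gP ?mulr0 ?addr0 //; move: nN; rewrite /wsize /=; lia.
Qed.

Lemma const_row_size (g : state -> R) N :
  (forall a, (N < wsize a)%N -> g a = 0) ->
  forall a i, (N + i < wsize a)%N -> (const_row g a)`_i = 0.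
Proof.
move=> gP a i iN; rewrite /const_row coefC gP; first by case: i {iN}.
by move: iN; lia.
Qed.

Lemma krow_size bar c a : (sumn c < wsize a)%N -> krow beta bar c a = 0.
Proof.
elim/last_ind: c a => [|c n IHc] a; first by case: a.
rewrite sumn_rcons krow_rcons => aN.
by apply: unprim_size aN; apply: prim_size; apply: const_row_size.
Qed.

End Triangularity.

(* Lexicographic, since [wsum a <= wsize a ^ 2]. *)
Definition rank (a : state) : nat := wsize a ^ 3 + wsum a.

Lemma wsum_le a : (wsum a <= wsize a ^ 2)%N.
Proof.
elim: a => // q r IHr; rewrite /wsize /= in IHr *.
have := size r; nia.
Qed.

(** Consecutive cubes differ by more than the square that bounds [wsum], so a smaller [wsize] forces
    a smaller [rank]; for equal sizes [rank] compares [wsum]. *)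
Lemma rank_above r a : (rank r <= rank a)%N ->
  above (size r) (wsize r) (wsum r) a.
Proof.
rewrite /above /rank => ra; right; have := wsum_le r; have := wsum_le a.
case: (ltngtP (wsize r) (wsize a)) ra => [|ar|<-] ra wa wr;
  [by left| |by right; split=> //; lia].
exfalso; have : ((wsize a).+1 ^ 3 <= wsize r ^ 3)%N by rewrite leq_exp2r.
by rewrite !expnS !expn0 in ra wa wr *; nia.
Qed.

Fixpoint low_states (n : nat) : seq state :=
  if n is n'.+1 then
    [::] :: [seq q :: r | q <- iota 0 n, r <- low_states n']
  else [:: [::]].

Lemma low_statesP a n : (wsize a <= n)%N -> a \in low_states n.
Proof.
elim: a n => [|q r IHr] [|n] //; first by rewrite /wsize /= addnS.
rewrite /wsize /= => an.
change (q :: r \in [::] :: [seq q :: r | q <- iota 0 n.+1, r <- low_states n]).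
rewrite in_cons; apply/orP; right; apply: (allpairs_f cons).
  by rewrite mem_iota; lia.
by apply: IHr; rewrite /wsize; lia.
Qed.

Lemma rank_low a n : (rank a <= n)%N -> (wsize a <= n)%N.
Proof.
move=> an; apply: leq_trans an; rewrite /rank.
by case: (wsize a) => // m; rewrite !expnS expn0; nia.
Qed.


(** * Power series of functionals *)

Section Convolution.
Variable V : nmodType.
Implicit Types (F : nat -> nat -> V).

Definition conv (n : nat) F : V := \sum_(i < n.+1) F i (n - i)%N.

Lemma eq_conv n F G : (forall i j, (i + j)%N = n -> F i j = G i j) ->
  conv n F = conv n G.
Proof. by move=> FG; apply: eq_bigr => i _; apply: FG; have := ltn_ord i; lia. Qed.

Lemma conv0 F : conv 0 F = F 0%N 0%N.
Proof. by rewrite /conv big_ord1. Qed.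

Lemma convS n F : conv n.+1 F = F 0%N n.+1 + conv n (fun i j => F i.+1 j).
Proof.
by rewrite /conv big_ord_recl subn0; congr (_ + _).
Qed.

Lemma convSr n F : conv n.+1 F = \sum_(i < n.+1) F i (n.+1 - i)%N + F n.+1 0%N.
Proof. by rewrite /conv big_ord_recr /= subnn. Qed.

(** As a sum over a square with a diagonal condition, a convolution allows the exchange of its
    indices and one common truncation for several degrees. *)
Lemma conv_wide N n F : (n < N)%N ->
  conv n F = \sum_(i < N) \sum_(j < N | (i + j)%N == n) F i j.
Proof.
move=> nN; rewrite /conv (big_ord_widen N (fun i => F i (n - i)%N)) // big_mkcond /=.
apply: eq_bigr => i _; case: ltnP => ni.
  have nij : (n - i < N)%N by lia.
  rewrite (big_pred1 (Ordinal nij)) // => j.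
  by apply/eqP/eqP => [E|->] /=; [apply: val_inj => /=; lia|lia].
by rewrite big_pred0 // => j; apply/eqP; lia.
Qed.

Lemma convC n F : conv n F = conv n (fun i j => F j i).
Proof.
rewrite !(@conv_wide n.+1) // (exchange_big_dep xpredT) //=; apply: eq_bigr => i _.
by apply: eq_bigl => j; rewrite addnC.
Qed.

Lemma convD n F G :
  conv n (fun i j => F i j + G i j) = conv n F + conv n G.
Proof. exact: big_split. Qed.

Lemma convA n (F : nat -> nat -> nat -> V) :
  conv n (fun i m => conv i (fun j k => F j k m)) =
  conv n (fun j i => conv i (fun k m => F j k m)).
Proof.
elim: n F => [|n IHn] F; first by rewrite !conv0.
rewrite [LHS]convS conv0 [RHS]convS convS -addrA; congr (_ + _).
rewrite -(IHn (fun j => F j.+1)) -convD; apply: eq_conv => i m _.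
by rewrite convS.
Qed.

Lemma convACA n (F : nat -> nat -> nat -> nat -> V) :
  conv n (fun i j => conv i (fun a b => conv j (fun c d => F a b c d))) =
  conv n (fun i j => conv i (fun a c => conv j (fun b d => F a b c d))).
Proof.
rewrite !convA; apply: eq_conv => a i _.
rewrite -!convA; apply: eq_conv => j d _.
by rewrite convC.
Qed.

End Convolution.

(* Finite functionals on quasisymmetric functions form the algebra of
   noncommutative symmetric functions, the product being concatenation; a
   sequence of functionals is a power series over that algebra. *)
Notation dual_series R := (nat -> (seq nat -> R) -> R).

Section QuasiShuffle.
Variable R : comNzRingType.
Implicit Types (c : seq nat) (u : seq nat -> R) (w : seq nat * seq nat -> R).

Definition del0 c : seq nat := [seq i <- c | 1 <= i]%N.

Lemma del0_cat c d : del0 (c ++ d) = del0 c ++ del0 d.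
Proof. exact: filter_cat. Qed.

Lemma del0K c : del0 (del0 c) = del0 c.
Proof. by rewrite /del0 filter_id. Qed.

Lemma del0_id c : all (leq 1) c -> del0 c = c.
Proof. by move/all_filterP. Qed.

Definition zero_insens u : Prop := forall c, u (del0 c) = u c.
Definition zero_insens2 w : Prop := forall c d, w (del0 c, del0 d) = w (c, d).

(** The coefficient at exponents [c] of a product sums over all entrywise splittings c = p + q. Zero
    entries are kept, which reduces the quasi-shuffle of compositions to addition of vectors;
    [zero_insens2] expresses that they may be deleted afterwards. *)
Fixpoint qshuffle (c : seq nat) w : R :=
  if c is n :: c' then
    conv n (fun i j => qshuffle c' (fun p => w (i :: p.1, j :: p.2)))
  else w ([::], [::]).

Lemma fin_conv (I : Type) n (F : nat -> nat -> (I -> R) -> R) :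
  (forall i j, fin (F i j)) -> fin (fun v : I -> R => conv n (fun i j => F i j v)).
Proof. by move=> FP; apply: fin_sum => i _. Qed.

Lemma fin_convE (I : Type) (phi : (I -> R) -> R) n (F : nat -> nat -> I -> R) :
  fin phi -> phi (fun i => conv n (fun j k => F j k i)) =
             conv n (fun j k => phi (F j k)).
Proof. by move=> phiP; rewrite /conv (fin_sumE phiP). Qed.

Lemma fin_qshuffle c : fin (qshuffle c).
Proof.
elim: c => [|n c IHc] /=; first exact: fin_proj.
apply: fin_conv => i j; apply: (fin_comp IHc); exact: finmap_reindex.
Qed.

Lemma qshuffle_cat c d w : qshuffle (c ++ d) w =
  qshuffle c (fun p => qshuffle d (fun q => w (p.1 ++ q.1, p.2 ++ q.2))).
Proof.
elim: c w => [|n c IHc] w /=.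
  by congr qshuffle; apply: funext => -[].
by apply: eq_conv => i j _; rewrite IHc.
Qed.

Lemma zi2_eq w c d c' d' : zero_insens2 w ->
  del0 c = del0 c' -> del0 d = del0 d' -> w (c, d) = w (c', d').
Proof. by move=> wP cc' dd'; rewrite -wP cc' dd' wP. Qed.

Lemma qshuffle_del0 c w : zero_insens2 w -> qshuffle (del0 c) w = qshuffle c w.
Proof.
elim: c w => //= n c IHc w wP.
have wcons i j : zero_insens2 (fun p => w (i :: p.1, j :: p.2)).
  move=> p q /=; apply: zi2_eq => //;
  by rewrite -cat1s -[in RHS]cat1s !del0_cat del0K.
case: n => [|n] /=; last by apply: eq_conv => i j _; apply: IHc.
by rewrite conv0 IHc //; congr (qshuffle c _); apply: funext => -[p q]; apply: zi2_eq.
Qed.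

Lemma qshuffleA c (w : seq nat * (seq nat * seq nat) -> R) :
  qshuffle c (fun p => qshuffle p.1 (fun q => w (q.1, (q.2, p.2)))) =
  qshuffle c (fun p => qshuffle p.2 (fun q => w (p.1, q))).
Proof.
elim: c w => //= n c IHc w.
transitivity (conv n (fun i m => conv i (fun j k =>
    qshuffle c (fun p => qshuffle p.1 (fun q =>
      w (j :: q.1, (k :: q.2, m :: p.2))))))).
  by apply: eq_conv => i m _; rewrite (fin_convE _ _ (fin_qshuffle c)).
rewrite convA; apply: eq_conv => j i _; rewrite (fin_convE _ _ (fin_qshuffle c)).
apply: eq_conv => k m _.
exact: (IHc (fun r => w (j :: r.1, (k :: r.2.1, m :: r.2.2)))).
Qed.

Lemma qshuffle_unitl c (w : seq nat * seq nat -> R) :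
  (forall p q, ~~ nilp (del0 p) -> w (p, q) = 0) ->
  qshuffle c w = w (nseq (size c) 0%N, c).
Proof.
elim: c w => //= n c IHc w wP; rewrite /conv big_ord_recl big1 ?addr0.
  by rewrite IHc ?subn0 // => p q p0; apply: wP => /=.
move=> i _ /=; rewrite (_ : (fun _ => _) = (fun=> 0)) ?(fin0E (fin_qshuffle c)) //.
by apply: funext => p; apply: wP.
Qed.

Lemma qshuffleC c w : qshuffle c w = qshuffle c (fun p => w (p.2, p.1)).
Proof.
elim: c w => //= n c IHc w; rewrite [RHS]convC; apply: eq_conv => i j _.
by rewrite IHc.
Qed.

Implicit Types (phi psi : dual_series R).

Definition fin_family phi : Prop := forall n, fin (phi n).

Definition star phi psi : dual_series R := fun n u =>
  conv n (fun i j => phi i (fun a => psi j (fun b => u (a ++ b)))).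

Fixpoint hom_ext phi (c : seq nat) u : R :=
  if c is n :: c' then phi n (fun a => hom_ext phi c' (fun b => u (a ++ b)))
  else u [::].

Fixpoint antihom_ext phi (c : seq nat) u : R :=
  if c is n :: c' then antihom_ext phi c' (fun a => phi n (fun b => u (a ++ b)))
  else u [::].

Definition unital phi : Prop := forall u, phi 0%N u = u [::].

(** The coproduct of the n-th term, dual to multiplication of power series, is the sum of the
    tensors of the i-th and j-th terms with i + j = n. *)
Definition grouplike phi : Prop := forall n w, zero_insens2 w ->
  phi n (fun a => qshuffle a w) =
  conv n (fun i j => phi i (fun p => phi j (fun q => w (p, q)))).

Lemma fin_star phi psi : fin_family phi -> fin_family psi -> fin_family (star phi psi).
Proof.
move=> phiP psiP n; apply: fin_conv => i j; apply: (fin_comp (phiP i)) => a.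
apply: (fin_comp (psiP j)); exact: finmap_reindex.
Qed.

Lemma fin_hom_ext phi c : fin_family phi -> fin (hom_ext phi c).
Proof.
move=> phiP; elim: c => [|n c IHc] /=; first exact: fin_proj.
apply: (fin_comp (phiP n)) => a; apply: (fin_comp IHc); exact: finmap_reindex.
Qed.

Lemma fin_antihom_ext phi c : fin_family phi -> fin (antihom_ext phi c).
Proof.
move=> phiP; elim: c => [|n c IHc] /=; first exact: fin_proj.
apply: (fin_comp IHc) => a; apply: (fin_comp (phiP n)); exact: finmap_reindex.
Qed.

Lemma hom_ext_cat phi c d u : hom_ext phi (c ++ d) u =
  hom_ext phi c (fun a => hom_ext phi d (fun b => u (a ++ b))).
Proof.
elim: c u => //= n c IHc u; congr (phi n _); apply: funext => a; rewrite IHc.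
congr hom_ext; apply: funext => b; congr hom_ext; apply: funext => e.
by rewrite catA.
Qed.

Lemma antihom_ext_cat phi c d u : antihom_ext phi (c ++ d) u =
  antihom_ext phi d (fun a => antihom_ext phi c (fun b => u (a ++ b))).
Proof.
elim: c u => [|n c IHc] u /=.
  by congr antihom_ext; apply: funext => a; rewrite cats0.
rewrite IHc; congr antihom_ext; apply: funext => a; congr antihom_ext.
by apply: funext => b; congr (phi n _); apply: funext => e; rewrite catA.
Qed.

Lemma hom_ext_del0 phi c u : unital phi -> hom_ext phi (del0 c) u = hom_ext phi c u.
Proof.
move=> phi0; elim: c u => //= -[|n] c IHc u /=; first by rewrite phi0 IHc.
by congr (phi _ _); apply: funext => a; rewrite IHc.
Qed.

Lemma antihom_ext_del0 phi c u :
  unital phi -> antihom_ext phi (del0 c) u = antihom_ext phi c u.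
Proof.
move=> phi0; elim: c u => //= -[|n] c IHc u /=; last by rewrite IHc.
by rewrite IHc; congr antihom_ext; apply: funext => a; rewrite phi0 cats0.
Qed.

Lemma zi2_catl w c d : zero_insens2 w ->
  zero_insens2 (fun q => w (c ++ q.1, d ++ q.2)).
Proof. by move=> wP p q; apply: zi2_eq => //=; rewrite !del0_cat del0K. Qed.

(** The algebra map that sends the generators to [phi] respects the coproduct on generators because
    [phi] is group-like, and everywhere because the coproduct is multiplicative ([qshuffle_cat]).
    Dually, its transpose respects products. *)
Lemma hom_ext_mul phi c w : fin_family phi -> grouplike phi -> zero_insens2 w ->
  hom_ext phi c (fun a => qshuffle a w) =
  qshuffle c (fun p => hom_ext phi p.1 (fun a => hom_ext phi p.2 (fun b => w (a, b)))).
Proof.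
move=> phiP phiG; elim: c w => //= n c IHc w wP.
transitivity (phi n (fun a => qshuffle a (fun p =>
  qshuffle c (fun r => hom_ext phi r.1 (fun a => hom_ext phi r.2 (fun b =>
    w (p.1 ++ a, p.2 ++ b))))))).
  congr (phi n _); apply: funext => a.
  under eq_fun => b do rewrite qshuffle_cat.
  rewrite (finC (fin_hom_ext c phiP) _ (fin_qshuffle a)).
  congr qshuffle; apply: funext => p.
  by rewrite (IHc (fun q => w (p.1 ++ q.1, p.2 ++ q.2))) //; apply: zi2_catl.
rewrite phiG; last first.
  move=> p q /=; congr qshuffle; apply: funext => r.
  congr hom_ext; apply: funext => a; congr hom_ext; apply: funext => b.
  by apply: zi2_eq => //; rewrite !del0_cat del0K.
apply: eq_conv => i j _.
under eq_fun => p do rewrite (finC (phiP j) _ (fin_qshuffle c)).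
rewrite (finC (phiP i) _ (fin_qshuffle c)); congr qshuffle; apply: funext => r /=.
congr (phi i _); apply: funext => p.
by rewrite (finC (phiP j) _ (fin_hom_ext r.1 phiP)).
Qed.

Section StarTensor.
Variables (phi psi : dual_series R) (phiP : fin_family phi) (psiP : fin_family psi).

Lemma star_tensor n w :
  conv n (fun i j => star phi psi i (fun p => star phi psi j (fun q => w (p, q)))) =
  conv n (fun i j => conv i (fun i1 i2 => conv j (fun j1 j2 =>
    phi i1 (fun p => phi i2 (fun q => psi j1 (fun p' => psi j2 (fun q' =>
      w (p ++ p', q ++ q')))))))).
Proof.
rewrite [RHS]convACA; apply: eq_conv => i j _; apply: eq_conv => i1 j1 _.
rewrite -(fin_convE _ _ (phiP i1)); congr (phi i1 _); apply: funext => p.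
rewrite /star (fin_convE _ _ (psiP j1)); apply: eq_conv => i2 j2 _.
by rewrite (finC (psiP j1) _ (phiP i2)).
Qed.

Lemma grouplike_star : grouplike phi -> grouplike psi -> grouplike (star phi psi).
Proof.
move=> phiG psiG n w wP; rewrite star_tensor; apply: eq_conv => i j _.
transitivity (phi i (fun a => qshuffle a (fun p => psi j (fun b =>
   qshuffle b (fun q => w (p.1 ++ q.1, p.2 ++ q.2)))))).
  congr (phi i _); apply: funext => a.
  under eq_fun => b do rewrite qshuffle_cat.
  by rewrite (finC (psiP j) _ (fin_qshuffle a)).
rewrite phiG; last first.
  move=> p q /=; congr (psi j _); apply: funext => b; congr qshuffle.
  by apply: funext => r; apply: zi2_eq => //; rewrite !del0_cat del0K.
apply: eq_conv => i1 i2 _.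
rewrite -(fin_convE _ _ (phiP i1)); congr (phi i1 _); apply: funext => p.
rewrite -(fin_convE _ _ (phiP i2)); congr (phi i2 _); apply: funext => q.
by rewrite (psiG j (fun r => w (p ++ r.1, q ++ r.2))) //; apply: zi2_catl.
Qed.

End StarTensor.

End QuasiShuffle.


Section Families.
Variable R : comNzRingType.
Implicit Types (c : seq nat) (u : seq nat -> R) (w : seq nat * seq nat -> R).
Implicit Types (phi psi : dual_series R).

Definition unit_family : dual_series R := fun n u => if n is 0 then u [::] else 0.

Definition complete : dual_series R := fun n u => u (del0 [:: n]).

Lemma conv_unitr (V : nmodType) n (F : nat -> nat -> V) :
  (forall i j, F i j.+1 = 0) -> conv n F = F n 0%N.
Proof.
move=> F0; case: n => [|n]; first by rewrite conv0.
rewrite convSr big1 ?add0r // => i _.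
by rewrite subSn ?F0 // -ltnS.
Qed.

Lemma starA phi psi chi : fin_family phi -> fin_family psi ->
  star (star phi psi) chi = star phi (star psi chi).
Proof.
move=> phiP psiP; apply: funext => n; apply: funext => u.
rewrite /star convA; apply: eq_conv => i m _.
rewrite -(fin_convE _ _ (phiP i)); congr (phi i _); apply: funext => a.
apply: eq_conv => j k _; congr (psi j _); apply: funext => b.
by congr (chi k _); apply: funext => d; rewrite catA.
Qed.

Lemma star_unitr phi : fin_family phi -> star phi unit_family = phi.
Proof.
move=> phiP; apply: funext => n; apply: funext => u.
rewrite /star conv_unitr => [|i j]; last by rewrite (fin0E (phiP i)).
by congr (phi n _); apply: funext => a; rewrite /= cats0.
Qed.

Lemma star_unitl phi : star unit_family phi = phi.
Proof.
by apply: funext => n; apply: funext => u; rewrite /star convC conv_unitr.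
Qed.

Lemma fin_complete : fin_family complete.
Proof. by move=> n; apply: fin_proj. Qed.

Lemma grouplike_complete : grouplike complete.
Proof.
move=> [|n] w wP; first by rewrite conv0.
by rewrite /complete /=; apply: eq_conv => i j _; exact: (esym (wP [:: i] [:: j])).
Qed.

Fixpoint linv_fuel (f n : nat) (u : seq nat -> R) : R :=
  if f is f'.+1 then
    if n is 0 then u [::] else
    - \sum_(i < n) linv_fuel f' i (fun a => complete (n - i) (fun b => u (a ++ b)))
  else 0.

Fixpoint rinv_fuel (f n : nat) (u : seq nat -> R) : R :=
  if f is f'.+1 then
    if n is 0 then u [::] else
    - \sum_(i < n) complete (n - i) (fun a => rinv_fuel f' i (fun b => u (a ++ b)))
  else 0.

Lemma rinv_fuelS f n u : rinv_fuel f.+1 n.+1 u =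
  - \sum_(i < n.+1) complete (n.+1 - i) (fun a => rinv_fuel f i (fun b => u (a ++ b))).
Proof. by []. Qed.

(* The antipode of the complete functions *)
Definition inv_complete : dual_series R := fun n => linv_fuel n.+1 n.

Lemma linv_fuelS f n u : linv_fuel f.+1 n.+1 u =
  - \sum_(i < n.+1) linv_fuel f i (fun a => complete (n.+1 - i) (fun b => u (a ++ b))).
Proof. by []. Qed.

Lemma linv_fuelE f n u : (n < f)%N -> linv_fuel f n u = inv_complete n u.
Proof.
suff H m k : (n < m)%N -> (n < k)%N -> linv_fuel m n u = linv_fuel k n u.
  by move=> jn; apply: H.
elim: m k n u => [|m IHm] [|k] n u //; rewrite !ltnS => nm nk /=.
case: n nm nk => // n nm nk; congr (- _); apply: eq_bigr => i _; apply: IHm.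
  by apply: leq_trans nm.
by apply: leq_trans nk.
Qed.

Lemma inv_complete0 u : inv_complete 0 u = u [::].
Proof. by []. Qed.

Lemma inv_completeS n u : inv_complete n.+1 u =
  - \sum_(i < n.+1) inv_complete i (fun a => complete (n.+1 - i) (fun b => u (a ++ b))).
Proof.
rewrite {1}/inv_complete linv_fuelS; congr (- _); apply: eq_bigr => i _.
exact: linv_fuelE.
Qed.

Lemma fin_inv_complete : fin_family inv_complete.
Proof.
suff H f n : fin (linv_fuel f n) by move=> n; apply: H.
elim: f n => [|f IHf] [|n] /=; [exact: fin_zero|exact: fin_zero|exact: fin_proj|].
apply: fin_opp; apply: fin_sum => i _; apply: (fin_comp (IHf i)) => a.
exact: fin_proj.
Qed.

Lemma star_inv_complete : star inv_complete complete = unit_family.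
Proof.
apply: funext => -[|n]; apply: funext => u; first by rewrite /star conv0.
rewrite /star convSr /= [X in _ + X](_ : _ = inv_complete n.+1 u).
  by rewrite inv_completeS subrr.
by congr (inv_complete _ _); apply: funext => a; rewrite /complete /= cats0.
Qed.

(** Concatenation is not commutative, so a right inverse is built by its own recursion and then
    identified with the left inverse by associativity. *)
Lemma star_complete_inv : star complete inv_complete = unit_family.
Proof.
pose rinv : dual_series R := fun n => rinv_fuel n.+1 n.
have rinvE f n u : (n < f)%N -> rinv_fuel f n u = rinv n u.
  suff H m k : (n < m)%N -> (n < k)%N -> rinv_fuel m n u = rinv_fuel k n u.
    by move=> jn; apply: H.
  elim: m k n u => [|m IHm] [|k] n u //; rewrite !ltnS => nm nk /=.
  case: n nm nk => // n nm nk; congr (- _); apply: eq_bigr => i _; apply: IHm.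
    by apply: leq_trans nm.
  by apply: leq_trans nk.
have rinvP : star complete rinv = unit_family.
  apply: funext => -[|n]; apply: funext => u; first by rewrite /star conv0.
  rewrite /star convC convSr.
  have -> : complete 0 (fun a => rinv n.+1 (fun b => u (a ++ b))) = rinv n.+1 u by [].
  rewrite {2}/rinv rinv_fuelS [X in _ - X](_ : _ = \sum_(i < n.+1)
    complete (n.+1 - i) (fun a => rinv i (fun b => u (a ++ b)))) ?subrr //.
  by apply: eq_bigr => i _; rewrite /complete rinvE.
rewrite -rinvP; congr star; rewrite -[LHS](star_unitr fin_inv_complete) -rinvP.
rewrite -starA ?star_inv_complete ?star_unitl //.
  exact: fin_inv_complete.
exact: fin_complete.
Qed.

(** The inverse of a group-like series is group-like: the tensor expression [E] satisfies the
    recursion that defines the coproduct of the inverse. *)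
Lemma grouplike_inv_complete : grouplike inv_complete.
Proof.
move=> n; have [m] := ubnP n; elim: m n => // m IHm [|n] nm w wP.
  by rewrite conv0.
pose E i w := conv i (fun j k =>
  inv_complete j (fun p => inv_complete k (fun q => w (p, q)))).
pose W i w (p : seq nat * seq nat) := conv i (fun j k => complete j (fun c =>
  complete k (fun d => w (p.1 ++ c, p.2 ++ d)))).
(* This is the coproduct of [inv_complete] times [complete], in positive degree. Its last summand is
   the wanted tensor expression; the others are known by induction. *)
have total : conv n.+1 (fun i j => E i (W j w)) = 0.
  transitivity (conv n.+1 (fun i j =>
      unit_family i (fun p => unit_family j (fun q => w (p, q))))).
    rewrite -star_inv_complete star_tensor; [|exact: fin_inv_complete|exact: fin_complete].
    apply: eq_conv => i j _; apply: eq_conv => i1 i2 _.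
    rewrite -(fin_convE _ _ (fin_inv_complete i1)); congr (inv_complete i1 _).
    apply: funext => p; rewrite -(fin_convE _ _ (fin_inv_complete i2)).
    by congr (inv_complete i2 _).
  by rewrite convC conv_unitr // => -[].
rewrite inv_completeS; apply/eqP; rewrite -subr_eq0 -opprD oppr_eq0; apply/eqP.
rewrite -[RHS]total [RHS]convSr; congr (_ + _).
  apply: eq_bigr => i _.
  transitivity (inv_complete i (fun a => qshuffle a (W (n.+1 - i)%N w))); last first.
    apply: IHm; first by have := ltn_ord i; lia.
    move=> p q /=; rewrite /W; apply: eq_conv => j k _.
    by apply: zi2_eq => //=; rewrite !del0_cat !del0K.
  congr (inv_complete i _); apply: funext => a.
  rewrite [complete _ _]/complete qshuffle_cat; congr (qshuffle a _).
  apply: funext => p; rewrite qshuffle_del0; last exact: zi2_catl.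
  rewrite [LHS]/= /W; apply: eq_conv => j k _.
  by apply: zi2_eq => //; rewrite !del0_cat /complete del0K.
apply: eq_conv => j k _; congr (inv_complete j _); apply: funext => p.
congr (inv_complete k _); apply: funext => q.
by rewrite /W conv0 /complete /= !cats0.
Qed.

End Families.


(** * The series that defines Theta, and its action on rows *)

Section PeakSeries.
Variables (R : comNzRingType) (beta : R).
Implicit Types (c : seq nat) (u : seq nat -> R) (w : seq nat * seq nat -> R).

(* The coefficient of x^n in the m-th power of - x / (1 + beta x) *)
Fixpoint neg_coef (n m : nat) : R :=
  match n, m with
  | 0, 0 => 1
  | n'.+1, m'.+1 => - (beta * neg_coef n' m) - neg_coef n' m'
  | _, _ => 0
  end.

Lemma neg_coefSS n m : neg_coef n.+1 m.+1 =
  - (beta * neg_coef n m.+1) - neg_coef n m.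
Proof. by []. Qed.

Lemma neg_coef_small n m : (n < m)%N -> neg_coef n m = 0.
Proof.
elim: n m => [|n IHn] [|m] // nm; rewrite neg_coefSS !IHn //; last by lia.
by rewrite mulr0 subr0 oppr0.
Qed.

Lemma neg_coefD n i j :
  conv n (fun k l => neg_coef k i * neg_coef l j) = neg_coef n (i + j).
Proof.
elim: i n => [|i IHi] n.
  rewrite convC conv_unitr => [|k l]; last by rewrite mul0r.
  by rewrite mul1r.
elim: n => [|n IHn]; first by rewrite conv0 mul0r.
rewrite convS mul0r add0r addSn neg_coefSS -addSn -IHn -IHi.
rewrite /conv mulr_sumr -opprD -big_split -sumrN; apply: eq_bigr => k _ /=.
by ring.
Qed.

(** H(y)^-1 for y = -x/(1+beta x), expanded in powers of x. *)
Definition neg_complete : dual_series R := fun n u =>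
  \sum_(m < n.+1) neg_coef n m * inv_complete m u.

Lemma fin_neg_complete : fin_family neg_complete.
Proof.
by move=> n; apply: fin_sum => m _; apply: fin_scale; apply: fin_inv_complete.
Qed.

Lemma neg_complete_wide N n u : (n < N)%N ->
  neg_complete n u = \sum_(m < N) neg_coef n m * inv_complete m u.
Proof.
move=> nN; rewrite /neg_complete.
rewrite (big_ord_widen N (fun m => neg_coef n m * inv_complete m u)) // big_mkcond /=.
by apply: eq_bigr => m _; case: ltnP => // nm; rewrite neg_coef_small ?mul0r.
Qed.

(** Substituting y for the variable preserves group-likeness, because y^(i+j) = y^i y^j; [neg_coefD]
    is this rule for the coefficients. *)
Lemma grouplike_neg_complete : grouplike neg_complete.
Proof.
move=> n w wP; pose N := n.+1.
pose X i j := inv_complete i (fun p => inv_complete j (fun q => w (p, q))).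
transitivity (\sum_(i < N) \sum_(j < N) neg_coef n (i + j) * X i j).
  rewrite (@neg_complete_wide N) //.
  transitivity (\sum_(m < N) \sum_(i < N) \sum_(j < N)
      (if (i + j)%N == m then neg_coef n m * X i j else 0)).
    apply: eq_bigr => m _; rewrite grouplike_inv_complete // (@conv_wide _ N) //.
    rewrite mulr_sumr; apply: eq_bigr => i _; rewrite mulr_sumr.
    by rewrite big_mkcond.
  rewrite exchange_big; apply: eq_bigr => i _; rewrite exchange_big.
  apply: eq_bigr => j _; rewrite -big_mkcond /=.
  have [ij|ij] := ltnP (i + j) N.
    by rewrite (big_pred1 (Ordinal ij)).
  rewrite big1 => [|m /eqP ijm]; first by rewrite neg_coef_small ?mul0r.
  by have := ltn_ord m; rewrite -ijm ltnNge ij.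
transitivity (conv n (fun k l => \sum_(i < N) \sum_(j < N)
    neg_coef k i * neg_coef l j * X i j)); last first.
  apply: eq_conv => k l kl; rewrite (@neg_complete_wide N); last by lia.
  apply: eq_bigr => i _.
  rewrite (_ : (fun p => neg_complete l _) = (fun p => \sum_(j < N)
      neg_coef l j * inv_complete j (fun q => w (p, q)))); last first.
    by apply: funext => p; apply: neg_complete_wide; lia.
  rewrite (fin_sumE (@fin_inv_complete R i)) mulr_sumr; apply: eq_bigr => j _.
  by rewrite (finZE (@fin_inv_complete R i)) mulrA.
rewrite /conv [RHS]exchange_big; apply: eq_bigr => i _; rewrite [RHS]exchange_big.
apply: eq_bigr => j _; rewrite -neg_coefD /conv mulr_suml.
by apply: eq_bigr.
Qed.

(* H(-x/(1+beta x))^-1 H(x) *)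
Definition peak_series : dual_series R := star neg_complete (@complete R).

Lemma fin_peak_series : fin_family peak_series.
Proof. exact: (fin_star fin_neg_complete (@fin_complete R)). Qed.

Lemma grouplike_peak_series : grouplike peak_series.
Proof.
apply: grouplike_star; [exact: fin_neg_complete|exact: (@fin_complete R)| |].
  exact: grouplike_neg_complete.
exact: grouplike_complete.
Qed.

Lemma unital_peak_series : unital peak_series.
Proof.
by move=> u; rewrite /peak_series /star conv0 /neg_complete big_ord1 mul1r.
Qed.

Lemma conv_two (V : nmodType) n (F : nat -> nat -> V) : (forall i j, F i j.+2 = 0) ->
  conv n.+1 F = F n.+1 0%N + F n 1%N.
Proof. by move=> F0; rewrite convC convS; congr (_ + _); rewrite convC conv_unitr. Qed.

Lemma convSl (V : nmodType) n (F : nat -> nat -> V) :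
  conv n.+1 F = F n.+1 0%N + conv n (fun i j => F i j.+1).
Proof. by rewrite convC convS; congr (_ + _); rewrite convC. Qed.

Lemma coef_const_row (g : state -> R) a n :
  (const_row g a)`_n = if n is 0 then g a else 0.
Proof. by rewrite /const_row coefC; case: n. Qed.

(** [unprim] is linear over polynomials in x, so on a row of polynomials it acts as the product of
    U(x) with a series of constant rows. *)
Lemma coef_unprim_conv (h : state -> {poly R}) a n :
  (unprim beta%:P 'X h a)`_n = conv n (fun i j => ustep beta (fun s => (h s)`_i) j a).
Proof.
case: a => [|q r].
  rewrite conv_unitr => [|i j]; by rewrite /ustep /= coef_const_row.
elim: q n => [|q IHq] n; rewrite /ustep.
  rewrite coef_unprim0.
  under [in RHS]eq_conv => i j _ do rewrite coef_unprim0 !coef_const_row.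
  case: n => [|n]; first by rewrite conv0.
  rewrite conv_two => [|i j]; rewrite !coef_const_row ?addr0 ?add0r //.
  by rewrite mulr0 ?addr0.
rewrite coef_unprimS; case: n => [|n].
  by rewrite conv0 coef_unprimS coef_const_row.
rewrite convSl coef_unprimS !coef_const_row addr0; congr (_ + _).
under [in RHS]eq_conv => i j _ do rewrite coef_unprimS !coef_const_row add0r.
rewrite convD IHq; congr (_ + _); rewrite conv_unitr // => i j; by rewrite mulr0.
Qed.

Section CompleteRow.
Variables (chi : (seq nat -> R) -> R) (chiP : fin chi).

Definition rowof (a : state) : R := chi (fun c => lrow beta c a).

(** Right multiplication of a functional by H(x) becomes the transfer of an unprimed letter on its
    values at the L_a, since appending an exponent to a monomial adds one variable. The case n = 0
    uses H_0 = 1. *)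
Lemma complete_row n a :
  chi (fun c => complete n (fun d => lrow beta (c ++ d) a)) = ustep beta rowof n a.
Proof.
rewrite /complete; case: n => [|n] /=.
  rewrite /ustep coef0_unprim coef_const_row; congr chi; apply: funext => c.
  by rewrite cats0.
transitivity (chi (fun c => ustep beta (lrow beta c) n.+1 a)).
  by congr chi; apply: funext => c; rewrite cats1 lrow_rcons.
by rewrite (finC chiP _ (fin_ustep beta n.+1 a)).
Qed.

End CompleteRow.

Section Evaluation.
Variables (chi : (seq nat -> R) -> R) (chiP : fin chi).
Let g := rowof chi.

Lemma fin_extend (phi : dual_series R) n : fin_family phi ->
  fin (fun u : seq nat -> R => chi (fun c => phi n (fun d => u (c ++ d)))).
Proof.
move=> phiP; apply: (fin_comp chiP) => c; apply: (fin_comp (phiP n)).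
exact: finmap_reindex.
Qed.

Definition inv_row n a := chi (fun c => inv_complete n (fun d => lrow beta (c ++ d) a)).

Lemma inv_row0 a : inv_row 0 a = g a.
Proof. by congr chi; apply: funext => c; rewrite inv_complete0 cats0. Qed.

(** The identity H^-1 H = 1 read on rows: U(x) sends the series of the [inv_row] to the constant row
    [g]. The recursions that follow solve this equation for the inverse of U(x). *)
Lemma inv_rowP n a :
  conv n (fun i j => ustep beta (inv_row i) j a) = if n is 0 then g a else 0.
Proof.
transitivity (chi (fun c => star (@inv_complete R) (@complete R) n
                    (fun d => lrow beta (c ++ d) a))).
  rewrite /star (fin_convE _ _ chiP); apply: eq_conv => i j _.
  rewrite -(complete_row (fin_extend i (@fin_inv_complete R))).
  congr chi; apply: funext => c; congr (inv_complete i _); apply: funext => d.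
  by congr (complete j _); apply: funext => e; rewrite catA.
rewrite star_inv_complete; case: n => [|n]; last exact: (fin0E chiP).
by congr chi; apply: funext => c; rewrite /= cats0.
Qed.

Lemma inv_row_nil n : inv_row n.+1 [::] = 0.
Proof.
rewrite -[RHS](inv_rowP n.+1 [::]) conv_unitr => [|i j];
by rewrite /ustep /= coef_const_row.
Qed.

Lemma inv_row_zero n r :
  inv_row n.+1 (0%N :: r) = - (beta * inv_row n (0%N :: r) + inv_row n r).
Proof.
apply/eqP; rewrite -addr_eq0; apply/eqP; rewrite -[RHS](inv_rowP n.+1 (0%N :: r)).
rewrite conv_two => [|i j]; rewrite /ustep !coef_unprim0 !coef_const_row.
  by rewrite addr0 add0r.
by rewrite mulr0 !addr0.
Qed.

Lemma inv_row_succ n q r : inv_row n.+1 (q.+1 :: r) =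
  - (beta * inv_row n (q.+1 :: r) + (if n is 0 then g (q :: r) else 0)).
Proof.
apply/eqP; rewrite -addr_eq0; apply/eqP; rewrite -[RHS](inv_rowP n.+1 (q.+1 :: r)).
rewrite convSl /ustep coef_unprimS coef_const_row addr0; congr (_ + _).
under [in RHS]eq_conv => i j _ do rewrite coef_unprimS !coef_const_row add0r.
rewrite convD; congr (_ + _); last exact: esym (inv_rowP _ _).
by rewrite conv_unitr // => i j; rewrite mulr0.
Qed.

Definition neg_row n a :=
  chi (fun c => neg_complete n (fun d => lrow beta (c ++ d) a)).

Lemma neg_rowE n a : neg_row n a = \sum_(m < n.+1) neg_coef n m * inv_row m a.
Proof.
rewrite /neg_row /neg_complete (fin_sumE chiP); apply: eq_bigr => m _.
by rewrite (finZE chiP).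
Qed.

(** From (1 + beta x) y^(m+1) = - x y^m for y = -x/(1+beta x). The power y^0 obeys no such rule; its
    contribution [g], present only in degree 0, is subtracted first. *)
Lemma neg_rowS n a : neg_row n.+1 a =
  - (beta * (neg_row n a - (if n is 0 then g a else 0)))
  - \sum_(m < n.+1) neg_coef n m * inv_row m.+1 a.
Proof.
rewrite neg_rowE big_ord_recl mul0r add0r.
have -> : neg_row n a - (if n is 0 then g a else 0) =
    \sum_(m < n.+1) neg_coef n m.+1 * inv_row m.+1 a.
  rewrite neg_rowE big_ord_recl inv_row0 [RHS]big_ord_recr /=.
  rewrite (@neg_coef_small n n.+1) // mul0r addr0 addrAC.
  rewrite (_ : neg_coef n 0 * g a - _ = 0) ?add0r //.
  by case: n => [|n]; rewrite ?mul1r ?mul0r ?subr0 ?subrr.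
rewrite mulr_sumr -opprD -big_split -sumrN; apply: eq_bigr => m _.
by rewrite neg_coefSS /=; ring.
Qed.

(** This is V(x) = U(-x/(1+beta x))^-1. Inverting U turns a recursion that runs through ascents into
    one that runs through descents; the substitution then repairs the signs and produces the factor
    1 + beta x. *)
Lemma neg_row_prim n a : neg_row n a = (prim beta%:P 'X false (const_row g) a)`_n.
Proof.
elim: a n => [|[|q] r IHr] [|n]; rewrite ?coef0_prim.
all: try by rewrite neg_rowE big_ord1 mul1r inv_row0 coef_const_row.
- rewrite neg_rowE coef_const_row big_ord_recl mul0r add0r big1 // => m _.
  by rewrite inv_row_nil mulr0.
- rewrite neg_rowS coef_prim0 !coef_const_row add0r -IHr.
  under eq_bigr => m _ do rewrite inv_row_zero mulrN mulrDr mulrCA.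
  rewrite sumrN big_split -mulr_sumr -!neg_rowE /=.
  by case: n => [|n]; ring.
- rewrite neg_rowS coef_primS !coef_const_row add0r.
  under eq_bigr => m _ do rewrite inv_row_succ mulrN mulrDr mulrCA.
  rewrite sumrN big_split -mulr_sumr -!neg_rowE /=.
  have -> : \sum_(i < n.+1) neg_coef n i *
      (if nat_of_ord i is 0 then g (q :: r) else 0) = if n is 0 then g (q :: r) else 0.
    rewrite big_ord_recl big1 ?addr0; last by move=> i _; rewrite mulr0.
    by case: n => [|n]; rewrite ?mul1r ?mul0r.
  by case: n => [|n]; ring.
Qed.

Lemma peak_series_row n a :
  chi (fun c => peak_series n (fun d => lrow beta (c ++ d) a)) = vstep beta false g n a.
Proof.
rewrite /peak_series /star (fin_convE _ _ chiP) /vstep /variable coef_unprim_conv.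
apply: eq_conv => i j _.
transitivity (ustep beta (neg_row i) j a).
  rewrite -(complete_row (fin_extend i fin_neg_complete)).
  congr chi; apply: funext => c; congr (neg_complete i _); apply: funext => d.
  by congr (complete j _); apply: funext => e; rewrite catA.
by congr ustep; apply: funext => s; rewrite neg_row_prim.
Qed.

End Evaluation.

(** The coefficient form of Theta(L_a) = K_a: each exponent in [c] contributes one factor of the
    series, hence one application of [vstep]. *)
Lemma hom_ext_peak_series c a :
  hom_ext peak_series c (fun d => lrow beta d a) = krow beta false c a.
Proof.
elim/last_ind: c a => // c n IHc a.
rewrite -cats1 hom_ext_cat /= cats1 krow_rcons.
transitivity (vstep beta false (rowof (hom_ext peak_series c)) n a).
  rewrite -peak_series_row; last exact: (fin_hom_ext c fin_peak_series).
  congr hom_ext; apply: funext => b; congr (peak_series n _).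
  by apply: funext => d; rewrite cats0.
by congr vstep; apply: funext => s; rewrite /rowof IHc.
Qed.

End PeakSeries.


(** * Coordinates of power series *)

Lemma fsum_seq (V : nmodType) (T : choiceType) (A : set T) (r : seq T) (F : T -> V) :
  uniq r -> (forall t, A t <-> t \in r) -> \sum_(t \in A) F t = \sum_(t <- r) F t.
Proof.
move=> r_uniq Ar; rewrite [RHS]fsbig_seq //; apply: eq_fsbigl.
by rewrite predeqE => t /=; rewrite Ar.
Qed.

Section Monomials.
Implicit Types (m : monomial) (c : seq nat).

Definition exps (k : nat) m : seq nat := [seq m i | i <- iota 0 k].

Definition mbound m : nat := (\max_(i <- finsupp m) i).+1.

Lemma mboundP m i : (mbound m <= i)%N -> m i = 0%N.
Proof.
move=> mi; apply/eqP; rewrite cmE_eq0; apply/negP => im; move: mi.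
by rewrite /mbound ltnNge (big_rem i) //= leq_maxl.
Qed.

Definition mcomp m : seq nat := del0 (exps (mbound m) m).

Definition msupp m : seq nat := [seq i <- iota 0 (mbound m) | m i != 0]%N.

Lemma del0_exps k m : (forall i, (k <= i)%N -> m i = 0%N) ->
  del0 (exps k m) = mcomp m.
Proof.
have ext k' d : (forall i, (k' <= i)%N -> m i = 0%N) ->
    del0 (exps (k' + d) m) = del0 (exps k' m).
  move=> mk; rewrite /exps iotaD map_cat del0_cat.
  rewrite [X in _ ++ X](_ : _ = [::]) ?cats0 // add0n.
  elim: d k' mk => //= d IHd k' mk; rewrite mk //=.
  by apply: IHd => i ki; apply: mk; apply: ltnW.
move=> mk; rewrite /mcomp -(ext k (mbound m)) // -(ext (mbound m) k) 1?addnC //.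
exact: mboundP.
Qed.

Lemma mcompE m : mcomp m = [seq m i | i <- msupp m].
Proof.
rewrite /mcomp /exps /del0 filter_map /msupp; congr map.
by apply: eq_filter => i /=; rewrite lt0n.
Qed.

Lemma mem_msupp m i : (i \in msupp m) = (m i != 0%N).
Proof.
rewrite mem_filter mem_iota add0n /=; case: (boolP (m i == 0%N)) => // mi.
by rewrite ltnNge; apply/negP => /mboundP mi0; rewrite mi0 in mi.
Qed.

Lemma msupp_sorted m : sorted ltn (msupp m).
Proof. by apply: sorted_filter; [exact: ltn_trans|exact: iota_ltn_sorted]. Qed.

Lemma expcmnE m n i : expcmn m n i = (n * m i)%N.
Proof.
rewrite /expcmn; case: n => [|n]; first exact: onecmE.
rewrite iteropS; elim: n => [|n IHn]; first by rewrite mul1n.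
by rewrite iterS mulcmE IHn mulSn.
Qed.

Lemma xmonE (i a : seq nat) j : uniq i -> size i = size a ->
  xmon i a j = if j \in i then nth 0%N a (index j i) else 0%N.
Proof.
rewrite /xmon; elim: i a => [|k i IHi] [|n a] //=; first by rewrite big_nil cm1.
move=> /andP[ki i_uniq] [ia]; rewrite big_cons cmM expcmnE ucmE IHi // inE.
rewrite [j == k]eq_sym; case: eqVneq => [<-|kj] /=; last by rewrite muln0.
by rewrite (negPf ki) muln1 addn0.
Qed.

Lemma xmon_iotaE k c j : size c = k -> xmon (iota 0 k) c j = nth 0%N c j.
Proof.
move=> ck; rewrite xmonE ?iota_uniq ?size_iota // mem_iota add0n /=.
case: ltnP => [jk|kj]; last by rewrite nth_default // ck.
by rewrite -{1}[j]add0n -(nth_iota 0 0 jk) index_uniq ?size_iota ?iota_uniq.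
Qed.

Lemma exps_xmon k c : size c = k -> exps k (xmon (iota 0 k) c) = c.
Proof.
move=> ck; apply: (@eq_from_nth _ 0%N); first by rewrite size_map size_iota ck.
move=> j; rewrite size_map size_iota => jk.
by rewrite (nth_map 0%N) ?size_iota // nth_iota // xmon_iotaE.
Qed.

Lemma mcomp_xmon_iota k c : size c = k -> mcomp (xmon (iota 0 k) c) = del0 c.
Proof.
move=> ck; rewrite -(@del0_exps k) ?exps_xmon // => i ki.
by rewrite xmon_iotaE // nth_default // ck.
Qed.

Section SortedMonomial.
Variables (i a : seq nat) (ia : size i = size a) (i_sorted : sorted ltn i).
Hypothesis a_pos : all (leq 1) a.

Let i_uniq : uniq i.
Proof. exact: (sorted_uniq ltn_trans ltnn). Qed.

Lemma msupp_xmon : msupp (xmon i a) = i.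
Proof.
apply: (irr_sorted_eq ltn_trans ltnn) => //; first exact: msupp_sorted.
move=> j; rewrite mem_msupp xmonE //; case: ifP => // ji.
by rewrite -lt0n; apply: (allP a_pos); rewrite mem_nth // -ia index_mem.
Qed.

Lemma mcomp_xmon : mcomp (xmon i a) = a.
Proof.
rewrite mcompE msupp_xmon; apply: (@eq_from_nth _ 0%N); first by rewrite size_map.
move=> j; rewrite size_map => ji; rewrite (nth_map 0%N) // xmonE // mem_nth //.
by rewrite index_uniq.
Qed.

End SortedMonomial.

Lemma xmon_mcomp m : xmon (msupp m) (mcomp m) = m.
Proof.
have supp_uniq : uniq (msupp m).
  exact: (sorted_uniq ltn_trans ltnn (msupp_sorted m)).
apply/eqP/cmP => j; rewrite xmonE ?mcompE ?size_map // mem_msupp.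
case: eqP => //= /eqP mj; rewrite (nth_map 0%N) ?index_mem ?mem_msupp //.
by rewrite nth_index ?mem_msupp.
Qed.

Lemma mcomp_pos m : all (leq 1) (mcomp m).
Proof. exact: filter_all. Qed.

Definition comp_del0 c : composition := exist _ (del0 c) (filter_all _ c).
Definition comp_of m : composition := exist _ (mcomp m) (mcomp_pos m).

Lemma comp_pos (a : composition) : all (leq 1) (val a).
Proof. exact: (valP a). Qed.

Lemma comp_del0_val (a : composition) : comp_del0 (val a) = a.
Proof. by apply: val_inj; rewrite /= del0_id ?comp_pos. Qed.

End Monomials.

Section PowerSeries.
Variable R : comNzRingType.

(** Every monomial is [xmon (msupp m) (mcomp m)], so invariance says that a coefficient depends on
    the composition of nonzero exponents alone. *)
Lemma mQSymP (f : pseries R) :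
  mQSym R f <-> forall m, f m = qsym_coord f (comp_of m).
Proof.
split=> [fQ m|fQ a i a_pos ia i_sorted].
  rewrite /qsym_coord /= (fQ (mcomp m) (msupp m)) ?mcomp_pos ?xmon_mcomp ?msupp_sorted //.
  by rewrite mcompE size_map.
rewrite !fQ; congr (qsym_coord f); apply: val_inj => /=.
by rewrite mcomp_xmon_iota // del0_id // mcomp_xmon.
Qed.

Lemma MqsymE (a : composition) m : Mqsym R a m = (a == comp_of m)%:R.
Proof.
rewrite /Mqsym /mon_sum; case: eqP => [->|am].
  rewrite (fsbigE [:: msupp m]) //=.
  - rewrite big_mkcond big_seq1 mem_set /= ?xmon_mcomp ?eqxx ?mulr1 //.
    by split; [rewrite mcompE size_map|exact: msupp_sorted].
  - move=> i /=; rewrite inE => /eqP ->.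
    by split; [rewrite mcompE size_map|exact: msupp_sorted].
  - move=> i [ia i_sorted]; rewrite inE; apply: contraNeq => /=.
    rewrite mul1r; have [im _|_] := eqVneq (xmon i (mcomp m)) m; last by rewrite eqxx.
    by rewrite -{1}im msupp_xmon // mcomp_pos.
apply: fsbig1 => i [ia i_sorted]; rewrite mul1r; case: eqP => // im.
by case: am; apply: val_inj; rewrite /= -im mcomp_xmon // comp_pos.
Qed.

Lemma lc_comb_Mqsym (u : composition -> R) m : lc_comb (@Mqsym R) u m = u (comp_of m).
Proof.
rewrite (@lc_combE _ _ _ _ _ _ [:: comp_of m]) // => [|a].
  by rewrite big_seq1 MqsymE eqxx mulr1.
by rewrite MqsymE inE; case: (a == _) => //; rewrite eqxx.
Qed.

Fixpoint splits (c : seq nat) : seq (seq nat * seq nat) :=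
  if c is n :: c' then
    [seq (i :: p.1, (n - i)%N :: p.2) | i <- iota 0 n.+1, p <- splits c']
  else [:: ([::], [::])].

Arguments splits : simpl never.

Lemma splits_cons n c : splits (n :: c) =
  [seq (i :: p.1, (n - i)%N :: p.2) | i <- iota 0 n.+1, p <- splits c].
Proof. by []. Qed.

Lemma splitsP c p : p \in splits c <->
  [/\ size p.1 = size c, size p.2 = size c &
      forall j, (nth 0 p.1 j + nth 0 p.2 j)%N = nth 0%N c j].
Proof.
elim: c p => [|n c IHc] [p q].
  rewrite inE; split=> [/eqP[-> ->]|[]]; first by split=> // j; rewrite !nth_nil.
  by case: p => // _; case: q.
split.
  case/allpairsP => -[i [p' q']] [i_n /IHc[pc qc pqc] [-> ->]].
  have : i \in iota 0 n.+1 by exact: i_n.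
  rewrite mem_iota /= add0n ltnS => ni; split=> [||[|j]] /=; rewrite ?pc ?qc //.
  exact: subnKC.
case: p => [|i p] [] //= [pc]; case: q => // j q [qc] pqc.
have ijn := pqc 0%N; rewrite /= in ijn.
rewrite splits_cons; apply/allpairsP; exists (i, (p, q)); split.
    by change (i \in iota 0 n.+1); rewrite mem_iota; lia.
  by apply/IHc; split=> // k; exact: (pqc k.+1).
by rewrite /= -ijn addKn.
Qed.

Lemma splits_uniq c : uniq (splits c).
Proof.
elim: c => // n c IHc; rewrite splits_cons.
apply: allpairs_uniq => //; first exact: iota_uniq.
by move=> [i [p q]] [j [p' q']] _ _ /= [-> -> _ ->].
Qed.

Lemma qshuffle_splits c (w : seq nat * seq nat -> R) :
  qshuffle c w = \sum_(p <- splits c) w p.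
Proof.
elim: c w => [|n c IHc] w; first by rewrite big_seq1.
rewrite splits_cons big_allpairs_dep /= /conv.
rewrite -(big_mkord xpredT
  (fun i => qshuffle c (fun p => w (i :: p.1, (n - i)%N :: p.2)))).
rewrite /index_iota subn0; apply: eq_bigr => i _; exact: IHc.
Qed.

(** The factorizations of the monomial with exponents [val a] on consecutive variables correspond to
    the entrywise splittings of [val a]. Zero exponents in a factor disappear when its coordinate is
    read. *)
Lemma qsym_mulE (w : composition * composition -> R) (a : composition) :
  qsym_mul w a =
  qshuffle (val a) (fun p => w (comp_del0 p.1, comp_del0 p.2)).
Proof.
rewrite /qsym_mul /qsym_coord /ps_mul; set c := val a; pose k := size c.
pose mons (p : seq nat * seq nat) := (xmon (iota 0 k) p.1, xmon (iota 0 k) p.2).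
rewrite (@fsum_seq _ _ _ (map mons (splits c))); first last.
- move=> [m1 m2] /=; split=> [m12|/mapP[[p q] /splitsP[/= pc qc pqc]] [-> ->]].
    have ck j : (m1 j + m2 j)%N = nth 0%N c j.
      by rewrite -cmM m12 xmon_iotaE.
    have zero j : (k <= j)%N -> m1 j = 0%N /\ m2 j = 0%N.
      by move=> kj; have := ck j; rewrite nth_default //; lia.
    apply/mapP; exists (exps k m1, exps k m2).
      apply/splitsP; rewrite /= !size_map size_iota; split=> // j; rewrite -ck.
      have [jk|kj] := ltnP j k.
        by rewrite !(nth_map 0%N) ?size_iota // nth_iota.
      by rewrite !nth_default ?size_map ?size_iota //; have [-> ->] := zero j kj.
    congr pair; apply/eqP/cmP => j; rewrite xmon_iotaE ?size_map ?size_iota //.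
      have [jk|kj] := ltnP j k; first by rewrite (nth_map 0%N) ?size_iota // nth_iota.
      by rewrite nth_default ?size_map ?size_iota //; have [] := zero j kj.
    have [jk|kj] := ltnP j k; first by rewrite (nth_map 0%N) ?size_iota // nth_iota.
    by rewrite nth_default ?size_map ?size_iota //; have [] := zero j kj.
  by apply/eqP/cmP => j; rewrite cmM !xmon_iotaE.
- rewrite map_inj_in_uniq ?splits_uniq // => -[p q] [p' q'].
  move=> /splitsP[/= pc qc _] /splitsP[/= pc' qc' _] [pp' qq'].
  congr pair; first by rewrite -(exps_xmon pc) pp' exps_xmon.
  by rewrite -(exps_xmon qc) qq' exps_xmon.
rewrite big_map qshuffle_splits; apply: eq_big_seq => -[p q] /splitsP[/= pc qc _].
rewrite /lc_tens /= lc_comb_Mqsym lc_comb_Mqsym; congr (w (_, _)); apply: val_inj => /=;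
by rewrite mcomp_xmon_iota.
Qed.

End PowerSeries.


(** * The Hopf algebra mQSym and its endomorphism Theta *)

(* Both S Theta and Theta S are the convolution inverse of Theta. *)
Lemma bialg_antipode (R : comNzRingType) (J : choiceType) (A : lc_ops R J)
    (F : (J -> R) -> (J -> R)) :
  lc_hopf A -> finmap (lc_mul A) -> finmap (lc_comul A) -> fin (lc_counit A) ->
  finmap (lc_antipode A) -> finmap F ->
  (forall w, F (lc_mul A w) = lc_mul A (lc_tens F F w)) ->
  F (lc_one A) = lc_one A ->
  (forall u, lc_tens F F (lc_comul A u) = lc_comul A (F u)) ->
  (forall u, lc_counit A (F u) = lc_counit A u) ->
  forall u, lc_antipode A (F u) = F (lc_antipode A u).
Proof.
move=> AP mP dP eP sP FP FM F1 FD Fe u.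
have idP K : finmap (fun u : K -> R => u) := @finmap_id R K.
pose SF v := lc_antipode A (F v); pose FS v := F (lc_antipode A v).
have SFP : finmap SF := finmap_comp sP FP.
have FSP : finmap FS := finmap_comp FP sP.
have invr v : lc_mul A (lc_tens F FS (lc_comul A v)) =
    (fun j => lc_counit A v * lc_one A j).
  rewrite (lc_tens_factor (F := F) (G := F) (F' := id) (G' := lc_antipode A)) //.
  rewrite -FM lc_antipoder //; apply: funext => j.
  by rewrite (finZE (FP j)) F1.
have invl v : lc_mul A (lc_tens SF F (lc_comul A v)) =
    (fun j => lc_counit A v * lc_one A j).
  rewrite (lc_tens_factor (F := lc_antipode A) (G := id) (F' := F) (G' := F)) //.
  by rewrite FD lc_antipodel // Fe.
pose unit_counit v j := lc_counit A v * lc_one A j.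
transitivity (lc_mul A (lc_tens SF unit_counit (lc_comul A u))).
  rewrite (_ : lc_tens _ _ _ = lc_pure (SF u) (lc_one A)) ?lc_mul1r //.
  apply: funext => -[a b]; rewrite /lc_tens /lc_pure /=.
  rewrite -[X in SF X a * _](lc_counitr AP u) [RHS]mulrC -(finZE (SFP a)).
  by congr (SF _ a); apply: funext => i; rewrite mulrC.
transitivity (lc_mul A (lc_tens unit_counit FS (lc_comul A u))); last first.
  rewrite (_ : lc_tens _ _ _ = lc_pure (lc_one A) (FS u)) ?lc_mul1l //.
  apply: funext => -[a b]; rewrite /lc_tens /lc_pure /= mulrC; congr (_ * _).
  rewrite -[X in _ = FS X b](lc_counitl AP u).
  by rewrite (finC (FSP b) _ eP).
rewrite (lc_tens_factor (F := id) (G := lc_mul A) (F' := SF)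
  (G' := fun v => lc_tens F FS (lc_comul A v))) //.
rewrite (lc_tens_factor (F := SF) (G := lc_tens F FS) (F' := id)
  (G' := lc_comul A)) //; last exact: finmap_lc_tens.
rewrite -lc_comulA //.
rewrite (_ : lc_tens SF _ _ = lc_assoc (lc_tens (lc_tens SF F) FS
  (lc_tens (lc_comul A) id (lc_comul A u)))) //.
rewrite -lc_mulA //; congr lc_mul.
have SFFP : finmap (lc_tens SF F) by apply: finmap_lc_tens.
rewrite !lc_tens_comp //; congr (lc_tens _ _ _); apply: funext => v.
exact: invl.
Qed.

Section QSymHopf.
Variable R : comNzRingType.
Implicit Types (u : composition -> R) (w : composition * composition -> R).

Definition ext u : seq nat -> R := fun c => u (comp_del0 c).
Definition ext2 w : seq nat * seq nat -> R :=
  fun p => w (comp_del0 p.1, comp_del0 p.2).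

Lemma comp_del0K c : comp_del0 (del0 c) = comp_del0 c.
Proof. by apply: val_inj; rewrite /= del0K. Qed.

Lemma ext_insens u : zero_insens (ext u).
Proof. by move=> c; rewrite /ext comp_del0K. Qed.

Lemma ext2_insens w : zero_insens2 (ext2 w).
Proof. by move=> c d; rewrite /ext2 /= !comp_del0K. Qed.

Definition comp_nil : composition := comp_del0 [::].
Definition comp_cat (a b : composition) : composition := comp_del0 (val a ++ val b).

Lemma val_comp_cat a b : val (comp_cat a b) = val a ++ val b.
Proof. by rewrite /= del0_cat !del0_id ?comp_pos. Qed.

Lemma comp_cat_del0 c d : comp_cat (comp_del0 c) (comp_del0 d) = comp_del0 (c ++ d).
Proof. by apply: val_inj; rewrite val_comp_cat /= del0_cat. Qed.

Lemma comp_catA a b c : comp_cat (comp_cat a b) c = comp_cat a (comp_cat b c).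
Proof. by apply: val_inj; rewrite !val_comp_cat catA. Qed.

Lemma qsym_mul_ext w a : qsym_mul w a = qshuffle (val a) (ext2 w).
Proof. exact: qsym_mulE. Qed.

Lemma ext_mul w c : ext (qsym_mul w) c = qshuffle c (ext2 w).
Proof. by rewrite /ext qsym_mul_ext qshuffle_del0 //; apply: ext2_insens. Qed.

Lemma qsym_comulE u a b : qsym_comul u (a, b) = u (comp_cat a b).
Proof.
rewrite /qsym_comul (@lc_combE _ _ _ _ _ _ [:: comp_cat a b]) // => [|c].
  by rewrite big_seq1 val_comp_cat eqxx mulr1.
have [E _|_] := eqVneq (val c) (val a ++ val b); last by rewrite eqxx.
by rewrite inE; apply/eqP/val_inj; rewrite val_comp_cat.
Qed.

Lemma qsym_counitE u : qsym_counit u = u comp_nil.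
Proof.
rewrite /qsym_counit (fsbigE [:: comp_nil]) //.
  by rewrite big_mkcond big_seq1 in_setT mulr1.
move=> a _; rewrite inE -val_eqE /= => /negPf ->.
by rewrite mulr0.
Qed.

(** The transpose of the anti-automorphism of noncommutative symmetric functions that sends H(x) to
    H(x)^-1. *)
Definition qsym_antipode u (a : composition) : R :=
  antihom_ext (@inv_complete R) (val a) (ext u).

Lemma finmap_ext : finmap ext.
Proof. exact: finmap_reindex. Qed.

Lemma finmap_ext2 : finmap ext2.
Proof. by move=> p; apply: fin_proj. Qed.

Lemma finmap_qsym_mul : finmap (@qsym_mul R).
Proof.
move=> a; have [s sE] := fin_comp (@fin_qshuffle R (val a)) finmap_ext2.
by exists s => w; rewrite qsym_mul_ext -sE.
Qed.

Lemma finmap_qsym_comul : finmap (@qsym_comul R).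
Proof.
move=> [a b]; have [s sE] := fin_proj R (comp_cat a b).
by exists s => u; rewrite qsym_comulE -sE.
Qed.

Lemma fin_qsym_counit : fin (@qsym_counit R).
Proof.
by have [s sE] := fin_proj R comp_nil; exists s => u; rewrite qsym_counitE -sE.
Qed.

Lemma finmap_qsym_antipode : finmap qsym_antipode.
Proof.
by move=> a; apply: fin_comp finmap_ext; apply: fin_antihom_ext; apply: fin_inv_complete.
Qed.

Lemma ext_antipode u c :
  ext (qsym_antipode u) c = antihom_ext (@inv_complete R) c (ext u).
Proof. by rewrite /ext /qsym_antipode /= antihom_ext_del0. Qed.

(** The reversal in [antihom_ext] places the antipode of the first entry of [p.1] right before the
    first entry of [p.2]. Summing over the splittings of that entry gives a coefficient of H^-1 H =
    1 in positive degree, which is zero. *)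
Lemma antipode_left c (v : seq nat -> R) : zero_insens v -> all (leq 1) c ->
  qshuffle c (fun p => antihom_ext (@inv_complete R) p.1 (fun x => v (x ++ p.2))) =
  (c == [::])%:R * v [::].
Proof.
move=> vP; case: c => [|n c] /=; first by rewrite mul1r.
move=> /andP[n_gt0 _]; rewrite mul0r.
rewrite -(fin_convE _ _ (@fin_qshuffle R c)) -[RHS](fin0E (@fin_qshuffle R c)).
congr (qshuffle c _); apply: funext => p.
rewrite -(fin_convE _ _ (fin_antihom_ext p.1 (@fin_inv_complete R))).
rewrite -[RHS](fin0E (fin_antihom_ext p.1 (@fin_inv_complete R))).
congr antihom_ext; apply: funext => x.
transitivity (star (@inv_complete R) (@complete R) n (fun e => v (x ++ (e ++ p.2)))).
  apply: eq_conv => i j _; congr (inv_complete i _); apply: funext => b.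
  rewrite /complete -vP -[RHS]vP -[j :: p.2]cat1s !del0_cat del0K.
  by rewrite !catA.
by rewrite star_inv_complete; case: n n_gt0.
Qed.

(** Here it is the last entries that become adjacent, so [c] is decomposed at its end and H H^-1 = 1
    is used. *)
Lemma antipode_right c (v : seq nat -> R) : zero_insens v -> all (leq 1) c ->
  qshuffle c (fun p => antihom_ext (@inv_complete R) p.2 (fun x => v (p.1 ++ x))) =
  (c == [::])%:R * v [::].
Proof.
move=> vP; elim/last_ind: c => [|c n _]; first by rewrite mul1r.
rewrite all_rcons => /andP[n_gt0 _].
have -> : (rcons c n == [::]) = false by case: c.
rewrite mul0r -cats1 qshuffle_cat -[RHS](fin0E (@fin_qshuffle R c)).
congr (qshuffle c _); apply: funext => p /=.
transitivity (star (@complete R) (@inv_complete R) n (fun e =>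
  antihom_ext (@inv_complete R) p.2 (fun x => v (p.1 ++ (e ++ x))))).
  apply: eq_conv => i j _; rewrite antihom_ext_cat /= /complete.
  congr (inv_complete j _); apply: funext => b.
  congr antihom_ext; apply: funext => x.
  by rewrite -vP -[RHS]vP !del0_cat del0K !catA.
by rewrite star_complete_inv; case: n n_gt0.
Qed.

Lemma del0_nseq0 k : del0 (nseq k 0%N) = [::].
Proof. by elim: k. Qed.

Lemma qsym_hopf : lc_hopf (qsym_ops qsym_antipode).
Proof.
split => /=.
- exact: finmap_lc_map finmap_qsym_mul.
- exact: finmap_lc_map finmap_qsym_comul.
- exact: fin_lc_form fin_qsym_counit.
- exact: finmap_lc_map finmap_qsym_antipode.
- move=> w; apply: funext => a; rewrite !qsym_mul_ext.
  pose W (r : seq nat * (seq nat * seq nat)) :=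
    w (comp_del0 r.1, comp_del0 r.2.1, comp_del0 r.2.2).
  transitivity (qshuffle (val a) (fun p => qshuffle p.1 (fun q => W (q.1, (q.2, p.2))))).
    congr (qshuffle (val a) _); apply: funext => -[p q].
    by rewrite /ext2 /lc_tens /= -/(ext _ p) ext_mul.
  rewrite qshuffleA; congr (qshuffle (val a) _); apply: funext => -[p q].
  by rewrite /ext2 /lc_tens /= -/(ext _ q) ext_mul.
- move=> u; apply: funext => a; rewrite qsym_mul_ext qshuffle_unitl => [|p q].
    by rewrite /ext2 /lc_pure /qsym_one /= del0_nseq0 mul1r comp_del0_val.
  rewrite /ext2 /lc_pure /qsym_one /=; case: (del0 p) => // n c _.
  by rewrite mul0r.
- move=> u; apply: funext => a; rewrite qsym_mul_ext qshuffleC qshuffle_unitl => [|p q].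
    by rewrite /ext2 /lc_pure /qsym_one /= del0_nseq0 mulr1 comp_del0_val.
  rewrite /ext2 /lc_pure /qsym_one /=; case: (del0 p) => // n c _.
  by rewrite mulr0.
- move=> u; apply: funext => -[a [b c]]; rewrite /lc_assoc /lc_tens /=.
  by rewrite !qsym_comulE comp_catA.
- move=> u; apply: funext => a; rewrite qsym_counitE qsym_comulE.
  by congr u; apply: val_inj; rewrite val_comp_cat.
- move=> u; apply: funext => a; rewrite qsym_counitE qsym_comulE.
  by congr u; apply: val_inj; rewrite val_comp_cat /= cats0.
- move=> w; apply: funext => -[a b]; rewrite qsym_comulE qsym_mul_ext val_comp_cat.
  rewrite qshuffle_cat /lc_tens /= qsym_mul_ext; congr (qshuffle (val a) _).
  apply: funext => p; rewrite /ext2 qsym_mul_ext; congr (qshuffle (val b) _).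
  apply: funext => q; rewrite /ext2 /lc_midswap /= !qsym_comulE.
  by rewrite !comp_cat_del0.
- apply: funext => -[a b]; rewrite qsym_comulE /lc_pure /qsym_one val_comp_cat /=.
  by case: (val a) => [|n c] /=; rewrite (mul1r, mul0r).
- by move=> w; rewrite !qsym_counitE qsym_mul_ext.
- by rewrite qsym_counitE.
- move=> u; apply: funext => a; rewrite qsym_mul_ext qsym_counitE.
  transitivity (qshuffle (val a) (fun p =>
      antihom_ext (@inv_complete R) p.1 (fun x => ext u (x ++ p.2)))).
    congr (qshuffle (val a) _); apply: funext => -[p q].
    rewrite /ext2 /lc_tens /= -/(ext _ p) ext_antipode; congr antihom_ext.
    by apply: funext => x; rewrite /ext qsym_comulE comp_cat_del0.
  rewrite antipode_left; [by rewrite mulrC|exact: ext_insens|exact: comp_pos].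
- move=> u; apply: funext => a; rewrite qsym_mul_ext qsym_counitE.
  transitivity (qshuffle (val a) (fun p =>
      antihom_ext (@inv_complete R) p.2 (fun x => ext u (p.1 ++ x)))).
    congr (qshuffle (val a) _); apply: funext => -[p q].
    rewrite /ext2 /lc_tens /= -/(ext _ q) ext_antipode; congr antihom_ext.
    by apply: funext => x; rewrite /ext qsym_comulE comp_cat_del0.
  rewrite antipode_right; [by rewrite mulrC|exact: ext_insens|exact: comp_pos].
Qed.

Section Theta.
Variable beta : R.
Let ps := peak_series beta.

Definition theta u (a : composition) : R := hom_ext ps (val a) (ext u).

Lemma ext_theta u c : ext (theta u) c = hom_ext ps c (ext u).
Proof. by rewrite /ext /theta /= hom_ext_del0 //; apply: unital_peak_series. Qed.

Lemma finmap_theta : finmap theta.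
Proof.
by move=> a; apply: fin_comp finmap_ext; apply: fin_hom_ext; apply: fin_peak_series.
Qed.

Lemma thetaM w : theta (qsym_mul w) = qsym_mul (lc_tens theta theta w).
Proof.
apply: funext => a; rewrite /theta (funext (ext_mul w)) hom_ext_mul.
- rewrite qsym_mul_ext; congr (qshuffle (val a) _); apply: funext => -[p q] /=.
  rewrite -[RHS]/(ext (theta (fun i => theta (fun i' => w (i, i')) (comp_del0 q))) p).
  rewrite ext_theta; congr hom_ext; apply: funext => x.
  exact: (esym (ext_theta (fun j => w (comp_del0 x, j)) q)).
- exact: fin_peak_series.
- exact: grouplike_peak_series.
- exact: ext2_insens.
Qed.

Lemma thetaD u : lc_tens theta theta (qsym_comul u) = qsym_comul (theta u).
Proof.
apply: funext => -[a b]; rewrite qsym_comulE /theta val_comp_cat hom_ext_cat /lc_tens /=.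
congr hom_ext; apply: funext => x; congr hom_ext; apply: funext => y.
by rewrite /ext qsym_comulE comp_cat_del0.
Qed.

Lemma theta_counit u : qsym_counit (theta u) = qsym_counit u.
Proof. by rewrite !qsym_counitE. Qed.

Lemma lrow_nil c : lrow beta c [::] = (del0 c == [::])%:R.
Proof.
elim/last_ind: c => // c n IHc; rewrite lrow_rcons /ustep /= coef_const_row IHc.
rewrite -cats1 del0_cat; case: n => [|n] /=; first by rewrite cats0.
by case: (del0 c).
Qed.

Lemma krow_nil bar c : krow beta bar c [::] = (del0 c == [::])%:R.
Proof.
elim/last_ind: c => // c n IHc; rewrite krow_rcons /vstep /= coef_const_row IHc.
rewrite -cats1 del0_cat; case: n => [|n] /=; first by rewrite cats0.
by case: (del0 c).
Qed.

(** The unit is L of the empty composition, and K of the empty composition is the unit too. *)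
Lemma theta1 : theta (@qsym_one R) = @qsym_one R.
Proof.
apply: funext => a; rewrite /qsym_one -[in RHS](del0_id (comp_pos a)).
rewrite -(krow_nil false) -hom_ext_peak_series.
by congr hom_ext; apply: funext => c; rewrite lrow_nil.
Qed.

Lemma theta_antipode u : theta (qsym_antipode u) = qsym_antipode (theta u).
Proof.
apply: esym; apply: (bialg_antipode qsym_hopf).
- exact: finmap_qsym_mul.
- exact: finmap_qsym_comul.
- exact: fin_qsym_counit.
- exact: finmap_qsym_antipode.
- exact: finmap_theta.
- exact: thetaM.
- exact: theta1.
- exact: thetaD.
- exact: theta_counit.
Qed.

Lemma lrow_del0 c : lrow beta (del0 c) = lrow beta c.
Proof.
elim/last_ind: c => // c n IHc; rewrite lrow_rcons -cats1 del0_cat -IHc.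
case: n => [|n]; last by rewrite cats1 lrow_rcons.
rewrite cats0; apply: funext => a.
by rewrite /ustep coef0_unprim coef_const_row.
Qed.

Lemma theta_fundamental (s : state) :
  theta (fun c => lrow beta (val c) s) = fun c => krow beta false (val c) s.
Proof.
apply: funext => a; rewrite -hom_ext_peak_series /theta; congr hom_ext.
by apply: funext => c; rewrite /ext /= lrow_del0.
Qed.

End Theta.
End QSymHopf.


(** * Fillings *)

Notation filling := (seq {fset nat}).

Section Fillings.
Implicit Types (bar : bool) (T : {fset nat}) (F : filling) (s r : state) (m q : nat).

(* Fillings are listed from the last block to the first, as states are. *)
Definition link (bar : bool) q F T : Prop :=
  if F is T' :: _ then
    (forall x y, x \in T' -> y \in T -> x <= y)%N /\
    (if q is 0 then
       if bar then (forall x y, x \in T' -> y \in T -> x < y)%N /\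
                   (forall c, c \in T -> ~~ primed c)
       else forall c, c \in T' -> c \in T -> primed c
     else forall c, c \in T' -> c \in T -> ~~ primed c)
  else bar -> forall c, c \in T -> ~~ primed c.

Fixpoint fill (bar : bool) s F : Prop :=
  if F is T :: F' then
    [/\ s != [::], T != fset0, link bar (head 0%N s) F' T & fill bar (decr s) F']
  else s = [::].

Definition letters_lt m F : Prop := forall T c, T \in F -> c \in T -> (c < m)%N.

Lemma letters_ltW m F : letters_lt m F -> letters_lt m.+1 F.
Proof. by move=> mF T c TF cT; apply: ltnW; apply: mF cT. Qed.

Lemma letters_lt_cons m T F : letters_lt m (T :: F) <->
  (forall c, c \in T -> c < m)%N /\ letters_lt m F.
Proof.
split=> [mF|[mT mF] T' c]; last first.
  by rewrite inE => /orP[/eqP->|]; [exact: mT|exact: mF].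
by split=> [c cT|T' c T'F cT']; [apply: (mF T)|apply: (mF T')] => //;
  rewrite inE ?eqxx ?T'F ?orbT.
Qed.

(* Blocks weakly increase, so a bound on the last block bounds the others. *)
Lemma fill_letters_lt bar s T F m : fill bar s (T :: F) ->
  (forall c, c \in T -> c < m)%N -> letters_lt m (T :: F).
Proof.
elim: F s T => [|T' F IHF] s T [_ T0 lT fF] mT; apply/letters_lt_cons; split=> //.
apply: (IHF (decr s)) => // c cT'; have /fset0Pn[y yT] := T0.
by apply: leq_ltn_trans (mT y yT); case: lT => /(_ c y cT' yT).
Qed.

Lemma link_sub bar q F T T' : {subset T <= T'} -> link bar q F T' -> link bar q F T.
Proof.
move=> TT'; case: F => [|U F] /=; first by move=> H b c /TT'; apply: H.
move=> [le H]; split; first by move=> x y xU /TT'; apply: le.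
case: q H => [|q] H; last by move=> c cU /TT'; apply: H.
case: bar H => H; last by move=> c cU /TT'; apply: H.
by split=> [x y xU /TT'|c /TT']; apply H.
Qed.

Lemma link_add bar q F T m : letters_lt m F ->
  (bar -> (q == 0%N) || nilp F -> ~~ primed m) ->
  link bar q F T -> link bar q F (m |` T)%fset.
Proof.
case: F => [|U F] /= mF pm.
  move=> H b c; rewrite in_fset1U => /orP[/eqP->|]; last exact: H.
  by apply: pm; rewrite ?orbT.
have mU x : x \in U -> (x < m)%N by apply: mF; rewrite inE eqxx.
move=> [le H]; split.
  move=> x y xU; rewrite in_fset1U => /orP[/eqP->|yT]; last exact: le.
  exact: ltnW (mU x xU).
case: q H pm => [|q] H pm.
  case: bar H pm => H pm.
    case: H => lt up; split=> [x y xU|c]; rewrite in_fset1U => /orP[/eqP->|].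
    - exact: mU.
    - exact: lt.
    - exact: pm.
    - exact: up.
  move=> c cU; rewrite in_fset1U => /orP[/eqP cm|]; last exact: H.
  by have := mU c cU; rewrite cm ltnn.
move=> c cU; rewrite in_fset1U => /orP[/eqP cm|]; last exact: H.
by have := mU c cU; rewrite cm ltnn.
Qed.

Lemma link_single bar q F m : letters_lt m.+1 F ->
  (letters_lt m F \/ primed m = (q == 0%N)) ->
  (bar -> (q == 0%N) || nilp F -> ~~ primed m) ->
  link bar q F [fset m]%fset.
Proof.
case: F => [|U F] /= mF pm bm.
  by move=> b c; rewrite in_fset1 => /eqP ->; apply: bm; rewrite ?orbT.
have mU x : x \in U -> (x <= m)%N by apply: mF; rewrite inE eqxx.
have pU : m \in U -> primed m = (q == 0%N).
  by case: pm => // lm mU'; have := lm U m; rewrite inE eqxx ltnn => /(_ isT mU').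
split; first by move=> x y xU; rewrite in_fset1 => /eqP->; apply: mU.
case: q pm bm pU => [|q] pm bm pU; last first.
  by move=> c cU; rewrite in_fset1 => /eqP cm; rewrite cm pU // -cm.
case: bar bm => bm; last first.
  by move=> c cU; rewrite in_fset1 => /eqP cm; rewrite cm pU // -cm.
split=> [x y xU|c]; rewrite in_fset1 => /eqP ->; last exact: bm.
rewrite ltn_neqAle mU // andbT; apply/eqP => xm.
by have := bm isT isT; rewrite pU // -xm.
Qed.

Definition add_letter m F : filling :=
  if F is T :: F' then (m |` T)%fset :: F' else [::].

Definition extend_last m (A B : seq filling) : seq filling :=
  A ++ map (add_letter m) A ++ map (cons [fset m]%fset) B.

(** [extend_last] lists the three terms of (1 + b x) g + x h: last block unchanged, enlarged by the
    new letter, or equal to it. These recursions thus copy [unprim] and [prim] term by term. *)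
Fixpoint list_unprim_in m (g : state -> seq filling) r q : seq filling :=
  extend_last m (g (q :: r)) (if q is q'.+1 then list_unprim_in m g r q' else g r).

Definition list_unprim m g s : seq filling :=
  if s is q :: r then list_unprim_in m g r q else g [::].

Fixpoint list_prim (bar : bool) m (g : state -> seq filling) s : seq filling :=
  match s with
  | [::] => g [::]
  | q'.+1 :: r => extend_last m (g s) (g (q' :: r))
  | 0 :: r => if bar then g s else extend_last m (g s) (list_prim bar m g r)
  end.

Fixpoint fillings bar m : state -> seq filling :=
  if m is m'.+1 then
    if odd m' then list_unprim m' (fillings bar m')
    else list_prim bar m' (fillings bar m')
  else fun s => if s is [::] then [:: [::]] else [::].

Definition enumerates bar m (g : state -> seq filling) : Prop :=
  forall s, uniq (g s) /\
    forall F, F \in g s <-> fill bar s F /\ letters_lt m F.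

Section Extend.
Variables (bar : bool) (m : nat) (s : state) (A B : seq filling).
Hypothesis s_neq0 : s != [::].
Hypothesis A_uniq : uniq A.
Hypothesis B_uniq : uniq B.
Hypothesis AP : forall F, F \in A <-> fill bar s F /\ letters_lt m F.

Let A_cons F : F \in A -> exists T F', [/\ F = T :: F', T != fset0 & m \notin T].
Proof.
move=> /AP; case: F => [|T F] [/= fF mF]; first by move: s_neq0; rewrite fF.
exists T, F; split=> //; first by case: fF.
by apply/negP => mT; have := mF T m; rewrite inE eqxx ltnn => /(_ isT mT).
Qed.

Lemma extend_last_uniq : uniq (extend_last m A B).
Proof.
rewrite /extend_last cat_uniq A_uniq /= cat_uniq.
have -> : uniq (map (add_letter m) A).
  rewrite map_inj_in_uniq // => F F' /A_cons[T [G [-> _ mT]]] /A_cons[T' [G' [-> _ mT']]].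
  move=> [TT' ->]; congr (_ :: _); apply/fsetP => x; move/fsetP: TT' => /(_ x).
  rewrite !in_fset1U; case: eqP => // -> _.
  by rewrite (negPf mT) (negPf mT').
rewrite map_inj_uniq ?B_uniq ?andbT => [|F F' [] //]; apply/andP; split.
  apply/hasPn => F; rewrite mem_cat => FAB; apply/negP => /A_cons[T [G [FE T0 mT]]].
  case/orP: FAB => /mapP[F' F'P FF']; move: mT; last first.
    by move: FF'; rewrite FE => -[-> _]; rewrite in_fset1 eqxx.
  have [T' [G' [F'E _ _]]] := A_cons F'P.
  by move: FF'; rewrite F'E FE => -[-> _]; rewrite in_fset1U eqxx.
apply/hasPn => _ /mapP[F FB ->]; apply/negP => /mapP[F' /A_cons[T [G [-> T0 mT]]]] [E _].
have /fset0Pn[y yT] := T0; have : y \in [fset m]%fset by rewrite E in_fset1U yT orbT.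
by rewrite in_fset1 => /eqP ym; rewrite -ym yT in mT.
Qed.

Hypothesis BP : forall F, F \in B <->
  [/\ fill bar (decr s) F, letters_lt m.+1 F & link bar (head 0%N s) F [fset m]%fset].
Hypothesis m_legal : bar -> forall F, fill bar (decr s) F ->
  (head 0%N s == 0%N) || nilp F -> ~~ primed m.

(** The last block omits [m], or contains it with other letters, or is the singleton of [m]. In the
    first two cases all remaining letters lie below [m], because blocks weakly increase. *)
Lemma extend_lastP F :
  F \in extend_last m A B <-> fill bar s F /\ letters_lt m.+1 F.
Proof.
rewrite /extend_last !mem_cat; split.
  case/or3P.
  - by move=> /AP[fF mF]; split=> //; apply: letters_ltW.
  - case/mapP => F0 F0A ->; have [T [G [F0E T0 mT]]] := A_cons F0A.
    move/AP: F0A; rewrite F0E => -[[_ _ lT fG] /letters_lt_cons[mT' mG]]; split.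
      split=> //; first by apply/fset0Pn; exists m; rewrite in_fset1U eqxx.
      by apply: link_add => // b; apply: m_legal.
    apply/letters_lt_cons; split; last exact: letters_ltW.
    by move=> c; rewrite in_fset1U => /orP[/eqP->|/mT'/ltnW].
  - case/mapP => F0 /BP[fF0 mF0 lF0] ->; split.
      by split=> //; apply/fset0Pn; exists m; rewrite in_fset1.
    by apply/letters_lt_cons; split=> // c; rewrite in_fset1 => /eqP->.
case: F => [|T F] [/= fF mF]; first by move: s_neq0; rewrite fF.
have [s0 T0 lT fF'] := fF; have /letters_lt_cons[mT mF'] := mF.
have ltm (U : {fset nat}) : {subset U <= T} -> m \notin U -> U != fset0 ->
    letters_lt m (U :: F).
  move=> UT mU U0; apply: (@fill_letters_lt bar s) => [|c cU].
    by split=> //; apply: link_sub lT.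
  rewrite ltn_neqAle -ltnS mT ?UT // andbT; apply: contraNneq mU => <-.
  exact: cU.
have [mT'|mT'] := boolP (m \in T); last first.
  by apply/or3P; apply: Or31; apply/AP; split=> //; apply: ltm.
have [T1|T1] := eqVneq (T `\ m)%fset fset0.
  have TE : T = [fset m]%fset by rewrite -(fsetD1K mT') T1 fsetU0.
  apply/or3P; apply: Or33; rewrite TE; apply/mapP; exists F => //; apply/BP.
  by split=> //; rewrite -TE.
have subT : {subset (T `\ m)%fset <= T} by move=> c /fsetD1P[].
apply/or3P; apply: Or32; apply/mapP; exists ((T `\ m)%fset :: F).
  apply/AP; split; first by split=> //; apply: link_sub lT.
  by apply: ltm => //; rewrite in_fsetD1 eqxx.
by rewrite /= fsetD1K.
Qed.

End Extend.
(** If [m] occurred at all, monotonicity would put it in the last block of [F], and this link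
    forbids sharing [m] with the next block. *)
Lemma link_single_lt bar q r F m : primed m != (q == 0%N) -> fill bar r F ->
  letters_lt m.+1 F -> link bar q F [fset m]%fset -> letters_lt m F.
Proof.
case: F => [|U F] // pq fF mF lF; apply: (fill_letters_lt fF) => c cU.
have cm : (c < m.+1)%N by apply: mF cU; rewrite inE eqxx.
rewrite ltn_neqAle -ltnS cm andbT; apply/eqP => cmE.
move: cU pq lF; rewrite cmE => mU; have m1 : m \in [fset m]%fset by rewrite in_fset1.
case: q => [|q] /= pq [_ H]; last by have := H m mU m1; move: pq; case: (primed m).
case: bar fF H => fF H; last by have := H m mU m1; move: pq; case: (primed m).
by have := H.1 m m mU m1; rewrite ltnn.
Qed.

Lemma enumerates_unprim bar m g : ~~ primed m -> enumerates bar m g ->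
  enumerates bar m.+1 (list_unprim m g).
Proof.
move=> pm gP [|q r] /=.
  have [g_uniq gE] := gP [::]; split=> // F; rewrite gE.
  by case: F => [|T F]; split=> -[] //= [].
elim: q => [|q [IHu IHE]] /=.
  have [gs_uniq gsE] := gP (0%N :: r); have [gr_uniq grE] := gP r.
  split; first exact: (@extend_last_uniq bar m (0%N :: r)).
  move=> F; apply: (@extend_lastP bar m (0%N :: r)) => // F'.
  rewrite grE /=; split=> [[fF mF]|[fF mF lF]]; split=> //.
  - exact: letters_ltW.
  - by apply: link_single; [exact: letters_ltW|left|].
  - by apply: link_single_lt fF mF lF; rewrite (negPf pm).
have [gs_uniq gsE] := gP (q.+1 :: r).
split; first exact: (@extend_last_uniq bar m (q.+1 :: r)).
move=> F; apply: (@extend_lastP bar m (q.+1 :: r)) => // F'.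
rewrite IHE /=; split=> [[fF mF]|[]] //; split=> //.
by apply: link_single => //; right; apply: negbTE.
Qed.

Lemma enumerates_prim bar m g : primed m -> enumerates bar m g ->
  enumerates bar m.+1 (list_prim bar m g).
Proof.
move=> pm gP; elim=> [|[|q] r [IHu IHE]] /=.
- have [g_uniq gE] := gP [::]; split=> // F; rewrite gE.
  by case: F => [|T F]; split=> -[] //= [].
- have [gs_uniq gsE] := gP (0%N :: r).
  case: bar gP gsE IHu IHE => gP gsE IHu IHE.
    split=> // F; rewrite gsE; split=> [[fF mF]|[fF mF]]; split=> //.
      exact: letters_ltW.
    case: F fF mF => [|T F] // fF mF; apply: (fill_letters_lt fF) => c cT.
    have cm : (c < m.+1)%N by apply: mF cT; rewrite inE eqxx.
    rewrite ltn_neqAle -ltnS cm andbT; apply/eqP => cmE; rewrite cmE in cT.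
    case: fF => _ _ lT _; suff : ~~ primed m by rewrite pm.
    by case: F lT {mF} => [/(_ isT)|U F [_ [_]]]; apply.
  split; first exact: (@extend_last_uniq false m (0%N :: r)).
  move=> F; apply: (@extend_lastP false m (0%N :: r)) => // F'.
  rewrite IHE /=; split=> [[fF mF]|[]] //; split=> //.
  by apply: link_single => //; right.
- have [gs_uniq gsE] := gP (q.+1 :: r); have [gr_uniq grE] := gP (q :: r).
  split; first exact: (@extend_last_uniq bar m (q.+1 :: r)).
  have no_nil F' : bar -> fill bar (q :: r) F' -> (q.+1 == 0%N) || nilp F' -> ~~ primed m.
    by case: F'.
  move=> F; apply: (@extend_lastP bar m (q.+1 :: r)) => // [F'|b F'].
    rewrite grE /=; split=> [[fF mF]|[fF mF lF]]; split=> //.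
    - exact: letters_ltW.
    - by apply: link_single; [exact: letters_ltW|left|move=> b; apply: no_nil].
    - by apply: link_single_lt fF mF lF; rewrite pm.
  exact: no_nil.
Qed.

Lemma fillingsP bar m : enumerates bar m (fillings bar m).
Proof.
elim: m => [|m IHm].
  move=> s; split=> [|F]; first by case: s.
  have -> : (F \in fillings bar 0 s) = (s == [::]) && (F == [::]).
    by case: s F => [|? ?] [].
  split=> [/andP[/eqP-> /eqP->] //|]; case: F => [|T F] [].
    by move=> /= ->.
  case=> _ /fset0Pn[y yT] _ _ mF; have := mF T y.
  by rewrite inE eqxx yT => /(_ isT isT).
have [mo|mo] := boolP (odd m); rewrite /fillings -/fillings.
  by rewrite mo; apply: enumerates_unprim => //; rewrite /primed mo.
by rewrite (negPf mo); apply: enumerates_prim => //; rewrite /primed mo.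
Qed.

End Fillings.

(** * Generating functions of fillings *)

Section FillingWeights.
Variables (R : comNzRingType) (beta : R) (bar : bool).
Implicit Types (F : filling) (s r : state) (m q : nat) (c : seq nat).

Definition excess F : nat := (nblk F - size F)%N.

(** Exponents of the finished variables are pinned to [c], while the current variable stays as ['X];
    this is the shape in which [variable] adds a variable. *)
Definition weight (k : nat) c F : {poly R} :=
  (beta ^+ excess F * (exps k (mblk F) == c)%:R)%:P * 'X^(mblk F k).

Definition series (k : nat) c (A : seq filling) : {poly R} :=
  \sum_(F <- A) weight k c F.

Lemma mblk_cons (T : {fset nat}) F :
  mblk (T :: F) = mmul (\big[mmul/mone]_(c <- T) ucm c./2) (mblk F).
Proof. by rewrite /mblk big_cons. Qed.

Lemma nblk_cons (T : {fset nat}) F : nblk (T :: F) = (#|` T|%fset + nblk F)%N.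
Proof. by rewrite /nblk big_cons. Qed.

Lemma exps_mulU k (mu : monomial) : exps k (mmul (ucm k) mu) = exps k mu.
Proof.
apply/eq_in_map => i; rewrite mem_iota add0n /= => ik.
by rewrite cmM ucmE; case: eqVneq ik => [->|//]; rewrite ltnn.
Qed.

(** The size bound keeps the truncated subtraction in [excess] from swallowing the added letter. *)
Lemma weight_add k c m (T : {fset nat}) F : m./2 = k -> m \notin T ->
  (size (T :: F) <= nblk (T :: F))%N ->
  weight k c ((m |` T)%fset :: F) = beta%:P * 'X * weight k c (T :: F).
Proof.
move=> mk mT szT; rewrite /weight.
have -> : mblk ((m |` T)%fset :: F) = mmul (ucm k) (mblk (T :: F)).
  by rewrite !mblk_cons big_fsetU1 //= mk mulmA.
have -> : excess ((m |` T)%fset :: F) = (excess (T :: F)).+1.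
  move: szT; rewrite /excess !nblk_cons cardfsU1 mT /=; lia.
by rewrite exps_mulU cmM ucmE eqxx exprS -mulrA polyCM add1n exprS mulrACA.
Qed.

Lemma weight_single k c m F : m./2 = k ->
  weight k c ([fset m]%fset :: F) = 'X * weight k c F.
Proof.
move=> mk; rewrite /weight.
have -> : mblk ([fset m]%fset :: F) = mmul (ucm k) (mblk F).
  by rewrite mblk_cons big_seq_fset1 mk.
have -> : excess ([fset m]%fset :: F) = excess F.
  by rewrite /excess nblk_cons cardfs1.
by rewrite exps_mulU cmM ucmE eqxx add1n exprS mulrCA.
Qed.

Lemma fill_size s F : fill bar s F -> (size F <= nblk F)%N.
Proof.
elim: F s => [|T F IHF] s //= [_ T0 _ /IHF sF]; rewrite nblk_cons.
by move: T0; rewrite -cardfs_gt0; lia.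
Qed.

Lemma series_extend k c m s (A B : seq filling) : m./2 = k -> s != [::] ->
  (forall F, F \in A -> fill bar s F /\ letters_lt m F) ->
  series k c (extend_last m A B) =
  (1 + beta%:P * 'X) * series k c A + 'X * series k c B.
Proof.
move=> mk s0 AP; rewrite /series !big_cat /= !big_map mulrDl mul1r -addrA.
congr (_ + (_ + _)); last first.
  by rewrite mulr_sumr; apply: eq_bigr => F _; rewrite weight_single.
rewrite mulr_sumr; apply: eq_big_seq => -[|T F] /AP[fF mF].
  by move: s0; rewrite -[s]/(s) fF.
rewrite /= weight_add //; last exact: fill_size fF.
by apply/negP => mT; have := mF T m; rewrite inE eqxx ltnn => /(_ isT mT).
Qed.

Lemma series_unprim k c m g s : m./2 = k -> enumerates bar m g ->
  series k c (list_unprim m g s) =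
  unprim beta%:P 'X (fun s => series k c (g s)) s.
Proof.
move=> mk gP; case: s => // q r.
elim: q => [|q IHq] /=.
  by rewrite (@series_extend _ _ _ (0%N :: r)) // => F; apply (gP _).2.
by rewrite (@series_extend _ _ _ (q.+1 :: r)) ?IHq // => F; apply (gP _).2.
Qed.

Lemma series_prim k c m g s : m./2 = k -> enumerates bar m g ->
  series k c (list_prim bar m g s) =
  prim beta%:P 'X bar (fun s => series k c (g s)) s.
Proof.
move=> mk gP; elim: s => [|[|q] r IHr] //=; last first.
  by rewrite (@series_extend _ _ _ (q.+1 :: r)) // => F; apply (gP _).2.
have [//|barF] := boolP bar; rewrite (negPf barF) in IHr *.
by rewrite (@series_extend _ _ _ (0%N :: r)) ?IHr // => F; apply (gP _).2.
Qed.

Lemma letters_exps k F : letters_lt k.*2 F -> forall i, (k <= i)%N -> mblk F i = 0%N.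
Proof.
elim: F => [|T F IHF] kF i ki; first by rewrite /mblk big_nil cm1.
have /letters_lt_cons[kT kF'] := kF.
rewrite mblk_cons cmM IHF // addn0.
rewrite big_seq; elim/big_rec: _ => [|c mu cT IH]; first by rewrite cm1.
rewrite cmM IH ucmE addn0; case: eqP => // ci; have := kT c cT.
by rewrite -ci in ki; rewrite ltnNge => /negP[]; lia.
Qed.

Lemma sum_fillings k c s : size c = k ->
  \sum_(F <- fillings bar k.*2 s) beta ^+ excess F * (exps k (mblk F) == c)%:R =
  krow beta bar c s.
Proof.
elim: k c s => [|k IHk] c s.
  case: c => // _; case: s => [|q r] /=; last by rewrite big_nil.
  by rewrite big_seq1 /excess /nblk big_nil mul1r.
case/lastP: c => // c n; rewrite size_rcons => -[ck].
have G0 : (fun s => series k c (fillings bar k.*2 s)) = const_row (krow beta bar c).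
  apply: funext => s'; rewrite /const_row -IHk // /series raddf_sum.
  apply: eq_big_seq => F /(fillingsP bar k.*2 s').2[_ kF].
  by rewrite /weight (letters_exps kF) // expr0 mulr1.
(* The variable of index k consists of the letter 2k, primed, and the letter 2k + 1, unprimed. *)
have E : fillings bar k.*2.+2 =
    list_unprim k.*2.+1 (list_prim bar k.*2 (fillings bar k.*2)).
  by rewrite /= odd_double.
have P1 := fillingsP bar k.*2.+1; rewrite /= odd_double /= in P1.
rewrite krow_rcons /vstep /variable -G0 doubleS E.
have -> : prim beta%:P 'X bar (fun s => series k c (fillings bar k.*2 s)) =
    (fun s => series k c (list_prim bar k.*2 (fillings bar k.*2) s)).
  by apply: funext => s'; rewrite (@series_prim _ _ k.*2) ?doubleK //; apply: fillingsP.
rewrite -(@series_unprim _ _ k.*2.+1) //; last by rewrite -uphalfE uphalf_double.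
rewrite /series coef_sum; apply: eq_bigr => F _.
rewrite /weight coefCM coefXn -mulrA; congr (_ * _).
rewrite -natrM mulnb; congr (nat_of_bool _)%:R.
by rewrite /exps -addn1 iotaD map_cat /= add0n cats1 eqseq_rcons [n == _]eq_sym.
Qed.

End FillingWeights.


(** * From set tuples to recursively described fillings *)

Section PeakFillings.
Implicit Types (bar : bool) (S : seq {fset nat}) (T U : {fset nat}).

Lemma fsmax_ge U x : x \in U -> (x <= fsmax U)%N.
Proof. by move=> xU; rewrite /fsmax (big_rem x) //= leq_maxl. Qed.

Lemma bigmax_mem (x : nat) (s : seq nat) : (\max_(c <- x :: s) c)%N \in x :: s.
Proof.
elim: s x => [|y s IHs] x; first by rewrite big_seq1 inE.
rewrite big_cons /maxn; case: ifP => _; last exact: mem_head.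
by rewrite inE IHs orbT.
Qed.

Lemma fsmax_in U : U != fset0 -> fsmax U \in U.
Proof.
move=> /fset0Pn[y yU]; rewrite /fsmax -[_ \in U]/(_ \in enum_fset U).
by have : y \in enum_fset U by []; case: (enum_fset U) => // x s _; apply: bigmax_mem.
Qed.

Lemma fsmin_le U y : y \in U -> (fsmin U <= y)%N.
Proof.
rewrite /fsmin; move: (fsmax U) => d; rewrite -[y \in U]/(y \in enum_fset U).
elim: (enum_fset U) => // z s IHs; rewrite inE big_cons geq_min => /orP[/eqP->|/IHs->].
  by rewrite leqnn.
by rewrite orbT.
Qed.

Lemma fsmin_in U : U != fset0 -> fsmin U \in U.
Proof.
move=> U0; rewrite /fsmin; have dU := fsmax_in U0.
rewrite big_seq; elim/big_rec: _ => // c d cU dU'.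
by rewrite /minn; case: ifP.
Qed.

Lemma fsleP U T : U != fset0 -> T != fset0 ->
  fsle U T <-> (forall x y, x \in U -> y \in T -> x <= y)%N.
Proof.
move=> U0 T0; split=> [le x y /fsmax_ge xU /fsmin_le yT|H].
  exact: leq_trans xU (leq_trans le yT).
by apply: H; [exact: fsmax_in|exact: fsmin_in].
Qed.

Lemma fsltP U T : U != fset0 -> T != fset0 ->
  fslt U T <-> (forall x y, x \in U -> y \in T -> x < y)%N.
Proof.
move=> U0 T0; split=> [lt x y /fsmax_ge xU /fsmin_le yT|H].
  exact: leq_ltn_trans xU (leq_trans lt yT).
by apply: H; [exact: fsmax_in|exact: fsmin_in].
Qed.

Definition block_rel bar (d : bool) U T : Prop :=
  fsle U T /\
  (if d then
     if bar then fslt U T /\ (forall c, c \in T -> ~~ primed c)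
     else forall c, c \in (U `&` T)%fset -> primed c
   else forall c, c \in (U `&` T)%fset -> ~~ primed c).

Definition Kfill bar (a : seq nat) S : Prop :=
  [/\ size S = sumn a, forall T, T \in S -> T != fset0,
      forall i, (1 <= i < sumn a)%N ->
        block_rel bar (i \in desc a) (blk S i) (blk S i.+1)
    & bar -> (0 < sumn a)%N -> forall c, c \in blk S 1 -> ~~ primed c].

Lemma KsetE a S : Kset a S <-> Kfill false a S.
Proof.
split=> [[[sz nz] le d nd]|[sz nz rel _]].
  split=> // i iN; split; first exact: le.
  by case: ifP => [|/negbT] id; [apply: d|apply: nd].
split=> // i iN.
- by case: (rel i iN).
- by move=> id; case: (rel i iN); rewrite id.
- by move=> /negPf id; case: (rel i iN); rewrite id.
Qed.

Lemma KbarsetE a S : Kbarset a S <-> Kfill true a S.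
Proof.
split=> [[[sz nz] le d up nd]|[sz nz rel first]].
  split=> [||i iN|_ N0] //; last by apply: (up 0%N) => //; rewrite inE.
  split; first exact: le.
  case: ifP => [id|/negbT id]; last exact: nd.
  split; first exact: d.
  by apply: up; [case/andP: iN => _ ->|rewrite inE id orbT].
split=> // i iN.
- by case: (rel i iN).
- by move=> id; case: (rel i iN); rewrite id => _ [].
- case: i iN => [|i] iN id; first by apply: first.
  by case: (rel i.+1 iN); rewrite inE /= in id; rewrite id => _ [].
- by move=> /negPf id; case: (rel i iN); rewrite id.
Qed.

Lemma desc_rcons (a : seq nat) p : a != [::] ->
  desc (rcons a p) = rcons (desc a) (sumn a).
Proof.
move=> a0; have [n sz] : exists n, size a = n.+1.
  by case: a a0 => // x a _; exists (size a).
rewrite /desc size_rcons sz !succnK -[X in iota _ X]addn1 iotaD map_cat cats1 add1n.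
congr rcons; last by rewrite -cats1 take_cat sz ltnn subnn take0 cats0.
apply/eq_in_map => j; rewrite mem_iota add1n => /andP[_ jn].
by rewrite -cats1 takel_cat // sz ltnW.
Qed.

Lemma mem_desc q r i : (i \in desc (of_state (q :: r))) =
  (r != [::]) && ((i \in desc (of_state r)) || (i == wsize r)).
Proof.
rewrite of_state_cons; case: r => [|p r]; first by rewrite /desc.
rewrite desc_rcons ?mem_rcons ?inE ?sumn_of_state 1?orbC //.
by rewrite of_state_cons; case: (of_state r).
Qed.

Lemma desc_lt s i : i \in desc (of_state s) -> (i < wsize s)%N.
Proof.
elim: s => [|q r IHr] //; rewrite mem_desc => /andP[_ /orP[/IHr|/eqP->]];
by rewrite /wsize /=; lia.
Qed.

Lemma wsize_decr s : s != [::] -> wsize s = (wsize (decr s)).+1.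
Proof. by case: s => [|[|q] r] // _; rewrite /wsize /=; lia. Qed.

Lemma desc_decr s i : (0 < i < wsize (decr s))%N ->
  (i \in desc (of_state s)) = (i \in desc (of_state (decr s))).
Proof.
case: s => [|[|q] r] //= iN; last by rewrite !mem_desc.
rewrite mem_desc; have /negPf-> : i != wsize r by lia.
by case: r iN => [|p r] iN; [move: iN; rewrite /wsize /=; lia|rewrite orbF].
Qed.

Lemma desc_last s : (0 < wsize (decr s))%N ->
  (wsize (decr s) \in desc (of_state s)) = (head 0%N s == 0%N).
Proof.
case: s => [|[|q] r] //= iN; first by rewrite mem_desc eqxx orbT; case: r iN.
have -> : wsize (q :: r) \in desc (of_state (q.+1 :: r)) =
    (wsize (q :: r) \in desc (of_state (q :: r))).
  by rewrite !mem_desc.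
by apply/negP => /desc_lt; rewrite ltnn.
Qed.

Lemma blk_rcons S T i : (0 < i <= size S)%N -> blk (rcons S T) i = blk S i.
Proof.
move=> iS; have h : (i.-1 < size S)%N by case: i iS.
by rewrite /blk nth_rcons h.
Qed.

Lemma blk_last S T : blk (rcons S T) (size S).+1 = T.
Proof. by rewrite /blk nth_rcons ltnn eqxx. Qed.

Lemma link_block_rel bar q U F T : U != fset0 -> T != fset0 ->
  link bar q (U :: F) T <-> block_rel bar (q == 0%N) U T.
Proof.
move=> U0 T0; rewrite /block_rel /= fsleP //.
case: q => [|q] /=; [case: bar; rewrite ?fsltP //|];
split=> -[le H]; split=> // c; rewrite ?inE => cT.
- by case/andP: cT; apply: H.
- by move=> cT'; apply: H; rewrite inE cT cT'.
- by case/andP: cT; apply: H.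
- by move=> cT'; apply: H; rewrite inE cT cT'.
Qed.

(** Dropping the last block drops the last box of the composition. The link before it is a descent
    exactly when the last part is 1 ([desc_last]), and the earlier descents stay ([desc_decr]). *)
Lemma Kfill_rcons bar s S T : Kfill bar (of_state s) (rcons S T) <->
  [/\ s != [::], T != fset0, link bar (head 0%N s) (rev S) T
    & Kfill bar (of_state (decr s)) S].
Proof.
rewrite /Kfill !sumn_of_state size_rcons; split.
  move=> [sz nz rel first]; have s0 : s != [::] by case: s sz {rel first}.
  have T0 : T != fset0 by apply: nz; rewrite mem_rcons inE eqxx.
  have szS : size S = wsize (decr s) by move: sz; rewrite (wsize_decr s0) => -[].
  have nzS U : U \in S -> U != fset0.
    by move=> US; apply: nz; rewrite mem_rcons inE US orbT.
  split=> //.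
    case/lastP: S szS nzS sz rel first {nz} => [|S U] szS nzS sz rel first.
      by move=> b c cT; apply: first => //; rewrite -sz.
    rewrite rev_rcons link_block_rel //; last by apply: nzS; rewrite mem_rcons inE eqxx.
    have N0 : (0 < wsize (decr s))%N by rewrite -szS size_rcons.
    have := rel (wsize (decr s)); rewrite N0 (wsize_decr s0) ltnS leqnn desc_last //.
    rewrite -szS blk_last blk_rcons ?leqnn ?size_rcons // blk_last.
    by apply.
  split=> // [i iN|b N0 c cS].
    have := rel i; rewrite (wsize_decr s0) ltnS desc_decr // !blk_rcons ?szS; try lia.
    by apply; lia.
  by apply: first => //; rewrite ?(wsize_decr s0) // blk_rcons // szS N0.
move=> [s0 T0 lT [szS nz rel first]]; split.
- by rewrite szS -(wsize_decr s0).
- by move=> U; rewrite mem_rcons inE => /orP[/eqP->|/nz].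
- move=> i iN; have [iS|iS] := ltnP i (wsize (decr s)).
    rewrite desc_decr; last by lia.
    by rewrite !blk_rcons ?szS; [apply: rel; lia|lia|lia].
  have iE : i = wsize (decr s) by rewrite (wsize_decr s0) in iN; lia.
  rewrite iE desc_last; last by lia.
  case/lastP: S szS nz lT {rel first} => [|S U] szS nz lT.
    by rewrite iE -szS in iN.
  rewrite -szS blk_last blk_rcons ?size_rcons ?leqnn // blk_last.
  rewrite rev_rcons link_block_rel // in lT.
  by apply: nz; rewrite mem_rcons inE eqxx.
- move=> b _ c cS; case: S szS lT first cS {nz rel} => [|U S] szS lT first cS.
    by apply: lT.
  by apply: first => //; rewrite -szS.
Qed.

Lemma KfillP bar s S : Kfill bar (of_state s) S <-> fill bar s (rev S).
Proof.
elim/last_ind: S s => [|S T IHS] s.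
  split=> [[sz _ _ _]|].
    by move: sz; rewrite sumn_of_state /=; case: s => // q r; rewrite /wsize /=; lia.
  by move=> /= ->; split=> // i; rewrite ltn0 andbF.
rewrite Kfill_rcons rev_rcons /=; split=> -[s0 T0 lT fS]; split=> //;
by apply/IHS.
Qed.

End PeakFillings.

Section PeakFunctions.
Variables (R : comNzRingType) (beta : R).

Definition Kfun (bar : bool) (a : peak_composition) : pseries R :=
  if bar then Kbarpeak beta a else Kpeak beta a.

Definition peak_state (a : peak_composition) : state := to_state (val a).

Lemma peak_pos (a : peak_composition) : all (leq 1) (val a).
Proof. by case/andP: (valP a). Qed.

Lemma of_peak_state (a : peak_composition) : of_state (peak_state a) = val a.
Proof. by rewrite /peak_state to_stateK ?peak_pos. Qed.

Lemma mblk_rev S : mblk (rev S) = mblk S.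
Proof. by rewrite /mblk big_rev. Qed.

Lemma Kfun_mon_sum bar (a : peak_composition) : Kfun bar a =
  mon_sum [set S | Kfill bar (val a) S] (fun S => beta ^+ (nblk S - sumn (val a))) mblk.
Proof.
case: bar; rewrite /Kfun /Kbarpeak /Kpeak; congr mon_sum; rewrite predeqE => S.
  by rewrite KbarsetE.
by rewrite KsetE.
Qed.

Lemma mblk_letter (S : seq {fset nat}) (T : {fset nat}) c :
  T \in S -> c \in T -> (0 < mblk S c./2)%N.
Proof.
elim: S => // U S IHS; rewrite inE mblk_cons cmM addn_gt0 => /orP[/eqP<-|TS] cT.
  by rewrite (big_fsetD1 c) //= cmM ucmE eqxx.
by rewrite IHS ?orbT.
Qed.

(** A filling that contributes to [m] uses only letters below 2k, since a larger letter would give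
    [m] a variable of index at least k. The sum therefore runs over a finite list. *)
Lemma KfunE bar (a : peak_composition) (m : monomial) k :
  (forall i, (k <= i)%N -> m i = 0%N) ->
  Kfun bar a m = krow beta bar (exps k m) (peak_state a).
Proof.
move=> mk; rewrite Kfun_mon_sum /mon_sum; set s := peak_state a.
have aE : val a = of_state s by rewrite of_peak_state.
have [fs_uniq fsP] := fillingsP bar k.*2 s.
have fillE S : Kfill bar (val a) S <-> fill bar s (rev S) by rewrite aE; apply: KfillP.
rewrite (fsbigE (map rev (fillings bar k.*2 s))); first last.
- move=> S /= SK; apply: contraNeq => Sm0; have mS : mblk S = m.
    by apply/eqP; apply: contraNT Sm0 => /negPf->; rewrite mulr0.
  apply/mapP; exists (rev S); last by rewrite revK.
  apply/fsP; split; first exact/fillE.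
  move=> T c; rewrite mem_rev => TS cT; have := mblk_letter TS cT; rewrite mS.
  have [kc|ck _] := leqP k c./2; first by rewrite mk.
  by rewrite -(odd_double_half c); case: (odd c); lia.
- by move=> _ /= /mapP[F /fsP[fF _] ->]; apply/fillE; rewrite revK.
- by rewrite map_inj_uniq //; apply: can_inj revK.
rewrite -(@sum_fillings _ beta bar k) ?size_map ?size_iota // big_map big_seq_cond.
rewrite [RHS]big_seq_cond; apply: eq_big => F.
  rewrite andbT; case FF: (F \in _) => //=; apply/idP; rewrite inE /=; apply/fillE.
  by rewrite revK; have [] := (fsP F).1 FF.
move=> /andP[/fsP[fF kF] _]; rewrite mblk_rev /excess.
have sz : size F = sumn (val a).
  by have [] : Kfill bar (val a) (rev F) by [apply/fillE; rewrite revK]; rewrite size_rev.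
rewrite sz /nblk big_rev; congr (_ * (nat_of_bool _)%:R).
apply/eqP/eqP => [->//|E]; apply/eqP/cmP => i.
have [ki|ik] := leqP k i; first by rewrite (letters_exps kF) // mk.
have := congr1 (fun t => nth 0%N t i) E.
by rewrite !(nth_map 0%N) ?size_iota // nth_iota.
Qed.

End PeakFunctions.


(** * The two spans *)

Section Indices.

Definition low_comps (n : nat) : seq composition :=
  undup (pmap insub (map of_state (low_states n))).

Definition low_peaks (n : nat) : seq peak_composition :=
  undup (pmap insub (map of_state (low_states n))).

Definition comp_state (a : composition) : state := to_state (val a).

Lemma of_comp_state (a : composition) : of_state (comp_state a) = val a.
Proof. by rewrite /comp_state to_stateK ?comp_pos. Qed.

Lemma low_compsP (a : composition) n :
  (wsize (comp_state a) <= n)%N -> a \in low_comps n.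
Proof.
move=> an; rewrite mem_undup mem_pmap_sub; apply/mapP; exists (comp_state a).
  exact: low_statesP.
by rewrite of_comp_state.
Qed.

Lemma low_peaksP (a : peak_composition) n :
  (wsize (peak_state a) <= n)%N -> a \in low_peaks n.
Proof.
move=> an; rewrite mem_undup mem_pmap_sub; apply/mapP; exists (peak_state a).
  exact: low_statesP.
by rewrite of_peak_state.
Qed.

Lemma comp_state_inj : injective comp_state.
Proof. by move=> a b ab; apply: val_inj; rewrite -!of_comp_state ab. Qed.

Lemma peak_state_inj : injective peak_state.
Proof. by move=> a b ab; apply: val_inj; rewrite -!of_peak_state ab. Qed.

Lemma peak_stateP (a : peak_composition) : is_peak (peak_state a).
Proof.
have /andP[_] := valP a; rewrite /is_peak /peak_state /to_state.
case/lastP: (val a) => [|c n] //; rewrite size_rcons /= -cats1 take_size_cat //.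
rewrite map_cat rev_cat /= all_rev all_map => /allP cP; apply/allP => i /cP /=.
by case: i => [|[]].
Qed.

Lemma peak_of_state (s : state) : is_peak s ->
  all (leq 1) (of_state s) && all (leq 2) (take (size (of_state s)).-1 (of_state s)).
Proof.
rewrite of_state_pos /=; case: s => [|q r] //= rP.
rewrite of_state_cons size_rcons /= -cats1 take_size_cat // /of_state all_map all_rev.
exact: rP.
Qed.

Definition peak_nil : peak_composition := exist _ [::] isT.

Definition mk_peak (s : state) : peak_composition := insubd peak_nil (of_state s).

Lemma mk_peakK (s : state) : is_peak s -> peak_state (mk_peak s) = s.
Proof.
move=> sP; rewrite /peak_state /mk_peak val_insubd peak_of_state //.
exact: of_stateK.
Qed.

Definition peak_comp (a : peak_composition) : composition := exist _ (val a) (peak_pos a).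

Lemma is_peak_peak (s : state) : is_peak (peak s).
Proof.
case: s => // q r; rewrite /is_peak /peak.
elim: r q => [|p r IHr] q //; case: p => [|p]; first exact: (IHr q.+1).
have [t [r' [_ E]]] := lamS p r.
have := IHr p.+1; rewrite /= E /= => ->.
by [].
Qed.

Lemma wsize_peak (s : state) : wsize (peak s) = wsize s.
Proof.
case: s => // q r; rewrite /peak.
elim: r q => [|[|p] r IHr] q //=; rewrite ?IHr; rewrite /wsize /=; try lia.
by have := IHr p.+1; rewrite /wsize /=; lia.
Qed.

End Indices.

(** * Hopf structures on the spans of K and Kbar *)

Section Assembly.
Variables (R : comNzRingType) (beta : R).
Hypothesis two_reg : forall x : R, 2 * x = 0 -> x = 0.

Definition Kcoord bar (a : peak_composition) (c : composition) : R :=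
  krow beta bar (val c) (peak_state a).

Lemma qsym_coord_Kfun bar a : qsym_coord (Kfun beta bar a) = Kcoord bar a.
Proof.
apply: funext => c; rewrite /qsym_coord (@KfunE _ _ _ _ _ (size (val c))) ?exps_xmon //.
by move=> i ci; rewrite xmon_iotaE // nth_default.
Qed.

Lemma krow_del0 bar c : krow beta bar (del0 c) = krow beta bar c.
Proof.
elim/last_ind: c => // c n IHc; rewrite krow_rcons -cats1 del0_cat -IHc.
case: n => [|n]; last by rewrite cats1 krow_rcons.
by rewrite cats0 vstep0.
Qed.

Lemma Kfun_comp_of bar a m : Kfun beta bar a m = Kcoord bar a (comp_of m).
Proof. by rewrite (KfunE beta bar a (@mboundP m)) /Kcoord /= krow_del0. Qed.

Lemma Kfun_size bar a m : Kfun beta bar a m != 0 ->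
  (wsize (peak_state a) <= sumn (mcomp m))%N.
Proof.
rewrite Kfun_comp_of; apply: contraNT; rewrite -ltnNge => am.
by rewrite /Kcoord krow_size.
Qed.

Lemma Kcoord_size bar a c : Kcoord bar a c != 0 ->
  (wsize (peak_state a) <= sumn (val c))%N.
Proof. by apply: contraNT; rewrite -ltnNge => am; rewrite /Kcoord krow_size. Qed.

Lemma summable_Kfun bar : summable (Kfun beta bar).
Proof.
move=> m; apply: (@sub_finite_set _ _ [set` low_peaks (sumn (mcomp m))]).
  by move=> a /= /Kfun_size; apply: low_peaksP.
exact: finite_seq.
Qed.

Lemma summable_Kcoord bar : summable (Kcoord bar).
Proof.
move=> c; apply: (@sub_finite_set _ _ [set` low_peaks (sumn (val c))]).
  by move=> a /= /Kcoord_size; apply: low_peaksP.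
exact: finite_seq.
Qed.

Let phi := lc_comb (Kcoord false).
Let phib := lc_comb (Kcoord true).

Lemma finmap_phi bar : finmap (lc_comb (Kcoord bar)).
Proof. exact/finmap_lc_comb/summable_Kcoord. Qed.

Definition Ksquare (a a' : peak_composition) : R := Kcoord true a (peak_comp a').
Definition peak_rank (a : peak_composition) : nat := rank (peak_state a).

Lemma low_peaks_rank a n : (peak_rank a <= n)%N -> a \in low_peaks n.
Proof. by move/rank_low/low_peaksP. Qed.

Lemma Ksquare_above a a' : (peak_rank a' <= peak_rank a)%N -> Ksquare a a' = (a == a')%:R.
Proof.
move=> aa'; rewrite /Ksquare /Kcoord /= -of_peak_state krow_tri.
  by rewrite (inj_eq peak_state_inj).
exact: rank_above.
Qed.

Lemma Ksquare_tri a a' : Ksquare a a' != 0 -> a = a' \/ (peak_rank a < peak_rank a')%N.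
Proof.
have [lt|ge] := ltnP (peak_rank a) (peak_rank a'); first by right.
by rewrite Ksquare_above //; have [->|_] := eqVneq a a'; [left|rewrite eqxx].
Qed.

Lemma Ksquare_diag a : Ksquare a a * 1 = 1.
Proof. by rewrite Ksquare_above // eqxx mulr1. Qed.

(** Reads candidate Kbar-coordinates off the peak monomials. The square matrix there is
    unitriangular, so no division occurs. *)
Definition retract (f : composition -> R) : peak_composition -> R :=
  tri_inv peak_rank low_peaks Ksquare (fun=> 1) (fun a => f (peak_comp a)).

Lemma finmap_retract : finmap retract.
Proof.
apply: finmap_comp; first exact: finmap_tri_inv.
exact: finmap_reindex.
Qed.

Lemma low_peaks_uniq n : uniq (low_peaks n).
Proof. exact: undup_uniq. Qed.

Lemma retractK c : retract (lc_comb (Kcoord true) c) = c.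
Proof.
exact: (tri_combK low_peaks_uniq low_peaks_rank Ksquare_tri Ksquare_diag c).
Qed.

Lemma retract_peak f a :
  lc_comb (Kcoord true) (retract f) (peak_comp a) = f (peak_comp a).
Proof.
exact: (congr1 (@^~ a) (tri_invK low_peaks_uniq low_peaks_rank Ksquare_tri
  Ksquare_diag (fun a => f (peak_comp a)))).
Qed.

Lemma Kbar_peak_inj c d :
  (forall a, lc_comb (Kcoord true) c (peak_comp a) =
             lc_comb (Kcoord true) d (peak_comp a)) ->
  c = d.
Proof.
move=> cd; rewrite -[c]retractK -[d]retractK /retract.
by congr tri_inv; apply: funext.
Qed.

Fixpoint thick_list (s : state) : seq (R * state) :=
  if s is q :: r then
    [seq (2 * p.1, q :: p.2) | p <- thick_list r] ++
    [seq (beta * p.1, q.+1 :: p.2) | p <- thick_list r]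
  else [:: (1, [::])].

Lemma thick_listE g s : thicken beta g s = \sum_(p <- thick_list s) p.1 * g p.2.
Proof.
elim: s g => [|q r IHr] g /=; first by rewrite big_seq1 mul1r.
rewrite big_cat !big_map /= !IHr !mulr_sumr.
by congr (_ + _); apply: eq_bigr => p _; rewrite mulrA.
Qed.

Lemma thick_list_pos s p : p \in thick_list s -> all (leq 1) s -> all (leq 1) p.2.
Proof.
elim: s p => [|q r IHr] p /=; first by rewrite inE => /eqP->.
rewrite mem_cat => /orP[] /mapP[p' /IHr H ->] /= /andP[q_pos /H ->];
by rewrite ?andbT.
Qed.

Lemma thick_list_peak s p : p \in thick_list s -> is_peak s -> is_peak p.2.
Proof.
case: s => [|q r] /=; first by rewrite inE => /eqP->.
by rewrite mem_cat => /orP[] /mapP[p' /thick_list_pos H ->].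
Qed.

Definition thick (a a' : peak_composition) : R :=
  \sum_(p <- thick_list (peak_state a)) p.1 * (a' == mk_peak p.2)%:R.

Lemma thickE a a' :
  thick a a' = thicken beta (fun s => (s == peak_state a')%:R) (peak_state a).
Proof.
rewrite thick_listE; apply: eq_big_seq => p ps; congr (_ * (nat_of_bool _)%:R).
rewrite -(inj_eq peak_state_inj) mk_peakK 1?eq_sym //.
exact: thick_list_peak ps (peak_stateP a).
Qed.

Lemma thicken0 s : thicken beta (fun=> 0) s = 0.
Proof. by elim: s => //= q r ->; rewrite !mulr0 addr0. Qed.

(** Every d other than 0 enlarges the state and cannot reach [t]; d = 0 contributes one factor 2 per
    part. *)
Lemma thicken_delta s t : (wsize t <= wsize s)%N ->
  thicken beta (fun u => (u == t)%:R) s = (s == t)%:R * 2 ^+ size s.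
Proof.
elim: s t => [|q r IHr] t ts; first by rewrite /= expr0 mulr1.
case: t ts => [|p t] ts; first by rewrite /= !thicken0 !mulr0 addr0 mul0r.
have thick_cons k : thicken beta (fun u => (k :: u == p :: t)%:R) r =
    if k == p then thicken beta (fun u => (u == t)%:R) r else 0.
  rewrite -[X in if _ then _ else X](thicken0 r).
  by have [->|kp] := eqVneq k p; congr thicken; apply: funext => u;
    rewrite eqseq_cons ?eqxx ?(negPf kp).
rewrite thickenE !thick_cons eqseq_cons.
have [E|qp] := eqVneq q p.
  rewrite -E (gtn_eqF (ltnSn q)) mulr0 addr0 IHr; last first.
    by move: ts; rewrite -E /wsize /=; lia.
  by rewrite /= exprS mulrCA.
rewrite mulr0 add0r mul0r; case: eqP => [E|_]; last by rewrite mulr0.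
rewrite IHr; last by move: ts; rewrite /wsize -E /=; lia.
case: eqP => [rt|_]; last by rewrite mul0r mulr0.
by move: ts; rewrite -E rt /wsize /=; lia.
Qed.

Lemma thick_above a a' : (wsize (peak_state a') <= wsize (peak_state a))%N ->
  thick a a' = (a == a')%:R * 2 ^+ size (peak_state a).
Proof. by move=> aa'; rewrite thickE thicken_delta // (inj_eq peak_state_inj). Qed.

Lemma thick_tri a a' : thick a a' != 0 ->
  a = a' \/ (wsize (peak_state a) < wsize (peak_state a'))%N.
Proof.
have [lt|ge] := ltnP (wsize (peak_state a)) (wsize (peak_state a')); first by right.
rewrite thick_above //; have [->|_] := eqVneq a a'; first by left.
by rewrite mul0r eqxx.
Qed.

Lemma thick_diag a : thick a a = 2 ^+ size (peak_state a).
Proof. by rewrite thick_above // eqxx mul1r. Qed.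

Lemma thick_reg a x : x * thick a a = 0 -> x = 0.
Proof.
rewrite thick_diag; elim: (size _) x => [|n IHn] x; first by rewrite mulr1.
by rewrite exprS mulrCA => /two_reg/IHn.
Qed.

Lemma finmap_thick : finmap (lc_comb thick).
Proof. exact/finmap_lc_comb/(tri_summable low_peaksP thick_tri). Qed.

Lemma phi_thick c : phi c = phib (lc_comb thick c).
Proof.
apply: funext => d; apply: (@fin_ext _ _ (fun c => phi c d)
  (fun c => phib (lc_comb thick c) d)) => [||a]; first exact: finmap_phi.
  exact: (fin_comp (finmap_phi true d) finmap_thick).
rewrite /phi !lc_comb_basis {1}/Kcoord krow_thicken ?peak_stateP // thick_listE.
transitivity (phib (fun a' => \sum_(p <- thick_list (peak_state a))
    p.1 * basis_vec R (mk_peak p.2) a') d); last by [].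
rewrite /phib (fin_sumE (finmap_phi true d)); apply: eq_big_seq => p ps.
rewrite (finZE (finmap_phi true d)) lc_comb_basis /Kcoord mk_peakK //.
exact: thick_list_peak ps (peak_stateP a).
Qed.

Lemma thick_inj : injective (lc_comb thick).
Proof. exact: (tri_comb_inj low_peaks_uniq low_peaksP thick_tri thick_reg). Qed.

Lemma phib_inj : injective phib.
Proof. exact: can_inj retractK. Qed.

Lemma phi_inj : injective phi.
Proof. by move=> c d; rewrite !phi_thick => /phib_inj/thick_inj. Qed.

Definition fundamental (a c : composition) : R := lrow beta (val c) (comp_state a).
Definition comp_rank (a : composition) : nat := rank (comp_state a).

Lemma low_comps_rank a n : (comp_rank a <= n)%N -> a \in low_comps n.
Proof. by move/rank_low/low_compsP. Qed.

Lemma low_comps_uniq n : uniq (low_comps n).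
Proof. exact: undup_uniq. Qed.

Lemma fundamental_above a c : (comp_rank c <= comp_rank a)%N ->
  fundamental a c = (a == c)%:R.
Proof.
move=> ac; rewrite /fundamental -of_comp_state lrow_tri ?(inj_eq comp_state_inj) //.
exact: rank_above.
Qed.

Lemma fundamental_tri a c : fundamental a c != 0 ->
  a = c \/ (comp_rank a < comp_rank c)%N.
Proof.
have [lt|ge] := ltnP (comp_rank a) (comp_rank c); first by right.
by rewrite fundamental_above //; have [->|_] := eqVneq a c; [left|rewrite eqxx].
Qed.

Lemma fundamental_diag a : fundamental a a * 1 = 1.
Proof. by rewrite fundamental_above // eqxx mulr1. Qed.

Lemma summable_fundamental : summable fundamental.
Proof. exact: (tri_summable low_comps_rank fundamental_tri). Qed.

(** The matrix of L_a |-> K_(peak a), that is, of Theta with its values written in K-coordinates. *)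
Definition collapse (a : composition) (p : peak_composition) : R :=
  (p == mk_peak (peak (comp_state a)))%:R.

Lemma summable_collapse : summable collapse.
Proof.
move=> p; apply: (@sub_finite_set _ _ [set` low_comps (wsize (peak_state p))]).
  move=> a /=; rewrite /collapse.
  have [-> _|_] := eqVneq p (mk_peak (peak (comp_state a))); last by rewrite eqxx.
  by apply: low_compsP; rewrite mk_peakK ?is_peak_peak // wsize_peak.
exact: finite_seq.
Qed.

(** Expansion in the L_a followed by [collapse]: Theta factors through it ([phi_project]). *)
Definition project (u : composition -> R) : peak_composition -> R :=
  lc_comb collapse (tri_inv comp_rank low_comps fundamental (fun=> 1) u).

Definition lift_peaks (v : peak_composition -> R) : composition -> R :=
  lc_comb (fun a => fundamental (peak_comp a)) v.

Lemma summable_lift_peaks : summable (fun a => fundamental (peak_comp a)).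
Proof.
move=> c; apply: (@sub_finite_set _ _ [set` low_peaks (rank (comp_state c))]).
  move=> a /= /fundamental_tri ac; apply: low_peaks_rank.
  rewrite -[peak_rank a]/(comp_rank (peak_comp a)).
  by case: ac => [->|/ltnW].
exact: finite_seq.
Qed.

Lemma finmap_project : finmap project.
Proof.
apply: finmap_comp; first exact/finmap_lc_comb/summable_collapse.
exact: finmap_tri_inv.
Qed.

Lemma finmap_lift_peaks : finmap lift_peaks.
Proof. exact/finmap_lc_comb/summable_lift_peaks. Qed.

Lemma theta_comp_fundamental a c :
  theta beta (fundamental a) c = krow beta false (val c) (comp_state a).
Proof. exact: (congr1 (@^~ c) (theta_fundamental beta (comp_state a))). Qed.

Lemma phi_project u : phi (project u) = theta beta u.
Proof.
rewrite -[in RHS](tri_invK low_comps_uniq low_comps_rank fundamental_tri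
  fundamental_diag u).
rewrite /project; move: (tri_inv _ _ _ _ u) => v; apply: funext => c.
apply: (@fin_ext _ _ (fun v => phi (lc_comb collapse v) c)
  (fun v => theta beta (lc_comb fundamental v) c)) => [||a].
- apply: (fin_comp (finmap_phi false c)).
  exact/finmap_lc_comb/summable_collapse.
- apply: (fin_comp (finmap_theta beta c)).
  exact/finmap_lc_comb/summable_fundamental.
- rewrite !lc_comb_basis theta_comp_fundamental -krow_peak.
  rewrite -(mk_peakK (is_peak_peak (comp_state a))).
  by rewrite -[collapse a]/(basis_vec R _) /phi lc_comb_basis.
Qed.

Lemma theta_lift_peaks v : theta beta (lift_peaks v) = phi v.
Proof.
apply: funext => c; apply: (@fin_ext _ _ (fun v => theta beta (lift_peaks v) c)
  (fun v => phi v c)) => [||a].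
- exact: (fin_comp (finmap_theta beta c) finmap_lift_peaks).
- exact: finmap_phi.
- by rewrite /lift_peaks /phi !lc_comb_basis theta_comp_fundamental.
Qed.

Let A := qsym_ops (@qsym_antipode R).
Let AP : lc_hopf A := @qsym_hopf R.
Let mulP : finmap (@qsym_mul R) := @finmap_qsym_mul R.
Let comulP : finmap (@qsym_comul R) := @finmap_qsym_comul R.
Let counitP : fin (@qsym_counit R) := @fin_qsym_counit R.
Let antipodeP : finmap (@qsym_antipode R) := @finmap_qsym_antipode R.
Let phiP : finmap phi := finmap_phi false.
Let phibP : finmap phib := finmap_phi true.

(** [lift_peaks] need not respect the operations, but [phi] composed with [project], and [theta]
    composed with [lift_peaks], are Theta and [phi]. After applying [phi] only the Hopf endomorphism
    Theta is left. *)
Definition peak_ops : lc_ops R peak_composition := LCOps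
  (fun w => project (qsym_mul (lc_tens lift_peaks lift_peaks w)))
  (project (@qsym_one R))
  (fun u => lc_tens project project (qsym_comul (lift_peaks u)))
  (fun u => qsym_counit (phi u))
  (fun u => project (qsym_antipode (lift_peaks u))).

Lemma peak_restricts : lc_restricts A (Kcoord false) peak_ops.
Proof.
have thetaP := finmap_theta beta.
split=> /= [w||u|//|u].
- rewrite -/phi phi_project thetaM lc_tens_comp //; last exact: finmap_lift_peaks.
  by congr qsym_mul; congr (lc_tens _ _ w); apply: funext => v; apply: theta_lift_peaks.
- by rewrite -/phi phi_project theta1.
- rewrite -/phi lc_tens_comp //; last exact: finmap_project.
  rewrite -theta_lift_peaks -thetaD; congr (lc_tens _ _ _);
  by apply: funext => v; apply: phi_project.
- by rewrite -/phi phi_project theta_antipode theta_lift_peaks.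
Qed.

Lemma peak_hopf : lc_hopf peak_ops.
Proof.
have sP := finmap_lift_peaks; have pP := finmap_project.
have [rM r1 rD re rS] := peak_restricts.
apply: (lc_hopf_restrict phiP phi_inj AP) => //=.
- apply: finmap_comp => //; apply: finmap_comp => //; exact: finmap_lc_tens.
- apply: finmap_comp; first exact: finmap_lc_tens.
  exact: finmap_comp.
- exact: fin_comp.
- apply: finmap_comp => //; exact: finmap_comp.
Qed.

(** An operation on Kbar-combinations is a priori only known to land in mQSym, where [retract] may
    forget information; that it does not is the point of [peakbar_restricts]. *)
Definition peakbar_ops : lc_ops R peak_composition := LCOps
  (fun w => retract (qsym_mul (lc_tens phib phib w)))
  (retract (@qsym_one R))
  (fun u => lc_tens retract retract (qsym_comul (phib u)))
  (fun u => qsym_counit (phib u))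
  (fun u => retract (qsym_antipode (phib u))).

Let dense (xi xi' : (peak_composition -> R) -> R) : fin xi -> fin xi' ->
  (forall c, xi (lc_comb thick c) = xi' (lc_comb thick c)) -> forall u, xi u = xi' u.
Proof. exact: (tri_dense thick_tri thick_reg). Qed.

Lemma retract_phi c : phib (retract (phi c)) = phi c.
Proof. by rewrite phi_thick retractK. Qed.

Lemma phi_thickE : phi = fun c => phib (lc_comb thick c).
Proof. by apply: funext => c; apply: phi_thick. Qed.

(* Both sides of each identity are finite functionals, and they agree on the
   image of [thick], i.e. on the span of the K_a, where they hold by
   [peak_restricts]. *)
Lemma peakbar_restricts : lc_restricts A (Kcoord true) peakbar_ops.
Proof.
have [rM r1 rD re rS] := peak_restricts; have rP := finmap_retract.
have tP := finmap_thick.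
split=> /= [w||u|//|u].
- rewrite -/phib; apply: funext => c; move: w.
  apply: (tens_dense tP dense) => [||w].
  + apply: (fin_comp (phibP c)); apply: finmap_comp => //.
    by apply: finmap_comp => //; exact: finmap_lc_tens.
  + by apply: (fin_comp (mulP c)); exact: finmap_lc_tens.
  rewrite lc_tens_comp // -phi_thickE -[qsym_mul _]/(lc_mul A _) -rM.
  by rewrite retract_phi.
- by rewrite -/phib -[qsym_one R]/(lc_one A) -r1 retract_phi.
- rewrite -/phib; apply: funext => -[c d]; move: u; apply: dense => [||u].
  + apply: (fin_comp (finmap_lc_tens phibP phibP (c, d))).
    apply: finmap_comp; first exact: finmap_lc_tens.
    exact: finmap_comp.
  + exact: (fin_comp (comulP (c, d))).
  rewrite -phi_thick -[qsym_comul _]/(lc_comul A _) -rD.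
  move: (lc_comul peak_ops u) => v.
  rewrite -/phi !lc_tens_comp //; last exact: finmap_comp.
  rewrite (_ : (fun v => phib (retract (phi v))) = phi) //.
  by apply: funext => v'; apply: retract_phi.
- rewrite -/phib; apply: funext => c; move: u; apply: dense => [||u].
  + apply: (fin_comp (phibP c)); apply: finmap_comp => //; exact: finmap_comp.
  + exact: (fin_comp (antipodeP c)).
  by rewrite -phi_thick -[qsym_antipode _]/(lc_antipode A _) -rS retract_phi.
Qed.

Lemma peakbar_hopf : lc_hopf peakbar_ops.
Proof.
have rP := finmap_retract; have [rM r1 rD re rS] := peakbar_restricts.
apply: (lc_hopf_restrict phibP phib_inj AP) => //=.
- apply: finmap_comp => //; apply: finmap_comp => //; exact: finmap_lc_tens.
- apply: finmap_comp; first exact: finmap_lc_tens.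
  exact: finmap_comp.
- exact: fin_comp.
- apply: finmap_comp => //; exact: finmap_comp.
Qed.

Lemma Kfun_coordE bar : (@qsym_coord R) \o (Kfun beta bar) = Kcoord bar.
Proof. by apply: funext => a; apply: qsym_coord_Kfun. Qed.

Lemma qsym_coord_comb bar c :
  qsym_coord (lc_comb (Kfun beta bar) c) = lc_comb (Kcoord bar) c.
Proof. by rewrite -Kfun_coordE. Qed.

Lemma lc_comb_Kfun bar c m :
  lc_comb (Kfun beta bar) c m = lc_comb (Kcoord bar) c (comp_of m).
Proof. by apply: eq_fsbigr => a _; rewrite Kfun_comp_of. Qed.

Lemma lc_span_mQSym bar : lc_span (Kfun beta bar) `<=` mQSym R.
Proof.
by move=> _ [c _ <-]; apply/mQSymP => m; rewrite qsym_coord_comb lc_comb_Kfun.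
Qed.

Lemma Kcoord_inj bar : injective (lc_comb (Kcoord bar)).
Proof. by case: bar; [exact: phib_inj|exact: phi_inj]. Qed.

Lemma Kfun_hopf_sub bar :
  mQSym_hopf_sub (lc_span (Kfun beta bar)) (Kfun beta bar).
Proof.
split; first exact: lc_span_mQSym.
  split=> // [|c d cd]; first exact: summable_Kfun.
  by apply: (@Kcoord_inj bar); rewrite -!qsym_coord_comb cd.
exists (@qsym_antipode R); split; first exact: AP.
rewrite /lc_hopf_sub Kfun_coordE; split.
  split; [exact: summable_Kcoord|exact: Kcoord_inj|].
  rewrite /lc_span predeqE => u; split.
    by move=> [_ [c _ <-] <-]; exists c => //; rewrite qsym_coord_comb.
  move=> [c _ <-]; exists (lc_comb (Kfun beta bar) c); last exact: qsym_coord_comb.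
  by exists c.
case: bar; [exists peakbar_ops|exists peak_ops]; split.
- exact: peakbar_hopf.
- exact: peakbar_restricts.
- exact: peak_hopf.
- exact: peak_restricts.
Qed.

Lemma Kfun_thick c :
  lc_comb (Kfun beta false) c = lc_comb (Kfun beta true) (lc_comb thick c).
Proof.
by apply: funext => m; rewrite !lc_comb_Kfun -/phi phi_thick.
Qed.

Lemma thick_surj (h : R) : 2 * h = 1 -> forall d, exists c, lc_comb thick c = d.
Proof.
move=> h2 d; exists (tri_inv (fun a => wsize (peak_state a)) low_peaks thick
  (fun a => h ^+ size (peak_state a)) d).
apply: (tri_invK low_peaks_uniq low_peaksP thick_tri) => a.
by rewrite thick_diag -exprMn h2 expr1n.
Qed.

End Assembly.

Section BaseChange.
Variables (R R' : comNzRingType) (f : {rmorphism R -> R'}) (beta : R).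

Lemma rmorph_lc_comb_Kfun bar c m :
  f (lc_comb (Kfun beta bar) c m) =
  lc_comb (Kfun (f beta) bar) (fun a => f (c a)) m.
Proof.
rewrite !(@lc_combE _ _ _ _ _ _ (low_peaks (sumn (mcomp m)))) ?low_peaks_uniq //.
- rewrite rmorph_sum; apply: eq_bigr => a _; rewrite rmorphM.
  by rewrite !(KfunE _ _ _ (@mboundP m)) rmorph_krow.
- by move=> a /Kfun_size; apply: low_peaksP.
- by move=> a /Kfun_size; apply: low_peaksP.
Qed.

End BaseChange.

Lemma two_reg_poly (R : idomainType) : (2 : R) != 0 ->
  forall p : {poly R}, 2 * p = 0 -> p = 0.
Proof.
move=> two0 p /eqP; rewrite mulf_eq0 -polyC_natr polyC_eq0 (negPf two0).
by move/eqP.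
Qed.

Theorem theorem4p19 :
  [/\ mQSym_hopf_sub mPiSym (Kpeak ('X : {poly int})),
      mQSym_hopf_sub mPibarSym (Kbarpeak ('X : {poly int})),
      psQ @` mPibarSym = (psQ @` mQSym {poly int}) `&` mPiSymQ
    & psQ @` mPiSym `<=` (psQ @` mQSym {poly int}) `&` mPiSymQ].
Proof.
have two_regZ := @two_reg_poly int isT; have two_regQ := @two_reg_poly rat isT.
have psQ_comb bar c : psQ (lc_comb (Kfun ('X : {poly int}) bar) c) =
    lc_comb (Kfun ('X : {poly rat}) bar) (fun a => map_poly intr (c a)).
  apply: funext => m; rewrite /psQ.
  by rewrite (rmorph_lc_comb_Kfun (map_poly (intr : int -> rat))) /= map_polyX.
split.
- exact: (@Kfun_hopf_sub _ ('X : {poly int}) two_regZ false).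
- exact: (@Kfun_hopf_sub _ ('X : {poly int}) two_regZ true).
- rewrite predeqE => g; split.
    move=> [_ [c _ <-] <-]; split.
      exists (lc_comb (Kfun ('X : {poly int}) true) c); last exact: erefl.
      by apply: (@lc_span_mQSym _ _ true); exists c.
    have h2 : 2 * (2^-1)%:P = 1 :> {poly rat}.
      by rewrite -polyC_natr -polyCM mulfV.
    (* Over Q[beta] the powers of 2 are invertible, so every Kbar-combination is a K-combination. *)
    have [d dE] := thick_surj ('X : {poly rat}) h2 (fun a => map_poly intr (c a)).
    exists d; first exact: I.
    rewrite -[Kpeak _]/(Kfun _ false) Kfun_thick dE.
    exact: esym (psQ_comb true c).
  move=> [[f fQ <-] [v _ vE]].
  (* The candidate coordinates are computed over Z[beta] from the integral series [f]. *)
  pose c := retract ('X : {poly int}) (qsym_coord f).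
  exists (lc_comb (Kfun 'X true) c); first by exists c.
  rewrite psQ_comb -vE -[Kpeak _]/(Kfun _ false) Kfun_thick; congr lc_comb.
  (* Over Q[beta] both series lie in the Kbar-span, so agreement on peak monomials identifies their
     coordinates. There both agree with [f]: one is [psQ f], the other was built by [retract]. *)
  apply: (Kbar_peak_inj (beta := 'X)) => a.
  rewrite -!qsym_coord_comb -psQ_comb -Kfun_thick.
  have -> : lc_comb (Kfun 'X false) v = psQ f by exact: vE.
  rewrite -[LHS]/(map_poly intr (qsym_coord (lc_comb (Kfun 'X true) c) (peak_comp a))).
  by rewrite qsym_coord_comb retract_peak.
- move=> _ [_ [c _ <-] <-]; split.
    exists (lc_comb (Kfun ('X : {poly int}) false) c); last exact: erefl.
    by apply: (@lc_span_mQSym _ _ false); exists c.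
  exists (fun a => map_poly intr (c a)); first exact: I.
  exact: esym (psQ_comb false c).
Qed.
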